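(* Let $\mu \in \Sigma(\mathcal B)$ and let $\alpha : \mathcal B \to \mathcal B$ be a completely positive $\mathbb C$-linear map such that $\alpha - 1$ is completely positive, where $1$ denotes the identity map on $\mathcal B$. Then the distribution $\mu^{\boxplus \alpha}$ belongs to $\Sigma(\mathcal B)$. If moreover $\mu \in \Sigma^0(\mathcal B)$, then $\mu^{\boxplus\alpha} \in \Sigma^0(\mathcal B)$.
   Context: $\mathcal B$ is a fixed unital $C^*$-algebra. Distributions. $\mathcal B\langle \mathcal X\rangle$ is the $*$-algebra of polynomials in a self-adjoint formal variable $\mathcal X$ with coefficients in $\mathcal B$, where $\mathcal X$ and $\mathcal B$ are algebraically independent: as a vector space it is $\bigoplus_{n\ge 0}$ of the spans of the monomials $b_0\mathcal X b_1\cdots \mathcal X b_n$, the $n$-th span being isomorphic to $\mathcal B^{\otimes_{\mathbb C}(n+1)}$. $\Sigma_{alg}(\mathcal B)$ is the set of all $\mathbb C$-linear $\mathcal B$-bimodule maps $\mu:\mathcal B\langle\mathcal X\rangle\to\mathcal B$ with $\mu[b]=b$ for $b\in\mathcal B$. $\Sigma(\mathcal B)$ is the set of those $\mu\in\Sigma_{alg}(\mathcal B)$ that are positive ($\mu[P^*P]\ge 0$ for all $P$; such $\mu$ is automatically completely positive). $\Sigma^0(\mathcal B)\subset\Sigma(\mathcal B)$ is the set of distributions $\mu[b_0\mathcal Xb_1\cdots\mathcal Xb_n]=\mathbb E[b_0Xb_1\cdots Xb_n]$ of self-adjoint elements $X$ of $\mathcal B$-valued $C^*$-probability spaces $(\mathcal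 M,\mathbb E)$ ($\mathcal M\supseteq\mathcal B$ a $C^*$-algebra, $\mathbb E:\mathcal M\to\mathcal B$ a unital positive $\mathcal B$-bimodule map); equivalently, the $\mu \in \Sigma(\mathcal B)$ for which there is $M>0$ with $\|\mu[\mathcal X b_1\mathcal X\cdots b_{n-1}\mathcal X]\|\le M^n\|b_1\|\cdots\|b_{n-1}\|$ for all $n$ and all $b_i\in\mathcal B$. Series. $\mathrm{Ser}(\mathcal B)$ is the set of sequences $F=(F^{[n]})_{n\ge1}$ with $F^{[1]}\in\mathcal B$ and $F^{[n]}:\mathcal B^{n-1}\to\mathcal B$ $\mathbb C$-multilinear. For linear $\alpha:\mathcal B\to\mathcal B$, $(\alpha\circ F)^{[n]}:=\alpha\circ F^{[n]}$. The moment series of $\mu\in\Sigma_{alg}(\mathcal B)$ is $M_\mu^{[1]}=\mu[\mathcal X]$, $M_\mu^{[n]}(b_1,\dots,b_{n-1})=\mu[\mathcal Xb_1\mathcal X\cdots b_{n-1}\mathcal X]$; $\mu\mapsto M_\mu$ is a bijection $\Sigma_{alg}(\mathcal B)\to\mathrm{Ser}(\mathcal B)$. Nested functionals. $NC(n)$ is the set of non-crossing partitions of $\{1,\dots,n\}$. For $F\in\mathrm{Ser}(\mathcal B)$ and $\pi\in NC(n)$, the multilinear map $F^{[\pi]}:\mathcal B^{n-1}\to\mathcal B$ is obtained by reading the string $W_1b_1W_2b_2\cdots W_{n-1}b_{n-1}W_n$ as a parenthesized expression, where: if $m$ is the minimum of a block $V$ with $|V|=k\ge2$ then $W_m$ is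 ''$F^{[k]}($''; if $m$ is the maximum of a block with at least 2 elements then $W_m$ is ''$)$''; if $m\in V$ with $\min V<m<\max V$ then $W_m$ is a comma; if $\{m\}$ is a block then $W_m$ is ''$F^{[1]}$''. Example: for $\pi=\{\{1,4,5\},\{2,3\}\}$, $F^{[\pi]}(b_1,\dots,b_4)=F^{[3]}(b_1F^{[2]}(b_2)b_3,b_4)$. $R$-transform and convolution power. The $R$-transform $R_\mu\in\mathrm{Ser}(\mathcal B)$ of $\mu\in\Sigma_{alg}(\mathcal B)$ is the unique series with $M_\mu^{[n]}=\sum_{\pi\in NC(n)}R_\mu^{[\pi]}$ for all $n\ge1$; $\mu\mapsto R_\mu$ is a bijection $\Sigma_{alg}(\mathcal B)\to\mathrm{Ser}(\mathcal B)$. For linear $\alpha:\mathcal B\to\mathcal B$, $\mu^{\boxplus\alpha}\in\Sigma_{alg}(\mathcal B)$ is the distribution determined by $R_{\mu^{\boxplus\alpha}}=\alpha\circ R_\mu$. *)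

(* Defs.v *)
From HB Require Import structures.
From mathcomp Require Import boolp classical_sets reals.
From mathcomp Require Import all_boot all_order all_algebra.
From mathcomp Require Import generic_quotient.
From mathcomp Require Import complex.

Set Implicit Arguments.
Unset Strict Implicit.
Unset Printing Implicit Defensive.

Import Order.TTheory GRing.Theory Num.Theory.

Local Open Scope ring_scope.
Local Open Scope complex_scope.
Local Open Scope quotient_scope.

(** * Unital C*-algebras *)

(* The library's normed modules cannot be joined with its algebras in one
   hierarchy (its only normed rings are the numDomainTypes), so the complete
   norm is part of the mixin. *)
HB.mixin Record Algebra_isCStar (R : realType) B of GRing.Algebra R[i] B := {
  cnorm : B -> R;
  star : B -> B;
  cnorm_eq0 : forall x : B, cnorm x = 0 -> x = 0;
  cnormD : forall x y : B, cnorm (x + y) <= cnorm x + cnorm y;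
  cnormZ : forall (c : R[i]) (x : B), (cnorm (c *: x))%:C = `|c| * (cnorm x)%:C;
  cnormM : forall x y : B, cnorm (x * y) <= cnorm x * cnorm y;
  cnorm_complete : forall u : nat -> B,
    (forall e : R, 0 < e ->
       exists N, forall m n, (N <= m)%N -> (N <= n)%N -> cnorm (u m - u n) < e) ->
    exists l : B, forall e : R, 0 < e ->
       exists N, forall n, (N <= n)%N -> cnorm (u n - l) < e;
  starK : forall x : B, star (star x) = x;
  starD : forall x y : B, star (x + y) = star x + star y;
  starZ : forall (c : R[i]) (x : B), star (c *: x) = c^* *: star x;
  starM : forall x y : B, star (x * y) = star y * star x;
  cnorm_starM : forall x : B, cnorm (star x * x) = cnorm x ^+ 2
}.

#[short(type="cstarAlgType")]
HB.structure Definition CStarAlgebra (R : realType) :=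
  {B of GRing.Algebra R[i] B & Algebra_isCStar R B}.

Section Positivity.
Variables (R : realType) (B : cstarAlgType R).

Definition positive (a : B) : Prop := exists c : B, a = star c * c.

Definition mxstar n (A : 'M[B]_n) : 'M[B]_n := (map_mx star A)^T.

(* positivity in the C*-algebra M_n(B), whose involution is mxstar *)
Definition mxpositive n (A : 'M[B]_n) : Prop :=
  exists C : 'M[B]_n, A = mxstar C *m C.

Definition completely_positive (f : B -> B) : Prop :=
  forall n (A : 'M[B]_n), mxpositive A -> mxpositive (map_mx f A).

End Positivity.

(** * The *-algebra B<X> *)

(* The pair (b0, [:: b1; ...; bn]) encodes the monomial b0 X b1 ... X bn.
   A list of such pairs stands for the sum of its monomials, and two lists are
   identified when they have the same image in the direct sum over n of the
   (n+1)-fold tensor powers of B over the complex numbers, i.e. when no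
   additive, scalar-balanced map separates them. *)
Section NCPolyDef.
Variables (R : realType) (B : cstarAlgType R).

Definition word : Type := (B * seq B)%type.
HB.instance Definition _ := Choice.on word.
Definition rawpoly : Type := seq word.
HB.instance Definition _ := Choice.on rawpoly.

Definition wseq (w : word) : seq B := w.1 :: w.2.

Definition balanced (V : zmodType) (phi : seq B -> V) : Prop :=
  (forall s t x y, phi (s ++ (x + y) :: t) = phi (s ++ x :: t) + phi (s ++ y :: t))
  /\ (forall s t u (c : R[i]) x y,
        phi (s ++ c *: x :: t ++ y :: u) = phi (s ++ x :: t ++ c *: y :: u)).

Definition raw_eval (V : zmodType) (phi : seq B -> V) (p : rawpoly) : V :=
  \sum_(w <- p) phi (wseq w).

Definition raw_equiv (p q : rawpoly) : bool :=
  `[< forall (V : zmodType) (phi : seq B -> V),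
        balanced phi -> raw_eval phi p = raw_eval phi q >].

Lemma raw_equiv_refl : reflexive raw_equiv.
Proof. by move=> p; apply/asboolP. Qed.

Lemma raw_equiv_sym : symmetric raw_equiv.
Proof.
by move=> p q; apply/idP/idP => /asboolP h; apply/asboolP => V phi hphi;
  rewrite h.
Qed.

Lemma raw_equiv_trans : transitive raw_equiv.
Proof.
move=> q p r /asboolP h1 /asboolP h2; apply/asboolP => V phi hphi.
by rewrite h1 // h2.
Qed.

Canonical raw_equiv_rel :=
  EquivRel raw_equiv raw_equiv_refl raw_equiv_sym raw_equiv_trans.

Definition ncpoly : Type := {eq_quot raw_equiv_rel}.
HB.instance Definition _ := Choice.on ncpoly.
HB.instance Definition _ := EqQuotient.on ncpoly.

(* (.. X a)(b X ..) = .. X (a b) X .. *)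
Fixpoint wglue (a : B) (s : seq B) (w : word) : word :=
  if s is a1 :: s' then (a, wseq (wglue a1 s' w)) else (a * w.1, w.2).
Definition wmul (v w : word) : word := wglue v.1 v.2 w.

Definition wstar (w : word) : word :=
  let r := rev [seq star b | b <- wseq w] in (head 0 r, behead r).

Definition raw_opp (p : rawpoly) : rawpoly := [seq (- w.1, w.2) | w <- p].
Definition raw_scale (c : R[i]) (p : rawpoly) : rawpoly :=
  [seq (c *: w.1, w.2) | w <- p].
Definition raw_mul (p q : rawpoly) : rawpoly := [seq wmul v w | v <- p, w <- q].
Definition raw_star (p : rawpoly) : rawpoly := [seq wstar w | w <- p].

Definition nc_zero : ncpoly := \pi_ncpoly [::].
Definition nc_opp (P : ncpoly) : ncpoly := \pi_ncpoly (raw_opp (repr P)).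
Definition nc_add (P Q : ncpoly) : ncpoly := \pi_ncpoly (repr P ++ repr Q).
Definition nc_scale (c : R[i]) (P : ncpoly) : ncpoly :=
  \pi_ncpoly (raw_scale c (repr P)).
Definition nc_one : ncpoly := \pi_ncpoly [:: (1, [::])].
Definition nc_mul (P Q : ncpoly) : ncpoly := \pi_ncpoly (raw_mul (repr P) (repr Q)).
Definition nc_star (P : ncpoly) : ncpoly := \pi_ncpoly (raw_star (repr P)).

Definition ncC (b : B) : ncpoly := \pi_ncpoly [:: (b, [::])].
Definition ncX : ncpoly := \pi_ncpoly [:: (1, [:: 1])].

Lemma ncW (K : ncpoly -> Prop) :
  (forall p, K (\pi_ncpoly p)) -> forall P, K P.
Proof. by move=> h P; rewrite -[P]reprK. Qed.

Lemma nc_eqP (p q : rawpoly) :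
  reflect (forall (V : zmodType) (phi : seq B -> V),
             balanced phi -> raw_eval phi p = raw_eval phi q)
          (\pi_ncpoly p == \pi_ncpoly q).
Proof. by rewrite eqmodE; exact: asboolP. Qed.

Lemma nc_eq (p q : rawpoly) :
  (forall (V : zmodType) (phi : seq B -> V),
     balanced phi -> raw_eval phi p = raw_eval phi q) ->
  \pi_ncpoly p = \pi_ncpoly q.
Proof. by move=> h; apply/eqP/nc_eqP. Qed.

Lemma repr_evalE (p : rawpoly) (V : zmodType) (phi : seq B -> V) :
  balanced phi -> raw_eval phi (repr (\pi_ncpoly p)) = raw_eval phi p.
Proof.
move=> hphi.
have /eqP/nc_eqP h : \pi_ncpoly (repr (\pi_ncpoly p)) = \pi_ncpoly p by rewrite reprK.
exact: h.
Qed.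

Section Eval.
Variables (V : zmodType) (phi : seq B -> V).
Hypothesis hphi : balanced phi.

Lemma balancedN s t x : phi (s ++ (- x) :: t) = - phi (s ++ x :: t).
Proof.
have h0 : phi (s ++ 0 :: t) = 0.
  apply: (addrI (phi (s ++ 0 :: t))).
  by rewrite addr0 -hphi.1 addr0.
by apply/eqP; rewrite -addr_eq0 -hphi.1 addNr h0.
Qed.

Lemma raw_eval_nil : raw_eval phi [::] = 0.
Proof. exact: big_nil. Qed.

Lemma raw_eval_cat p q : raw_eval phi (p ++ q) = raw_eval phi p + raw_eval phi q.
Proof. exact: big_cat. Qed.

Lemma raw_eval_opp p : raw_eval phi (raw_opp p) = - raw_eval phi p.
Proof.
rewrite /raw_eval big_map -sumrN; apply: eq_bigr => w _.
exact: (balancedN [::]).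
Qed.

Lemma raw_eval_scale c p :
  raw_eval phi (raw_scale c p) = raw_eval (phi \o (fun s =>
    if s is b :: s' then c *: b :: s' else [::])) p.
Proof. by rewrite /raw_eval big_map; apply: eq_bigr. Qed.

Lemma balanced_scale c : balanced (phi \o (fun s =>
    if s is b :: s' then c *: b :: s' else [::])).
Proof.
split.
  move=> [|a s] t x y /=; first by rewrite scalerDr (hphi.1 [::]).
  exact: (hphi.1 (_ :: _)).
move=> [|a s] t u d x y /=; last exact: (hphi.2 (_ :: _)).
by rewrite -(hphi.2 [::]) !scalerA mulrC.
Qed.

Lemma wglue_cat a s t x w :
  wseq (wglue a (s ++ x :: t) w) = a :: s ++ wseq (wglue x t w).
Proof. by elim: s a => [|b s IH] a //=; rewrite /wseq /= -/(wseq _) IH. Qed.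

Definition glue (w : word) (s : seq B) : seq B :=
  if s is a :: s' then wseq (wglue a s' w) else [::].

Lemma glue_cat w s x t : glue w (s ++ x :: t) = s ++ wseq (wglue x t w).
Proof. by case: s => //= a s; rewrite wglue_cat. Qed.

Lemma balanced_mull (w : word) : balanced (phi \o glue w).
Proof.
split=> [s t x y|s t u c x y] /=.
  rewrite !glue_cat; case: t => [|z t] /=; first by rewrite mulrDl hphi.1.
  exact: hphi.1.
rewrite !glue_cat !wglue_cat; case: u => [|z u] /=.
  by rewrite -!cat_cons -scalerAl; exact: hphi.2.
exact: hphi.2.
Qed.

Lemma wglueE a s w :
  wseq (wglue a s w) = belast a s ++ last a s * w.1 :: w.2.
Proof. by elim: s a => [|b s IH] a //=; rewrite /wseq /= -/(wseq _) IH. Qed.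

Definition gluer (v : word) (s : seq B) : seq B :=
  if s is b :: s' then wseq (wmul v (b, s')) else [::].

Lemma balanced_mulr (v : word) : balanced (phi \o gluer v).
Proof.
split=> [[|a s] t x y|[|a s] t u c x y] /=; rewrite !wglueE /=.
- by rewrite mulrDr hphi.1.
- have := hphi.1 (belast v.1 v.2 ++ last v.1 v.2 * a :: s) t x y.
  by rewrite -!catA.
- by rewrite -scalerAr; exact: hphi.2.
- have := hphi.2 (belast v.1 v.2 ++ last v.1 v.2 * a :: s) t u c x y.
  by rewrite -!catA.
Qed.

Lemma raw_eval_mull p q :
  raw_eval phi (raw_mul p q) = \sum_(w <- q) raw_eval (phi \o glue w) p.
Proof. by rewrite /raw_eval big_allpairs_dep /= exchange_big. Qed.

Lemma raw_eval_mulr p q :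
  raw_eval phi (raw_mul p q) = \sum_(v <- p) raw_eval (phi \o gluer v) q.
Proof.
rewrite /raw_eval big_allpairs_dep /=; apply: eq_bigr => v _.
by apply: eq_bigr => -[].
Qed.

Lemma wseq_wstar w : wseq (wstar w) = rev [seq star b | b <- wseq w].
Proof.
rewrite /wstar /wseq /= rev_cons.
by case: (rev _).
Qed.

Lemma balanced_star : balanced (phi \o (fun s => rev [seq star b | b <- s])).
Proof.
split=> [s t x y|s t u c x y] /=.
  by rewrite !map_cat !rev_cat /= !rev_cons !cat_rcons starD hphi.1.
rewrite !(map_cat, rev_cat) /= !rev_cons !(map_cat, rev_cat) /= !rev_cons.
by rewrite -!cats1 -!catA /= !starZ; symmetry; exact: hphi.2.
Qed.

Lemma raw_eval_star p :
  raw_eval phi (raw_star p) =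
  raw_eval (phi \o (fun s => rev [seq star b | b <- s])) p.
Proof.
by rewrite /raw_eval big_map; apply: eq_bigr => w _; rewrite wseq_wstar.
Qed.

End Eval.

Lemma nc_addE p q : nc_add (\pi_ncpoly p) (\pi_ncpoly q) = \pi_ncpoly (p ++ q).
Proof.
by apply: nc_eq => V phi h; rewrite !raw_eval_cat !repr_evalE.
Qed.

Lemma nc_oppE p : nc_opp (\pi_ncpoly p) = \pi_ncpoly (raw_opp p).
Proof.
by apply: nc_eq => V phi h; rewrite !raw_eval_opp // repr_evalE.
Qed.

Lemma nc_scaleE c p : nc_scale c (\pi_ncpoly p) = \pi_ncpoly (raw_scale c p).
Proof.
apply: nc_eq => V phi h; rewrite !raw_eval_scale repr_evalE //.
exact: balanced_scale.
Qed.

Lemma nc_mulE p q : nc_mul (\pi_ncpoly p) (\pi_ncpoly q) = \pi_ncpoly (raw_mul p q).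
Proof.
apply: nc_eq => V phi h; rewrite raw_eval_mull.
under eq_bigr do rewrite (repr_evalE _ (balanced_mull h _)).
rewrite -raw_eval_mull raw_eval_mulr.
under eq_bigr do rewrite (repr_evalE _ (balanced_mulr h _)).
by rewrite -raw_eval_mulr.
Qed.

Lemma nc_starE p : nc_star (\pi_ncpoly p) = \pi_ncpoly (raw_star p).
Proof.
apply: nc_eq => V phi h; rewrite !raw_eval_star repr_evalE //.
exact: balanced_star.
Qed.

Lemma nc_addA : associative nc_add.
Proof.
move=> P Q S; elim/ncW: P => p; elim/ncW: Q => q; elim/ncW: S => r.
by rewrite !nc_addE catA.
Qed.

Lemma nc_addC : commutative nc_add.
Proof.
move=> P Q; elim/ncW: P => p; elim/ncW: Q => q; rewrite !nc_addE.
by apply: nc_eq => V phi h; rewrite !raw_eval_cat addrC.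
Qed.

Lemma nc_add0 : left_id nc_zero nc_add.
Proof. by move=> P; elim/ncW: P => p; rewrite nc_addE. Qed.

Lemma nc_addN : left_inverse nc_zero nc_opp nc_add.
Proof.
move=> P; elim/ncW: P => p; rewrite nc_oppE nc_addE.
by apply: nc_eq => V phi h; rewrite raw_eval_cat raw_eval_opp // addNr raw_eval_nil.
Qed.

HB.instance Definition _ :=
  GRing.isZmodule.Build ncpoly nc_addA nc_addC nc_add0 nc_addN.

Lemma wmulA : associative wmul.
Proof.
case=> [a s] [b t] w; rewrite /wmul /=.
elim: s a => [|a1 s IH] a /=; last by rewrite {1}/wseq /= -/(wseq _) IH.
by case: t => [|b1 t] //=; rewrite mulrA.
Qed.

Lemma nc_mulA : associative nc_mul.
Proof.
move=> P Q S; elim/ncW: P => p; elim/ncW: Q => q; elim/ncW: S => r; rewrite !nc_mulE.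
apply: nc_eq => V phi h; rewrite /raw_eval !big_allpairs_dep /=.
apply: eq_bigr => u _; rewrite !big_allpairs_dep /=.
by apply: eq_bigr => v _; apply: eq_bigr => w _; rewrite wmulA.
Qed.

Lemma nc_mul1 : left_id nc_one nc_mul.
Proof.
move=> P; elim/ncW: P => p; rewrite nc_mulE; apply: nc_eq => V phi h.
rewrite raw_eval_mulr big_seq1 /raw_eval; apply: eq_bigr => -[b s] _ /=.
by rewrite /wmul /= mul1r.
Qed.

Lemma nc_mulr1 : right_id nc_one nc_mul.
Proof.
move=> P; elim/ncW: P => p; rewrite nc_mulE; apply: nc_eq => V phi h.
rewrite raw_eval_mull big_seq1 /raw_eval; apply: eq_bigr => -[b s] _ /=.
by rewrite wglueE /= mulr1 cats1 -lastI.
Qed.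

Lemma nc_mulDl : left_distributive nc_mul nc_add.
Proof.
move=> P Q S; elim/ncW: P => p; elim/ncW: Q => q; elim/ncW: S => r.
rewrite !(nc_mulE, nc_addE); apply: nc_eq => V phi h.
by rewrite raw_eval_cat !raw_eval_mulr big_cat.
Qed.

Lemma nc_mulDr : right_distributive nc_mul nc_add.
Proof.
move=> P Q S; elim/ncW: P => p; elim/ncW: Q => q; elim/ncW: S => r.
rewrite !(nc_mulE, nc_addE); apply: nc_eq => V phi h.
by rewrite raw_eval_cat !raw_eval_mull big_cat.
Qed.

Lemma nc_one_neq0 : nc_one != nc_zero.
Proof.
apply/negP => /nc_eqP /(_ B (fun s => if s is [:: b] then b else 0)) h.
suff /h/eqP : balanced (fun s : seq B => if s is [:: b] then b else 0).
  by rewrite raw_eval_nil /raw_eval big_seq1 /= oner_eq0.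
split=> [s t x y|s t u c x y].
  by case: s => [|a [|b s]]; case: t => [|z t] //=; rewrite addr0.
by case: s => [|a [|b s]]; case: t => [|z t].
Qed.

HB.instance Definition _ := GRing.Zmodule_isNzRing.Build ncpoly
  nc_mulA nc_mul1 nc_mulr1 nc_mulDl nc_mulDr nc_one_neq0.

Lemma nc_scaleA a b P : nc_scale a (nc_scale b P) = nc_scale (a * b) P.
Proof.
elim/ncW: P => p; rewrite !nc_scaleE /raw_scale -map_comp.
by congr (\pi_ncpoly _); apply: eq_map => w /=; rewrite scalerA.
Qed.

Lemma nc_scale1 : left_id 1 nc_scale.
Proof.
move=> P; elim/ncW: P => p; rewrite nc_scaleE /raw_scale; congr (\pi_ncpoly _).
by rewrite -[RHS]map_id; apply: eq_map => -[b s] /=; rewrite scale1r.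
Qed.

Lemma nc_scaleDr : right_distributive nc_scale +%R.
Proof.
move=> c; move=> P Q; elim/ncW: P => p; elim/ncW: Q => q.
rewrite -[X in nc_scale c X]/(nc_add _ _) -[RHS]/(nc_add _ _).
by rewrite !(nc_addE, nc_scaleE) /raw_scale map_cat.
Qed.

Lemma nc_scaleDl P : {morph nc_scale^~ P : a b / a + b}.
Proof.
move=> a b; elim/ncW: P => p; rewrite -[RHS]/(nc_add _ _).
rewrite !(nc_addE, nc_scaleE); apply: nc_eq => V phi h.
rewrite raw_eval_cat /raw_eval !big_map -big_split; apply: eq_bigr => w _ /=.
by rewrite /wseq /= scalerDl (h.1 [::]).
Qed.

HB.instance Definition _ := GRing.Zmodule_isLmodule.Build R[i] ncpoly
  nc_scaleA nc_scale1 nc_scaleDr nc_scaleDl.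

Lemma nc_scaleAl (c : R[i]) (P Q : ncpoly) : c *: (P * Q) = (c *: P) * Q.
Proof.
rewrite -[LHS]/(nc_scale c (nc_mul P Q)) -[RHS]/(nc_mul (nc_scale c P) Q).
elim/ncW: P => p; elim/ncW: Q => q; rewrite !(nc_mulE, nc_scaleE).
apply: nc_eq => V phi h; rewrite raw_eval_scale !raw_eval_mulr big_map.
apply: eq_bigr => -[a [|a1 s]] _; apply: eq_bigr => -[b t] _ //=.
by rewrite /wmul /= scalerAl.
Qed.

HB.instance Definition _ :=
  GRing.Lmodule_isLalgebra.Build R[i] ncpoly nc_scaleAl.

Lemma nc_scaleAr (c : R[i]) (P Q : ncpoly) : c *: (P * Q) = P * (c *: Q).
Proof.
rewrite -[LHS]/(nc_scale c (nc_mul P Q)) -[RHS]/(nc_mul P (nc_scale c Q)).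
elim/ncW: P => p; elim/ncW: Q => q; rewrite !(nc_mulE, nc_scaleE).
apply: nc_eq => V phi h; rewrite raw_eval_scale !raw_eval_mulr.
apply: eq_bigr => -[a s] _; rewrite /raw_eval big_map.
apply: eq_bigr => -[b t] _ /=; rewrite !wglueE /= -scalerAr.
case: s => [|a1 s] //=.
by rewrite wglueE; exact: (h.2 [::]).
Qed.

HB.instance Definition _ :=
  GRing.Lalgebra_isAlgebra.Build R[i] ncpoly nc_scaleAr.

End NCPolyDef.

Arguments ncC {R B} b.
Arguments ncX {R B}.

(** * Distributions *)

(* b0 X b1 ... X bn in an algebra receiving B through [inj] *)
Definition monomial (R : realType) (B : cstarAlgType R) (A : nzRingType)
    (inj : B -> A) (X : A) (b0 : B) (bs : seq B) : A :=
  inj b0 * \prod_(b <- bs) (X * inj b).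

Section Distributions.
Variables (R : realType) (B : cstarAlgType R).
Implicit Types (mu nu : ncpoly B -> B).

Definition Sigma_alg mu : Prop :=
  [/\ linear mu,
      forall (a b : B) (P : ncpoly B), mu (ncC a * P * ncC b) = a * mu P * b
    & forall b : B, mu (ncC b) = b].

Definition Sigma mu : Prop :=
  Sigma_alg mu /\ forall P : ncpoly B, positive (mu (nc_star P * P)).

(* B is a unital C*-subalgebra of M through the isometric embedding iota *)
Definition cstar_prob_space (M : cstarAlgType R) (iota : {lrmorphism B -> M})
    (E : {linear M -> B}) : Prop :=
  [/\ (forall b : B, iota (star b) = star (iota b))
        /\ (forall b : B, cnorm (iota b) = cnorm b),
      E 1 = 1,
      forall m : M, positive m -> positive (E m)
    & forall (a b : B) (m : M), E (iota a * m * iota b) = a * E m * b].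

Definition Sigma0 mu : Prop :=
  Sigma_alg mu /\
  exists (M : cstarAlgType R) (iota : {lrmorphism B -> M}) (E : {linear M -> B})
         (X : M),
    [/\ cstar_prob_space iota E, star X = X
      & forall (b0 : B) (bs : seq B),
          mu (monomial ncC ncX b0 bs) = E (monomial iota X b0 bs)].

(** * Series and the R-transform *)

(* F^[n](b_1, ..., b_(n-1)) is the value of F at the list [:: b_1; ...; b_(n-1)];
   in particular F^[1] is F [::]. *)
Definition Ser (F : seq B -> B) : Prop :=
  forall (s t : seq B) (c : R[i]) (x y : B),
    F (s ++ (c *: x + y) :: t) = c *: F (s ++ x :: t) + F (s ++ y :: t).

Definition moment_series mu (bs : seq B) : B :=
  mu ((\prod_(b <- bs) (ncX * ncC b)) * ncX).

End Distributions.

Definition noncrossing n (pi : {set {set 'I_n}}) : bool :=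
  partition pi [set: 'I_n] &&
  [forall V in pi, forall W in pi,
     [forall i : 'I_n, forall j : 'I_n, forall k : 'I_n, forall l : 'I_n,
        [&& (i < j)%N, (j < k)%N, (k < l)%N, i \in V, k \in V, j \in W & l \in W]
          ==> (V == W)]].

Definition NC n : {set {set {set 'I_n}}} := [set pi | noncrossing pi].

Section Nested.
Variables (R : realType) (B : cstarAlgType R) (F : seq B -> B).

Inductive token := Coef of B | Single | Open | Comma | Close.

Definition block_token n (pi : {set {set 'I_n}}) (m : 'I_n) : token :=
  let V := pblock pi m in
  let before := [exists j in V, (j < m)%N] in
  let after := [exists j in V, (m < j)%N] in
  match before, after with
  | false, false => Single
  | false, true => Open
  | true, true => Comma
  | true, false => Close
  end.

(* W_1 b_1 W_2 ... b_n W_(n+1); lift ord0 i is i + 1 *)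
Definition token_string n (pi : {set {set 'I_n.+1}}) (bs : seq B) : seq token :=
  block_token pi ord0 ::
  flatten [seq [:: Coef bs`_i; block_token pi (lift ord0 i)]
           | i : 'I_n <- enum 'I_n].

(* A state (cur, stack): cur is the product read so far at the current
   parenthesis level; each enclosing open parenthesis contributes a frame
   (product standing to the left of its "F^[k](", arguments already completed). *)
Definition read (st : B * seq (B * seq B)) (tok : token) :
    B * seq (B * seq B) :=
  let: (cur, stack) := st in
  match tok, stack with
  | Coef b, _ => (cur * b, stack)
  | Single, _ => (cur * F [::], stack)
  | Open, _ => (1, (cur, [::]) :: stack)
  | Comma, (outer, args) :: stack' => (1, (outer, rcons args cur) :: stack')
  | Close, (outer, args) :: stack' => (outer * F (rcons args cur), stack')
  | _, [::] => st
  end.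

Definition nested n (pi : {set {set 'I_n.+1}}) (bs : seq B) : B :=
  (foldl read (1, [::]) (token_string pi bs)).1.

End Nested.

Section RTransform.
Variables (R : realType) (B : cstarAlgType R).
Implicit Types (mu nu : ncpoly B -> B).

Definition is_Rtransform mu (F : seq B -> B) : Prop :=
  Ser F /\
  forall bs : seq B,
    moment_series mu bs =
    \sum_(pi in NC (size bs).+1) nested F pi bs.

(* the unique F with is_Rtransform mu F, for mu in Sigma_alg *)
Definition Rtransform mu : seq B -> B :=
  xget (fun=> 0) [set F | is_Rtransform mu F]%classic.

(* the unique nu in Sigma_alg with R_nu = alpha o R_mu *)
Definition boxplus_pow mu (alpha : B -> B) : ncpoly B -> B :=
  xget (fun=> 0)
    [set nu | Sigma_alg nu /\ Rtransform nu = alpha \o Rtransform mu]%classic.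

End RTransform.

(* Main.v *)
Require Import Defs.
From HB Require Import structures.
From mathcomp Require Import boolp classical_sets reals.
From mathcomp Require Import all_boot all_order all_algebra.
From mathcomp Require Import generic_quotient complex.
From mathcomp Require Import ring lra zify.

Set Implicit Arguments.
Unset Strict Implicit.
Unset Printing Implicit Defensive.

Import Order.TTheory GRing.Theory Num.Theory.

Local Open Scope ring_scope.
Local Open Scope complex_scope.

(** Write [alpha = 1 + beta] with [beta] completely positive. Positivity of the convolution
    power is reduced to Boolean cumulants, where it becomes visible: if [B_mu] denotes the
    Boolean cumulants of [mu], then the moments of a distribution are positive as soon as
    its Boolean cumulants form a positive-definite kernel on words, because the moment of a
    word that is cut at some point is a term of rank one plus a congruence transform of the
    Boolean cumulants at shorter words ([boolean_moments_cut], [pdk_boolean_moments]).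
    Conversely, for positive [mu] the kernel of [B_mu] is positive-definite: it is the Gram
    matrix of the words in the compression of X to the complement of the constants
    ([bool_cumulants_kernel]).

    Let [tau] have the free cumulants [beta o B_mu]. A computation with formal series on
    words, where [comp] is substitution, shows that the moments of [nu], the convolution
    power, are [m_nu = comp m_mu m_tau] and that the Boolean cumulants of [nu] and [tau]
    are [(1 + beta) o Q] and [beta o Q], with the same [Q = comp B_mu m_tau]
    ([boolean_moments_comp], [power_moments]). The kernel of [Q] is positive-definite up to a
    given length of words if that of [m_tau] is ([pdk_comp], an interior tensor product of
    Hilbert modules); [beta] preserves positive-definiteness, so that the moments of [tau]
    are then positive for words that are longer by one. By induction [Q] is
    positive-definite, hence so are [Q + beta o Q] and the moments of [nu].

    To use the R-transform in this way, the sum over non-crossing partitions has to be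
    turned into a recursion. Non-crossing partitions are coded by bracket words
    ([sum_NC]), along which the nested functionals are read letter by letter; summed over
    all words, the states of this reading obey the recursion over the block of the
    first point ([sum_nested]).

    The bounded case needs two more facts. If the moments of [mu] grow geometrically, so do
    its Boolean cumulants and, by a majorant argument for the recursion that defines
    [m_tau], the moments of [nu] ([mom_geometric]). A positive distribution whose moments
    grow geometrically is that of a self-adjoint element of a C*-probability space
    ([Sigma0_of_geometric]): on the Hilbert module of polynomials with inner product
    [nu (P^* Q)] left multiplications are bounded, for X because the norms of [X^n Q] are
    log-convex in [n], and their operator norm is a C*-seminorm, in which the polynomials
    are completed ([cstar_completion]).

    Positivity in a C*-algebra is developed up to the facts that these arguments use:
    square roots, the positivity of [c^* c], Cholesky factorization of positive matrices,
    and Schwarz's inequality. *)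

(** * Normalization of sums in abelian groups *)

(* The products of a C*-algebra do not commute, so that only the additive part
   of its identities can be left to a decision procedure: both sides are read as
   integer combinations of atoms. *)

Inductive zexpr := ZVar of nat | ZZero | ZAdd of zexpr & zexpr | ZOpp of zexpr.

Fixpoint zcoef (e : zexpr) (i : nat) : int :=
  match e with
  | ZVar j => (i == j)%:Z
  | ZZero => 0
  | ZAdd a b => zcoef a i + zcoef b i
  | ZOpp a => - zcoef a i
  end.

Fixpoint zeval (V : zmodType) (env : seq V) (e : zexpr) : V :=
  match e with
  | ZVar j => nth 0 env j
  | ZZero => 0
  | ZAdd a b => zeval env a + zeval env b
  | ZOpp a => - zeval env a
  end.

Lemma zeval_coef (V : zmodType) (env : seq V) e :
  zeval env e = \sum_(i < size env) env`_i *~ zcoef e i.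
Proof.
elim: e => [j||a IHa b IHb|a IHa] /=.
- have [h|h] := ltnP j (size env); last first.
    rewrite nth_default // big1 // => i _.
    by rewrite ltn_eqF // (leq_trans (ltn_ord i) h).
  rewrite (bigD1 (Ordinal h)) //= eqxx big1 ?addr0 // => i /eqP ne.
  by rewrite (_ : (val i == j) = false) //; apply/eqP => e; apply/ne/val_inj.
- by rewrite big1.
- by rewrite IHa IHb -big_split; apply: eq_bigr => i _; rewrite mulrzDr.
- by rewrite IHa -sumrN; apply: eq_bigr => i _; rewrite mulrNz.
Qed.

Lemma zeval_eq (V : zmodType) (env : seq V) e f :
  all (fun i => zcoef e i == zcoef f i) (iota 0 (size env)) ->
  zeval env e = zeval env f.
Proof.
move=> /allP h; rewrite !zeval_coef; apply: eq_bigr => i _.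
by rewrite (eqP (h i _)) // mem_iota add0n ltn_ord.
Qed.

(* atoms are compared up to unification, as the same product may be built with
   syntactically different structure instances *)
Ltac zindex x env :=
  match env with
  | ?y :: _ => let _ := match goal with _ => unify x y end in constr:(0%N)
  | _ :: ?env' => let n := zindex x env' in constr:(S n)
  end.
Ltac zmember x env :=
  match env with
  | nil => constr:(false)
  | ?y :: _ => let _ := match goal with _ => unify x y end in constr:(true)
  | _ :: ?env' => zmember x env'
  end.
Ltac zatoms e env :=
  match e with
  | GRing.add ?a ?b => let env1 := zatoms a env in zatoms b env1
  | GRing.opp ?a => zatoms a env
  | GRing.zero => env
  | _ => let m := zmember e env in
         match m with true => env | false => constr:(e :: env) end
  end.
Ltac zreify e env :=
  match e with
  | GRing.add ?a ?b => let x := zreify a env in let y := zreify b env in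
                       constr:(ZAdd x y)
  | GRing.opp ?a => let x := zreify a env in constr:(ZOpp x)
  | GRing.zero => constr:(ZZero)
  | _ => let n := zindex e env in constr:(ZVar n)
  end.
Ltac abel :=
  match goal with
  | |- @eq ?T ?a ?b =>
    let env0 := zatoms a (@nil T) in
    let env := zatoms b env0 in
    let x := zreify a env in
    let y := zreify b env in
    refine (@zeval_eq _ env x y _); vm_compute; reflexivity
  end.

(** * Norms and limits in C*-algebras *)

Notation "r %:B" := (r%:C *: 1) (at level 2, left associativity, format "r %:B") : ring_scope.

Lemma bernoulli (R : realType) (x : R) n : 0 <= x -> 1 + n%:R * (x - 1) <= x ^+ n.
Proof.
move=> x0; elim: n => [|n IH]; first by rewrite mul0r addr0.
rewrite exprS -[n.+1]addn1 natrD; have n0 : 0 <= n%:R :> R by exact: ler0n.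
have h := ler_wpM2l x0 IH; have := mulr_ge0 n0 (sqr_ge0 (x - 1)).
by move: (n%:R) h => k h; lra.
Qed.

Section CStarBasics.
Variables (R : realType) (B : cstarAlgType R).
Implicit Types (a b c x y z : B) (r t : R).

Lemma cnormZr r x : cnorm (r%:C *: x) = `|r| * cnorm x.
Proof.
have := cnormZ r%:C x; rewrite normc_def /= expr0n addr0 sqrtr_sqr -rmorphM /=.
by case.
Qed.

Lemma cnorm0 : cnorm (0 : B) = 0.
Proof. by have := cnormZr 0 0; rewrite scaler0 normr0 mul0r. Qed.

Lemma scaleN1C x : (-1)%:C *: x = - x.
Proof. by rewrite rmorphN rmorph1 scaleN1r. Qed.

Lemma cnormN x : cnorm (- x) = cnorm x.
Proof. by have := cnormZr (-1) x; rewrite scaleN1C normrN1 mul1r. Qed.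

Lemma cnorm_ge0 x : 0 <= cnorm x.
Proof.
by have := cnormD x (- x); rewrite subrr cnorm0 cnormN -mulr2n pmulrn_lge0.
Qed.
Hint Resolve cnorm_ge0 : core.

Lemma cnormB x y : cnorm (x - y) <= cnorm x + cnorm y.
Proof. by rewrite -(cnormN y) cnormD. Qed.

Lemma cdistC x y : cnorm (x - y) = cnorm (y - x).
Proof. by rewrite -opprB cnormN. Qed.

Lemma cnorm_sum (I : Type) (s : seq I) (P : pred I) (F : I -> B) :
  cnorm (\sum_(i <- s | P i) F i) <= \sum_(i <- s | P i) cnorm (F i).
Proof.
elim/big_rec2: _ => [|i x y _ h]; first by rewrite cnorm0.
by apply: le_trans (cnormD _ _) _; rewrite lerD2l.
Qed.

Lemma cnormi x : cnorm ('i%C *: x) = cnorm x.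
Proof.
have := cnormZ 'i%C x; rewrite normc_def /= expr0n expr1n add0r sqrtr1 mul1r.
by case.
Qed.

Lemma star0 : star (0 : B) = 0.
Proof. by apply: (addrI (star 0)); rewrite -starD !addr0. Qed.

Lemma starN x : star (- x) = - star x.
Proof. by apply/eqP; rewrite -addr_eq0 -starD addNr star0. Qed.

Lemma starB x y : star (x - y) = star x - star y.
Proof. by rewrite starD starN. Qed.

Lemma star1 : star (1 : B) = 1.
Proof. by have := starM (star 1) (1 : B); rewrite mulr1 starK mulr1 => <-. Qed.

Lemma starZE (k : R[i]) x : star (k *: x) = conjc k *: star x.
Proof. exact: starZ. Qed.

Lemma starZr r x : star (r%:C *: x) = r%:C *: star x.
Proof. by rewrite starZE conjc_real. Qed.

Lemma star_sum (I : Type) (s : seq I) (P : pred I) (F : I -> B) :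
  star (\sum_(i <- s | P i) F i) = \sum_(i <- s | P i) star (F i).
Proof. by apply: (big_morph _ starD star0). Qed.

Lemma cnorm_star x : cnorm (star x) = cnorm x.
Proof.
have le y : cnorm y <= cnorm (star y).
  have [->//|y0] := eqVneq (cnorm y) 0.
  rewrite -(@ler_pM2r _ (cnorm y)) ?lt_def ?y0 ?cnorm_ge0 //.
  by rewrite -expr2 -cnorm_starM cnormM.
by apply/eqP; rewrite eq_le le -{2}(starK x) le.
Qed.

Lemma cnorm_mulstar x : cnorm (x * star x) = cnorm x ^+ 2.
Proof. by rewrite -{1}(starK x) cnorm_starM cnorm_star. Qed.

Lemma cnorm_sa x : star x = x -> cnorm (x ^+ 2) = cnorm x ^+ 2.
Proof. by move=> sa; rewrite -cnorm_starM sa expr2. Qed.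

Lemma cnorm1 : cnorm (1 : B) = 1.
Proof.
have := cnorm_starM (1 : B); rewrite star1 mulr1 => /eqP.
rewrite -subr_eq0 -{1}(mulr1 (cnorm 1)) expr2 -mulrBr mulf_eq0 => /orP[/eqP/cnorm_eq0/eqP|].
  by rewrite oner_eq0.
by rewrite subr_eq0 => /eqP.
Qed.

Lemma cnorm_scal r : cnorm (r%:B : B) = `|r|.
Proof. by rewrite cnormZr cnorm1 mulr1. Qed.

Lemma cnormX x n : cnorm (x ^+ n) <= cnorm x ^+ n.
Proof.
elim: n => [|n IH]; first by rewrite !expr0 cnorm1.
by rewrite !exprS; apply: le_trans (cnormM _ _) _; rewrite ler_wpM2l.
Qed.

Lemma star_scal r : star (r%:B : B) = r%:B.
Proof. by rewrite starZr star1. Qed.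

Lemma starX x n : star (x ^+ n) = star x ^+ n.
Proof. by elim: n => [|n IH]; rewrite ?expr0 ?star1 // exprS exprSr starM IH. Qed.

Lemma mul_scal r x : r%:B * x = r%:C *: x.
Proof. by rewrite -scalerAl mul1r. Qed.

Lemma mulr_scal r x : x * r%:B = r%:C *: x.
Proof. by rewrite -scalerAr mulr1. Qed.

Lemma comm_scal r x : GRing.comm x (r%:B).
Proof. by rewrite /GRing.comm mul_scal mulr_scal. Qed.

Lemma scalD r t : (r + t)%:B = r%:B + t%:B :> B.
Proof. by rewrite rmorphD scalerDl. Qed.

Lemma scal1 : 1%:B = 1 :> B.
Proof. by rewrite rmorph1 scale1r. Qed.

Lemma cnormZ_ge0 r x : 0 <= r -> cnorm (r%:C *: x) = r * cnorm x.
Proof. by move=> r0; rewrite cnormZr ger0_norm. Qed.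

Lemma scaleRA r t x : r%:C *: (t%:C *: x) = (r * t)%:C *: x.
Proof. by rewrite scalerA rmorphM. Qed.

(** ** Limits *)

Definition tends (u : nat -> B) (l : B) : Prop :=
  forall e : R, 0 < e -> exists N, forall n, (N <= n)%N -> cnorm (u n - l) < e.

Lemma tends_cst l : tends (fun=> l) l.
Proof. by move=> e e0; exists 0%N => n _; rewrite subrr cnorm0. Qed.

Lemma tendsD u v l k : tends u l -> tends v k -> tends (fun n => u n + v n) (l + k).
Proof.
move=> hu hv e e0; have e2 : 0 < e / 2 by lra.
have [N hN] := hu _ e2; have [M hM] := hv _ e2.
exists (maxn N M) => n; rewrite geq_max => /andP[/hN h1 /hM h2].
rewrite opprD addrACA; apply: le_lt_trans (cnormD _ _) _; lra.
Qed.

Lemma tends_ext u v l : u =1 v -> tends u l -> tends v l.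
Proof. by move=> h hu e /hu[N hN]; exists N => n /hN; rewrite h. Qed.

Lemma tends_star u l : tends u l -> tends (fun n => star (u n)) (star l).
Proof. by move=> hu e /hu[N hN]; exists N => n /hN; rewrite -starB cnorm_star. Qed.

Lemma tends_mull u l x : tends u l -> tends (fun n => x * u n) (x * l).
Proof.
move=> hu e e0; have x1 : 0 < cnorm x + 1 by rewrite ltr_pwDr.
have [N hN] := hu _ (divr_gt0 e0 x1); exists N => n /hN h; rewrite -mulrBr.
apply: le_lt_trans (cnormM _ _) _.
apply: (@le_lt_trans _ _ ((cnorm x + 1) * cnorm (u n - l))).
  by rewrite ler_wpM2r // lerDl.
by rewrite mulrC -ltr_pdivlMr.
Qed.

Lemma tends_mulr u l x : tends u l -> tends (fun n => u n * x) (l * x).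
Proof.
move=> /tends_star/(@tends_mull _ _ (star x))/tends_star; rewrite -starM starK.
by apply: tends_ext => n; rewrite -starM starK.
Qed.

Lemma tendsN u l : tends u l -> tends (fun n => - u n) (- l).
Proof.
move=> /(@tends_mulr _ _ (-1)); rewrite mulrN1; apply: tends_ext => n.
by rewrite mulrN1.
Qed.

Lemma tendsB u v l k : tends u l -> tends v k -> tends (fun n => u n - v n) (l - k).
Proof. by move=> hu /tendsN; exact: tendsD. Qed.

Lemma tendsZ u l (k : R[i]) : tends u l -> tends (fun n => k *: u n) (k *: l).
Proof.
move=> /(@tends_mulr _ _ (k *: 1)); rewrite -scalerAr mulr1; apply: tends_ext => n.
by rewrite -scalerAr mulr1.
Qed.

Lemma tends_le u l r : tends u l -> (exists N, forall n, (N <= n)%N -> cnorm (u n) <= r) ->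
  cnorm l <= r.
Proof.
move=> hu [M hM]; rewrite leNgt; apply/negP => h.
have [N hN] := hu (cnorm l - r) ltac:(lra).
have := hN _ (leq_maxl N M); have := hM _ (leq_maxr N M).
set n := maxn N M.
have := cnormB (u n) (u n - l); rewrite opprB addrC subrK; lra.
Qed.

Lemma tends_uniq u l k : tends u l -> tends u k -> l = k.
Proof.
move=> hl hk; apply/eqP; rewrite -subr_eq0; apply/eqP/cnorm_eq0.
apply/eqP; rewrite eq_le cnorm_ge0 andbT.
have h := tendsB hl hk; apply: (tends_le h).
by exists 0%N => n _; rewrite subrr cnorm0.
Qed.

Lemma tends_bounded u l : tends u l ->
  exists2 r, 0 <= r & exists N, forall n, (N <= n)%N -> cnorm (u n) <= r.
Proof.
move=> /(_ 1 ltr01)[N hN]; exists (1 + cnorm l); first by have := cnorm_ge0 l; lra.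
exists N => n /hN h; have := cnormD (u n - l) l; rewrite subrK; lra.
Qed.

Lemma tendsM u v l k : tends u l -> tends v k -> tends (fun n => u n * v n) (l * k).
Proof.
move=> hu hv; have [r r0 [N hN]] := tends_bounded hv.
have h : tends (fun n => (u n - l) * v n) 0.
  move=> e e0; have r1 : 0 < r + 1 by lra.
  have [M hM] := hu (e / (r + 1)) ltac:(by rewrite divr_gt0).
  exists (maxn N M) => n; rewrite geq_max subr0 => /andP[/hN h1 /hM h2].
  apply: le_lt_trans (cnormM _ _) _.
  apply: (@le_lt_trans _ _ (cnorm (u n - l) * (r + 1))).
    by rewrite ler_wpM2l //; lra.
  by rewrite -ltr_pdivlMr.
have := tendsD h (@tends_mull _ _ l hv); rewrite add0r; apply: tends_ext => n.
by rewrite mulrBl subrK.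
Qed.

Lemma tends_comm u l x : tends u l -> (forall n, GRing.comm x (u n)) -> GRing.comm x l.
Proof.
move=> hu hx; apply: (@tends_uniq (fun n => x * u n)); first exact: tends_mull.
by apply: tends_ext (@tends_mulr _ _ x hu) => n; rewrite hx.
Qed.

(** The bounded sequence [s] plays the role of a convergent series that dominates the
    increments. *)
Lemma tends_dominated u (s : nat -> R) (M : R) :
  (forall n, cnorm (u n.+1 - u n) <= s n.+1 - s n) -> (forall n, s n <= M) ->
  exists l, tends u l.
Proof.
move=> hu hM.
have mono m n : (m <= n)%N -> s m <= s n.
  move=> /subnK <-; elim: (n - m)%N => [|k IH] //.
  apply: le_trans IH _; rewrite addSn -subr_ge0.
  exact: le_trans (cnorm_ge0 _) (hu _).
have dist m n : (m <= n)%N -> cnorm (u n - u m) <= s n - s m.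
  move=> /subnK <-; elim: (n - m)%N => [|k IH]; first by rewrite !subrr cnorm0.
  have := cnormD (u (k + m).+1 - u (k + m)%N) (u (k + m)%N - u m).
  rewrite addrA subrK => /le_trans; apply.
  by have := hu (k + m)%N; move: IH; rewrite addSn; lra.
have hs : has_sup [set x | exists n, x = s n]%classic.
  by split; [exists (s 0), 0%N | exists M => _ [n ->]].
apply: cnorm_complete => e e0.
have [_ [N ->] hN] := sup_adherent e0 hs.
have up n : s n <= sup [set x | exists n, x = s n]%classic.
  by apply: ub_le_sup; [exact: hs.2 | exists n].
exists N => m n; wlog mn : m n / (m <= n)%N => [th hm hn|hm hn].
  by case/orP: (leq_total m n) => ?; last rewrite cdistC; apply: th.
rewrite cdistC; apply: le_lt_trans (dist _ _ mn) _.
have := up n; have := mono _ _ hm; lra.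
Qed.

End CStarBasics.

#[export] Hint Resolve cnorm_ge0 : core.

(** * Positive elements *)

Section PositiveCone.
Variables (R : realType) (B : cstarAlgType R).
Implicit Types (a b c x y z : B) (r t : R).

(** The spectrum of [a] lies between 0 and [2 t]. In this form closure under sums
    is immediate; [positiveP] links it with the elements [c^* c], for which closure under
    sums is the hard point. *)
Definition psd a : Prop :=
  star a = a /\ exists2 t : R, 0 <= t & cnorm (t%:B - a) <= t.

Lemma psdD a b : psd a -> psd b -> psd (a + b).
Proof.
move=> [sa [t t0 ha]] [sb [u u0 hb]]; split; first by rewrite starD sa sb.
exists (t + u); first exact: addr_ge0.
rewrite scalD opprD addrACA; apply: le_trans (cnormD _ _) _; exact: lerD.
Qed.

Lemma psdZ r a : 0 <= r -> psd a -> psd (r%:C *: a).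
Proof.
move=> r0 [sa [t t0 ha]]; split; first by rewrite starZr sa.
exists (r * t); first exact: mulr_ge0.
by rewrite -scaleRA -scalerBr cnormZ_ge0 // ler_wpM2l.
Qed.

Lemma psd0 : psd 0.
Proof. by split; [exact: star0 | exists 0; rewrite // scale0r subrr cnorm0]. Qed.

Lemma psd_scal r : 0 <= r -> psd (r%:B).
Proof.
by move=> r0; split; [exact: star_scal | exists r; rewrite // subrr cnorm0].
Qed.

Lemma psd1 : psd 1.
Proof. by rewrite -scal1; apply: psd_scal. Qed.

Lemma psd_sub_norm a t : star a = a -> cnorm a <= t -> psd (t%:B - a).
Proof.
move=> sa h; split; first by rewrite starB star_scal sa.
exists t; first exact: le_trans (cnorm_ge0 _) h.
by rewrite opprB addrC subrK.
Qed.

(* the iteration for the square root of [1 - x], and its scalar case [x = 1],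
   which dominates its increments *)
Let it x n := iter n (fun y => (2^-1)%:C *: (x + y ^+ 2)) 0.
Let sit n : R := iter n (fun s => 2^-1 * (1 + s ^+ 2)) 0.

Let sit_bd n : 0 <= sit n <= 1.
Proof. by elim: n => [|n] /=; rewrite ?lexx ?ler01 //; nra. Qed.

Let it_comm x n z : GRing.comm z x -> GRing.comm z (it x n).
Proof.
move=> h; elim: n => [|n IH] /=; first exact: commr0.
by rewrite /GRing.comm -scalerAr -scalerAl (commrD h (commrX 2 IH)).
Qed.

Let it_norm x n : cnorm x <= 1 -> cnorm (it x n) <= sit n.
Proof.
move=> h; elim: n => [|n IH] /=; first by rewrite cnorm0.
rewrite cnormZ_ge0 ?invr_ge0 ?ler0n // ler_wpM2l ?invr_ge0 ?ler0n //.
apply: le_trans (cnormD _ _) _; apply: lerD => //.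
apply: le_trans (cnormX _ _) _; rewrite ler_pXn2r ?nnegrE ?cnorm_ge0 //.
by case/andP: (sit_bd n).
Qed.

Let it_incr x n : cnorm x <= 1 ->
  cnorm (it x n.+1 - it x n) <= sit n.+1 - sit n.
Proof.
move=> h; elim: n => [|n IH].
  rewrite /= !expr0n /= !addr0 !subr0 cnormZ_ge0 ?invr_ge0 ?ler0n //.
  by rewrite ler_wpM2l ?invr_ge0 ?ler0n.
have -> : it x n.+2 - it x n.+1 = (2^-1)%:C *: ((it x n.+1 - it x n) * (it x n.+1 + it x n)).
  rewrite [it x n.+2]/= [X in _ - X = _]/= -/(it x n) -/(it x n.+1) -scalerBr; congr (_ *: _).
  have cc : GRing.comm (it x n) (it x n.+1).
    by apply: it_comm; apply: commr_sym; apply: it_comm.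
  rewrite opprD addrACA subrr add0r mulrBl !mulrDr -!expr2 cc.
  by rewrite opprD addrA addrK.
have -> : sit n.+2 - sit n.+1 = 2^-1 * ((sit n.+1 - sit n) * (sit n.+1 + sit n)).
  by rewrite [sit n.+2]/= [X in _ - X = _]/= -/(sit n) -/(sit n.+1) /=; ring.
rewrite cnormZ_ge0 ?invr_ge0 ?ler0n // ler_wpM2l ?invr_ge0 ?ler0n //.
apply: le_trans (cnormM _ _) _; apply: ler_pM; rewrite ?cnorm_ge0 //.
apply: le_trans (cnormD _ _) _; apply: lerD; exact: it_norm.
Qed.

Let it_lim x : cnorm x <= 1 -> exists l, tends (it x) l.
Proof.
move=> hx; apply: (@tends_dominated _ _ _ sit 1) => n; first exact: it_incr.
by case/andP: (sit_bd n).
Qed.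

(** [1 - y] with [y = (x + y^2)/2] squares to [1 - x]; the iteration converges
    since its increments are dominated by those of the scalar case [x = 1]. *)
Lemma csqrt1 x : star x = x -> cnorm x <= 1 -> exists s,
  [/\ psd s, s ^+ 2 = 1 - x & forall z, GRing.comm z x -> GRing.comm z s].
Proof.
move=> sx hx; have [y hy] := it_lim hx.
have sy : star y = y.
  apply: tends_uniq (tends_star hy) _; apply: tends_ext hy => n.
  elim: n => [|n IH] /=; first by rewrite star0.
  by rewrite starZr starD sx starX -IH.
have ey : y = (2^-1)%:C *: (x + y ^+ 2).
  have h1 : tends (fun n => it x n.+1) y.
    by move=> e /hy[N hN]; exists N => n hn; apply: hN; apply: leqW.
  apply: (tends_uniq h1); apply: tendsZ.
  by apply: tendsD; [exact: tends_cst | rewrite expr2; apply: tendsM].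
have ny : cnorm y <= 1.
  apply: (tends_le hy); exists 0%N => n _; apply: le_trans (it_norm n hx) _.
  by case/andP: (sit_bd n).
exists (1 - y); split.
- by rewrite -scal1; apply: psd_sub_norm.
- have h2 : y + y = x + y ^+ 2.
    rewrite {1 2}ey -scalerDl -rmorphD (_ : _ + _ = 1) ?rmorph1 ?scale1r //.
    by field.
  by rewrite -(opprB y 1) sqrrN sqrrB1 mulr2n h2 [x + _]addrC opprD addrA subrr add0r addrC.
- move=> z hz; apply: commrB; first exact: commr1.
  by apply: (tends_comm hy) => n; apply: it_comm.
Qed.

(** Scaling by [t] brings [a] into the form [1 - x] with [x] of norm at most 1. *)
Lemma csqrt a : psd a -> exists s,
  [/\ psd s, s ^+ 2 = a & forall z, GRing.comm z a -> GRing.comm z s].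
Proof.
move=> [sa [t t0 ha]]; have [t00|tn0] := eqVneq t 0.
  have : a = 0.
    apply: cnorm_eq0; apply/eqP; rewrite eq_le cnorm_ge0 andbT.
    by move: ha; rewrite t00 scale0r sub0r cnormN.
  move=> ->; exists 0; split; [exact: psd0 | by rewrite expr0n | by move=> *; exact: commr0].
have tp : 0 < t by rewrite lt_def tn0.
pose x := 1 - (t^-1)%:C *: a.
have hx : x = (t^-1)%:C *: (t%:B - a).
  by rewrite scalerBr scaleRA mulVf // rmorph1 scale1r.
have [] := @csqrt1 x.
- by rewrite starB star1 starZr sa.
- rewrite hx cnormZ_ge0 ?invr_ge0 // mulrC.
  by rewrite ler_pdivrMr // mul1r.
move=> s [ps es cs]; exists ((Num.sqrt t)%:C *: s); split.
- by apply: psdZ; rewrite ?sqrtr_ge0.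
- rewrite exprZn -rmorphXn sqr_sqrtr // es /x opprB addrC subrK.
  by rewrite scaleRA divff // rmorph1 scale1r.
- move=> z hz; rewrite /GRing.comm -scalerAr -scalerAl cs //.
  by apply: commrB; [exact: commr1 | rewrite /GRing.comm -scalerAr -scalerAl hz].
Qed.

Lemma psd_sa a : psd a -> star a = a. Proof. by case. Qed.

(** [u = c + i s] satisfies [u^* u = c^2 + s^2], which gives the bounds on its
    real and imaginary parts. *)
Lemma circle_bound c s k : star c = c -> star s = s -> GRing.comm c s -> 0 <= k ->
  c ^+ 2 + s ^+ 2 = (k ^+ 2)%:B -> cnorm c <= k /\ cnorm s <= k.
Proof.
move=> sc ss cs k0 h; pose u := c + 'i%C *: s.
have su : star u = c - 'i%C *: s.
  rewrite starD starZE sc ss (_ : conjc _ = - 'i%C) ?scaleNr //.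
  by rewrite /conjc; congr (_ +i* _)%C; rewrite oppr0.
have uu : star u * u = (k ^+ 2)%:B.
  rewrite su /u mulrBl !mulrDr -!scalerAl -!scalerAr cs opprD addrA addrK scalerA.
  by rewrite -(expr2 'i%C) sqr_i scaleN1r opprK -!expr2.
have nu : cnorm u = k.
  have := cnorm_starM u; rewrite uu cnorm_scal ger0_norm ?exprn_ge0 // => /eqP.
  by rewrite eqrXn2 ?cnorm_ge0 // => /eqP.
have nu' := cnorm_star u; rewrite nu in nu'.
split.
  have : c + c = u + star u by rewrite su /u addrACA subrr addr0.
  move=> /(congr1 (fun x => cnorm x)); rewrite -mulr2n -scaler_nat.
  rewrite -(rmorph_nat (real_complex R)) cnormZ_ge0 ?ler0n //.
  have := cnormD u (star u); rewrite nu nu'; lra.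
have : 'i%C *: (s + s) = u - star u.
  by rewrite su /u scalerDr; abel.
move=> /(congr1 (fun x => cnorm x)); rewrite cnormi -mulr2n -scaler_nat.
rewrite -(rmorph_nat (real_complex R)) cnormZ_ge0 ?ler0n //.
have := cnormB u (star u); rewrite nu nu'; lra.
Qed.

(** With [s] the square root of [k^2 - c^2], where [k] is the norm of [c], the element
    [c + i s] is [k] times a unitary, so that [k^2 - c^2 = s^2] has norm at most [k^2]. *)
Lemma psd_sq c : star c = c -> psd (c ^+ 2).
Proof.
move=> sc; split; first by rewrite starX sc.
exists (cnorm c ^+ 2); first by rewrite exprn_ge0 ?cnorm_ge0.
have [|s [ps es cs]] := @csqrt ((cnorm c ^+ 2)%:B - c ^+ 2).
  by apply: psd_sub_norm; rewrite ?starX ?sc ?cnorm_sa.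
have [//|||||_ h] := @circle_bound c s (cnorm c); rewrite ?cnorm_ge0 //.
- exact: psd_sa.
- apply: cs; apply: commrB; first exact: comm_scal.
  exact: commrX.
- by rewrite es addrC subrK.
- by rewrite -es cnorm_sa ?psd_sa // ler_pXn2r ?nnegrE ?cnorm_ge0.
Qed.

Lemma psdM a b : psd a -> psd b -> GRing.comm a b -> psd (a * b).
Proof.
move=> /csqrt[s [ps <- cs]] /csqrt[r [pr <- cr]] h.
have sr : GRing.comm s r.
  by apply: cr; apply: commr_sym; apply: cs; apply: commr_sym.
rewrite -exprMn_comm //; apply: psd_sq.
by rewrite starM !psd_sa.
Qed.

Lemma psdX a n : psd a -> psd (a ^+ n).
Proof.
move=> pa; elim: n => [|n IH]; first exact: psd1.
by rewrite exprS; apply: psdM => //; apply: commrX.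
Qed.

(** The square roots of [a] and [t - a] are the parts of [sqrt t] times a unitary. *)
Lemma psd_bound a t : psd a -> 0 <= t -> psd (t%:B - a) -> cnorm a <= t.
Proof.
move=> pa t0 pb; have [c [pc ec cc]] := csqrt pa; have [s [ps es cs]] := csqrt pb.
have cas : GRing.comm a s.
  by apply: cs; apply: commrB; [exact: comm_scal | exact: commr_refl].
have csc : GRing.comm c s by apply: commr_sym; apply: cc; apply: commr_sym.
have [|//||||h _] := @circle_bound c s (Num.sqrt t); rewrite ?psd_sa ?sqrtr_ge0 //.
  by rewrite ec es addrC subrK sqr_sqrtr.
rewrite -ec cnorm_sa ?psd_sa // -(sqr_sqrtr t0) ler_pXn2r ?nnegrE ?cnorm_ge0 //.
exact: sqrtr_ge0.
Qed.

Lemma psd_norm_le a b : psd a -> psd (b - a) -> cnorm a <= cnorm b.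
Proof.
move=> pa pb; apply: psd_bound => //.
have sb : star b = b by rewrite -[b](subrK a) starD !psd_sa.
have -> : (cnorm b)%:B - a = ((cnorm b)%:B - b) + (b - a) by rewrite addrA subrK.
by apply: psdD => //; apply: psd_sub_norm.
Qed.

Lemma psd_dist a t : psd a -> cnorm a <= t -> cnorm (t%:B - a) <= t.
Proof.
move=> pa h; apply: psd_bound; last by rewrite opprB addrC subrK.
  by apply: psd_sub_norm => //; exact: psd_sa.
exact: le_trans (cnorm_ge0 _) h.
Qed.

Lemma psd_lim u l : (forall n, psd (u n)) -> tends u l -> psd l.
Proof.
move=> pu hu; split.
  apply: tends_uniq (tends_star hu) _; apply: tends_ext hu => n.
  by rewrite psd_sa.
have [t t0 [N hN]] := tends_bounded hu; exists t => //.
apply: (@tends_le _ _ (fun n => t%:B - u n)).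
  by apply: tendsB => //; exact: tends_cst.
by exists N => n hn; apply: psd_dist => //; exact: hN.
Qed.

Let pow_bound (x C : R) : 0 <= x -> (forall k, x ^+ (2 ^ k) <= 1 + (2 ^ k)%:R * C) -> x <= 1.
Proof.
move=> x0 h; rewrite leNgt; apply/negP => x1; pose d := x - 1.
have d0 : 0 < d by rewrite subr_gt0.
have bern n : 1 + n%:R * d <= x ^+ n by exact: bernoulli.
have [m hm] : exists m, 2 * C < (2 ^ m)%:R * d ^+ 2.
  have d2 : 0 < d ^+ 2 by rewrite exprn_gt0.
  pose m := Num.bound (2 * C / d ^+ 2); exists m; rewrite -ltr_pdivrMr //.
  have C0 : 0 <= C by have := h 0%N; rewrite expn0 expr1 mul1r; rewrite /d in d0; lra.
  apply: (@lt_le_trans _ _ m%:R); first by apply: archi_boundP; rewrite divr_ge0 ?mulr_ge0 // ltW.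
  by rewrite ler_nat; apply/ltnW/ltn_expl.
have := h m.+1; rewrite expnS mulnC exprM natrM.
set M : R := (2 ^ m)%:R in hm *; have M0 : 0 < M by rewrite ltr0n expn_gt0.
have := bern (2 ^ m)%N; rewrite -/M => hb hh.
have : (1 + M * d) ^+ 2 <= (x ^+ (2 ^ m)) ^+ 2.
  by rewrite ler_pXn2r ?nnegrE ?exprn_ge0 // addr_ge0 // mulr_ge0 // ltW.
move=> /le_trans/(_ hh) h3.
have : M * (M * d ^+ 2) < M * (2 * C) by nra.
by rewrite ltr_pM2l //; lra.
Qed.

(** Since [v^2 = z v], one has [(1 - v)^n = 1 - v (1 + (1 - z) + .. + (1 - z)^(n-1))],
    so that the norm of [(1 - v)^n] grows at most linearly with [n]; as [1 - v]
    is self-adjoint, its norm is at most 1. *)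
Lemma psd_of_sq v z : star v = v -> psd z -> cnorm z <= 1 -> GRing.comm v z ->
  v ^+ 2 = z * v -> psd v.
Proof.
move=> sv pz nz cvz hv; split => //; exists 1 => //.
rewrite scal1; set r := 1 - v; pose S n := \sum_(j < n) (1 - z) ^+ j.
have sr : star r = r by rewrite starB star1 sv.
have rn n : r ^+ n = 1 - v * S n.
  elim: n => [|n IH]; first by rewrite /S big_ord0 mulr0 subr0.
  have -> : S n.+1 = 1 + (1 - z) * S n.
    rewrite /S big_ord_recl expr0 mulr_sumr; congr (_ + _).
    by apply: eq_bigr => i _; rewrite exprS.
  rewrite exprS IH mulrBr mulr1 mulrDr mulr1 opprD addrA; congr (_ - _).
  by rewrite !mulrA; congr (_ * _); rewrite /r mulrBl mul1r -expr2 hv mulrBr mulr1 cvz.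
have nz1 : cnorm (1 - z) <= 1 by rewrite -scal1; apply: psd_dist.
have rb n : cnorm (r ^+ n) <= 1 + n%:R * cnorm v.
  rewrite rn; apply: le_trans (cnormB _ _) _; rewrite cnorm1 lerD2l.
  apply: le_trans (cnormM _ _) _; rewrite mulrC ler_wpM2r ?cnorm_ge0 //.
  apply: le_trans (cnorm_sum _ _ _) _.
  rewrite -[n in n%:R]card_ord -sumr_const; apply: ler_sum => i _.
  by apply: le_trans (cnormX _ _) _; rewrite exprn_ile1 ?cnorm_ge0.
apply: (pow_bound (cnorm_ge0 _)) => k; apply: le_trans (rb _).
elim: k => [|k IH]; first by rewrite !expn0 !expr1.
rewrite expnS mulnC !exprM cnorm_sa ?starX ?sr //.
by rewrite ler_pXn2r ?nnegrE ?exprn_ge0 ?cnorm_ge0.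
Qed.

Lemma psd_gt_scale a : exists2 r, 0 < r & cnorm (r%:C *: a) <= 1.
Proof.
have h : 0 < cnorm a + 1 by rewrite ltr_wpDl ?cnorm_ge0.
exists (cnorm a + 1)^-1; first by rewrite invr_gt0.
rewrite cnormZ_ge0 ?invr_ge0 ?(ltW h) // mulrC ler_pdivrMr // mul1r.
by rewrite lerDl.
Qed.

Lemma psdZ_inv r a : 0 < r -> psd (r%:C *: a) -> psd a.
Proof.
move=> r0 /(@psdZ r^-1 _ _); rewrite scaleRA mulVf ?gt_eqF // rmorph1 scale1r.
by apply; rewrite invr_ge0 ltW.
Qed.

(** [v] is the negative part [(z - a) / 2] of [a], where [z] is the square root of [a^2]. *)
Lemma neg_part a : star a = a ->
  exists v, [/\ psd v, a * v = - v ^+ 2 & (v = 0 -> psd a)].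
Proof.
move=> sa; have pa2 := psd_sq sa; have [z [pz ez cz]] := csqrt pa2.
have caz : GRing.comm a z by apply: cz; apply: commrX.
pose v := (2^-1)%:C *: (z - a).
have h2 : (2^-1 : R) + 2^-1 = 1 by field.
have sv : star v = v by rewrite starZr starB sa psd_sa.
have hav : a * v = - (z * v).
  rewrite -!scalerAr -scalerN; congr (_ *: _).
  by rewrite !mulrBr -expr2 -expr2 ez opprB caz.
have cvz : GRing.comm v z.
  rewrite /GRing.comm -scalerAl -scalerAr; congr (_ *: _).
  by rewrite mulrBl mulrBr caz.
have hv : v ^+ 2 = z * v.
  rewrite expr2 {1}/v -scalerAl mulrBl hav opprK -mulr2n -scaler_nat scalerA.
  by rewrite -(rmorph_nat (real_complex R)) -rmorphM mulVf ?pnatr_eq0 // rmorph1 scale1r.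
have pv : psd v.
  have [r r0 hr] := psd_gt_scale z.
  apply: (psdZ_inv r0); apply: (@psd_of_sq _ (r%:C *: z)) => //.
  - by rewrite starZr sv.
  - by apply: psdZ => //; apply: ltW.
  - have cc x y : GRing.comm x y -> GRing.comm (r%:C *: x) (r%:C *: y).
      by move=> h; rewrite /GRing.comm -!scalerAl -!scalerAr h.
    exact: cc.
  - by rewrite exprZn hv expr2 -scalerAl -[in RHS]scalerAr scalerA.
exists v; split => //; first by rewrite hv.
move=> v0; have : z - a = 0.
  have : (2%:R)%:C *: v = 0 by rewrite v0 scaler0.
  by rewrite scaleRA divff ?pnatr_eq0 // rmorph1 scale1r.
by move/subr0_eq => <-.
Qed.

(** Only commuting elements occur, so that the products met in the induction are positive. *)
Lemma psd_bern q n : psd q -> psd ((1 + q) ^+ n - 1 - n%:R * q).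
Proof.
move=> pq; elim: n => [|n IH]; first by rewrite subrr mul0r subr0; exact: psd0.
have cq : GRing.comm (1 + q) ((1 + q) ^+ n - 1 - n%:R * q).
  have h1 : GRing.comm (1 + q) q.
    by apply: commr_sym; apply: commrD; [exact: commr1 | exact: commr_refl].
  apply: commrB; last by apply: commrM => //; exact: commr_nat.
  by apply: commrB; [exact: commrX | exact: commr1].
have -> : (1 + q) ^+ n.+1 - 1 - n.+1%:R * q =
    (1 + q) * ((1 + q) ^+ n - 1 - n%:R * q) + (n%:R)%:C *: q ^+ 2.
  rewrite !mulrBr mulr1 -exprS !mulr_natl !mulrDl !mul1r rmorph_nat scaler_nat.
  rewrite mulrnAr -(expr2 q) (mulrS q); set X := (1 + q) ^+ _; set Y := _ *+ n; set Z := _ *+ n.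
  abel.
apply: psdD; last by apply: psdZ; [exact: ler0n | exact: psdX].
by apply: psdM => //; apply: psdD => //; exact: psd1.
Qed.

(** With [p = - d^* d] and [q = d d^*] both positive, [(1 + q)^n q = d (1 - p)^n d^*]
    stays bounded while its left side is at least [n q^2]; hence [q = 0]. *)
Lemma negative_square_eq0 d : psd (- (star d * d)) -> d = 0.
Proof.
wlog nd : d / cnorm (star d * d) <= 1.
  move=> th; have [r r0 hr] := psd_gt_scale (star d * d) => pd.
  have rs : 0 < Num.sqrt r by rewrite sqrtr_gt0.
  have e : star ((Num.sqrt r)%:C *: d) * ((Num.sqrt r)%:C *: d) = r%:C *: (star d * d).
    by rewrite starZr -scalerAl -scalerAr scaleRA -expr2 sqr_sqrtr // ltW.
  have : (Num.sqrt r)%:C *: d = 0.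
    by apply: th; rewrite e // -scalerN; apply: psdZ => //; apply: ltW.
  move=> /(congr1 (fun x => ((Num.sqrt r)^-1)%:C *: x)); rewrite scaler0 scaleRA.
  by rewrite mulVf ?gt_eqF // rmorph1 scale1r.
set p := - _ => pp; set q := d * star d.
have pq : psd q.
  pose x := d + star d; pose y := 'i%C *: (d - star d).
  have sx : star x = x by rewrite starD starK addrC.
  have sy : star y = y.
    rewrite starZE (_ : conjc 'i%C = - 'i%C); last first.
      by rewrite /conjc; congr (_ +i* _)%C; rewrite oppr0.
    by rewrite scaleNr -scalerN starB starK opprB.
  have e : x ^+ 2 + y ^+ 2 = (q - p) + (q - p).
    rewrite exprZn sqr_i scaleN1r !expr2 /x !mulrDl !mulrDr !mulrN !mulNr /p /q.
    abel.
  have h : q = (2^-1)%:C *: (x ^+ 2 + y ^+ 2) + p.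
    rewrite e -mulr2n -scaler_nat scalerA -(rmorph_nat (real_complex R)) -rmorphM.
    by rewrite mulVf ?pnatr_eq0 // rmorph1 scale1r subrK.
  rewrite h; apply: psdD => //; apply: psdZ; first by rewrite invr_ge0.
  by apply: psdD; exact: psd_sq.
have np : cnorm (1 - p) <= 1.
  by rewrite -scal1; apply: psd_dist => //; rewrite cnormN.
have hc n : (1 + q) ^+ n * d = d * (1 - p) ^+ n.
  elim: n => [|n IH]; first by rewrite !expr0 mul1r mulr1.
  rewrite exprSr exprS -mulrA !mulrA; rewrite -[LHS]mulrA.
  have -> : (1 + q) * d = d * (1 - p) by rewrite mulrDl mulrDr mul1r mulr1 opprK mulrA.
  by rewrite !mulrA IH -!mulrA; congr (_ * _); apply: commr_sym; apply: commrX.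
have bd n : cnorm ((1 + q) ^+ n * q) <= cnorm d ^+ 2.
  rewrite /q mulrA hc; apply: le_trans (cnormM _ _) _; rewrite cnorm_star expr2.
  rewrite ler_wpM2r ?cnorm_ge0 //; apply: le_trans (cnormM _ _) _.
  rewrite ler_piMr ?cnorm_ge0 //; apply: le_trans (cnormX _ _) _.
  by rewrite exprn_ile1 ?cnorm_ge0.
have lower n : n%:R * cnorm q ^+ 2 <= cnorm d ^+ 2.
  apply: le_trans (bd n).
  rewrite -cnorm_sa ?psd_sa // -cnormZ_ge0 ?ler0n //; apply: psd_norm_le.
    by apply: psdZ; [exact: ler0n | exact: psdX].
  have -> : (1 + q) ^+ n * q - (n%:R)%:C *: q ^+ 2 = ((1 + q) ^+ n - 1 - n%:R * q) * q + q.
    by rewrite !mulrBl mul1r addrAC subrK rmorph_nat scaler_nat mulr_natl mulrnAl (expr2 q).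
  apply: psdD => //; apply: psdM => //; first exact: psd_bern.
  have h1 : GRing.comm q (1 + q) by apply: commrD; [exact: commr1 | exact: commr_refl].
  apply: commr_sym; apply: commrB; last by apply: commrM; [exact: commr_nat|exact: commr_refl].
  by apply: commrB; [exact: commrX | exact: commr1].
have q0 : cnorm q = 0.
  apply/eqP; rewrite eq_le cnorm_ge0 andbT leNgt; apply/negP => q0.
  have q2 : 0 < cnorm q ^+ 2 by rewrite exprn_gt0.
  have : cnorm d ^+ 2 / cnorm q ^+ 2 < (Num.bound (cnorm d ^+ 2 / cnorm q ^+ 2))%:R.
    by apply: archi_boundP; rewrite divr_ge0 // exprn_ge0 ?cnorm_ge0.
  by rewrite ltr_pdivrMr // ltNge lower.
have : cnorm d ^+ 2 == 0 by rewrite -cnorm_mulstar -/q q0.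
by rewrite expf_eq0 => /eqP/cnorm_eq0.
Qed.

(** Kaplansky's argument: if [v] is the negative part of [a = c^* c], the element
    [d = c v] satisfies [d^* d = - v^3]; hence it vanishes, and so does [v]. *)
Lemma psd_starM c : psd (star c * c).
Proof.
set a := star c * c; have sa : star a = a by rewrite starM starK.
have [v [pv hav hv]] := neg_part sa; apply: hv.
pose d := c * v.
have hd : star d * d = - v ^+ 3.
  by rewrite starM psd_sa // mulrA -(mulrA v) -/a -mulrA hav mulrN -exprS.
have d0 : d = 0.
  by apply: negative_square_eq0; rewrite hd opprK; apply: psdX.
have v3 : v ^+ 3 = 0 by rewrite -[_ ^+ 3]opprK -hd d0 mulr0 oppr0.
have v4 : (v ^+ 2) ^+ 2 = 0 by rewrite -exprM exprS v3 mulr0.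
apply: cnorm_eq0; apply/eqP.
have : cnorm v ^+ 4 == 0.
  by rewrite (exprM _ 2 2) -cnorm_sa ?psd_sa // -cnorm_sa ?v4 ?cnorm0 // starX psd_sa.
by rewrite expf_eq0.
Qed.

Lemma positiveP a : positive a <-> psd a.
Proof.
split=> [[c ->]|/csqrt[s [ps <- _]]]; first exact: psd_starM.
by exists s; rewrite psd_sa // expr2.
Qed.

Lemma psd_conj a b : psd a -> psd (star b * a * b).
Proof.
move=> /csqrt[s [ps <- _]]; have := psd_starM (s * b).
by rewrite starM (psd_sa ps) (expr2 s) !mulrA.
Qed.

Lemma psd_sum (I : Type) (s : seq I) (P : pred I) (F : I -> B) :
  (forall i, P i -> psd (F i)) -> psd (\sum_(i <- s | P i) F i).
Proof. by move=> h; elim/big_rec: _ => [|i x /h]; [exact: psd0 | exact: psdD]. Qed.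

End PositiveCone.

(** * Positive-definite kernels *)

Section Inverse.
Variables (R : realType) (B : cstarAlgType R).
Implicit Types (a x : B).

(** The partial sums of the geometric series of [x] are dominated by those of [r]. *)
Lemma neumann x (r : R) : 0 <= r -> r < 1 -> cnorm x <= r ->
  exists y, [/\ (1 - x) * y = 1, y * (1 - x) = 1 & star x = x -> star y = y].
Proof.
move=> r0 r1 hx; pose u n := iter n (fun y => 1 + x * y) 1.
pose s n := iter n (fun t : R => 1 + r * t) 1.
have [y hy] : exists y, tends u y.
  apply: (@tends_dominated _ _ _ s (1 - r)^-1) => n; last first.
    elim: n => [|n IH] /=; first by rewrite invf_ge1 ?lerBlDr ?lerDl // subr_gt0.
    have e : (1 - r)^-1 = 1 + r * (1 - r)^-1 by field; rewrite subr_eq0 eq_sym lt_eqF.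
    by rewrite e lerD2l ler_wpM2l.
  elim: n => [|n IH].
    by rewrite /= !mulr1 [1 + x]addrC addrK [1 + r]addrC addrK.
  have -> : u n.+2 - u n.+1 = x * (u n.+1 - u n).
    by rewrite /= -/(u n) -/(u n.+1) mulrBr opprD addrACA subrr add0r.
  have -> : s n.+2 - s n.+1 = r * (s n.+1 - s n).
    by rewrite /= -/(s n) -/(s n.+1) mulrBr opprD addrACA subrr add0r.
  by apply: le_trans (cnormM _ _) _; apply: ler_pM; rewrite ?cnorm_ge0.
have cxy : GRing.comm x y.
  apply: (tends_comm hy); elim => [|n IH]; first exact: commr1.
  by apply: commrD; [exact: commr1 | apply: commrM => //; exact: commr_refl].
have ey : y = 1 + x * y.
  apply: (@tends_uniq _ _ (fun n => u n.+1)).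
    by move=> e /hy[N hN]; exists N => n hn; apply: hN; apply: leqW.
  by apply: tendsD; [exact: tends_cst | exact: tends_mull].
have e1 : (1 - x) * y = 1 by rewrite mulrBl mul1r {1}ey addrK.
exists y; split => //; first by rewrite mulrBr mulr1 -cxy {1}ey addrK.
move=> sx; have e2 : star y * (1 - x) = 1.
  by rewrite -[in LHS]sx -[X in _ * (X - _)]star1 -starB -starM e1 star1.
by rewrite -[star y]mulr1 -e1 mulrA e2 mul1r.
Qed.

(** With [t] the norm of [a] plus [e], the element [1 - a / t] has norm less than 1. *)
Lemma psd_inverse a (e : R) : 0 < e -> psd (a - e%:B) ->
  exists v, [/\ psd v, a * v = 1 & v * a = 1].
Proof.
move=> e0 pae; have pa : psd a.
  by rewrite -[a](subrK e%:B); apply: psdD => //; apply: psd_scal; exact: ltW.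
have sa := psd_sa pa.
pose t := cnorm a + e; have t0 : 0 < t by rewrite ltr_wpDl ?cnorm_ge0.
have ht : cnorm (t%:B - a) <= cnorm a.
  apply: psd_bound; rewrite ?cnorm_ge0 //.
    by apply: psd_sub_norm => //; rewrite lerDl ltW.
  rewrite /t scalD.
  have -> : (cnorm a)%:B - ((cnorm a)%:B + e%:B - a) = a - e%:B by abel.
  by [].
pose x := 1 - (t^-1)%:C *: a.
have hx : x = (t^-1)%:C *: (t%:B - a).
  by rewrite scalerBr scaleRA mulVf ?gt_eqF // rmorph1 scale1r.
have sx : star x = x by rewrite starB star1 starZr sa.
have [|||y [y1 y2 /(_ sx) sy]] := @neumann x (cnorm a / t).
- by rewrite divr_ge0 ?cnorm_ge0 // ltW.
- by rewrite ltr_pdivrMr // mul1r ltrDl.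
- by rewrite hx cnormZ_ge0 ?invr_ge0 ?(ltW t0) // mulrC ler_wpM2r // invr_ge0 ltW.
have ex : 1 - x = (t^-1)%:C *: a by rewrite opprB addrC subrK.
rewrite ex in y1 y2; pose v := (t^-1)%:C *: y.
have av : a * v = 1 by rewrite -scalerAr scalerAl.
have va : v * a = 1 by rewrite -scalerAl scalerAr.
have sv : star v = v by rewrite starZr sy.
exists v; split => //.
by rewrite -[v]mulr1 -av mulrA -{1}sv; apply: psd_conj.
Qed.

End Inverse.

Section Kernels.
Variables (R : realType) (B : cstarAlgType R).

(** The coefficients range over [B], so that all the matrices [K x_i x_j] are positive
    over [B]. The predicate [P] serves to run inductions on the length of words. *)
Definition pdk (T : Type) (P : pred T) (K : T -> T -> B) : Prop :=
  forall l : seq (T * B), all (fun p => P p.1) l ->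
    psd (\sum_(p <- l) \sum_(q <- l) star p.2 * K p.1 q.1 * q.2).

Lemma pdk_sub (T : Type) (P Q : pred T) K : subpred Q P -> pdk P K -> pdk Q K.
Proof. by move=> h hK l hl; apply: hK; apply: sub_all hl => p; exact: h. Qed.

Lemma eq_sum_all (V : zmodType) (T : Type) (P : pred T) (l : seq T) (F G : T -> V) :
  all P l -> (forall x, P x -> F x = G x) -> \sum_(p <- l) F p = \sum_(p <- l) G p.
Proof.
move=> hl h; elim: l hl => [|p s IH] /=; first by rewrite !big_nil.
by move=> /andP[hp /IH e]; rewrite !big_cons e h.
Qed.

Lemma pdk_ext (T : Type) (P : pred T) K L :
  (forall x y, L x y = K x y) -> pdk P K -> pdk P L.
Proof.
move=> h hK l hl; have := hK l hl; congr psd.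
by apply: eq_bigr => p _; apply: eq_bigr => q _; rewrite h.
Qed.

Lemma pdk_diag (T : Type) (P : pred T) K x : pdk P K -> P x -> psd (K x x).
Proof.
move=> hK px; have := hK [:: (x, 1)]; rewrite !big_seq1 /= px => /(_ isT).
by rewrite star1 mul1r mulr1.
Qed.

(** Polarization: the quadratic form is self-adjoint for the coefficients 1 and ['i]. *)
Lemma pdk_herm (T : Type) (P : pred T) K x y : pdk P K -> P x -> P y ->
  star (K x y) = K y x.
Proof.
move=> hK px py.
have h b : star (K x y * b + star b * K y x) = K x y * b + star b * K y x.
  have := hK [:: (x, 1); (y, b)]; rewrite /= px py => /(_ isT).
  rewrite !big_cons !big_nil /= !addr0 star1 !mul1r !mulr1.
  move=> /psd_sa hs; have hx := psd_sa (pdk_diag hK px).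
  have hy := psd_sa (psd_conj b (pdk_diag hK py)).
  move: hs; rewrite !starD hx hy.
  set u := star (K x y * b); set v := star (star b * K y x).
  set c := K x x; set d := star b * K y y * b.
  move=> e; have -> : u + v = (c + u + (v + d)) - c - d by abel.
  by rewrite e; abel.
have h1 := h 1; have hi := h ('i%C *: 1).
rewrite star1 mulr1 mul1r starD in h1.
have ii : conjc ('i%C : R[i]) = - 'i%C by rewrite /conjc; congr (_ +i* _)%C; rewrite oppr0.
have e2 : star (K x y) - star (K y x) = - (K x y - K y x).
  move: hi; rewrite starZE star1 ii scaleNr mulNr -scalerAl -scalerAr mul1r mulr1.
  rewrite starB !starZE ii !scaleNr -opprB opprK.
  move=> /(congr1 (fun z => 'i%C *: z)).
  rewrite !(scalerBr, scalerDr, scalerN) !scalerA -!expr2 sqr_i !scaleN1r.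
  move=> e; transitivity (- (- - star (K y x) - star (K x y))); first by abel.
  by rewrite e; abel.
have e3 : star (K x y) + star (K x y) = K y x + K y x.
  have -> : star (K x y) + star (K x y) =
     (star (K x y) + star (K y x)) + (star (K x y) - star (K y x)) by abel.
  by rewrite h1 e2; abel.
have e4 : (2%:R : R[i]) *: star (K x y) = 2%:R *: K y x by rewrite !scaler_nat !mulr2n.
by apply: (scalerI _ e4); rewrite pnatr_eq0.
Qed.

(** A linear combination of points of [S], expanded along [e], is one of points
    of [T], so that the quadratic forms agree. *)
Lemma pdk_expand (T S : Type) (P : pred T) (Q : pred S) (K : T -> T -> B)
    (e : S -> seq (T * B)) (L : S -> S -> B) :
  pdk P K ->
  (forall x, Q x -> all (fun p => P p.1) (e x)) ->
  (forall x y, Q x -> Q y ->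
     L x y = \sum_(p <- e x) \sum_(q <- e y) star p.2 * K p.1 q.1 * q.2) ->
  pdk Q L.
Proof.
move=> hK he hL l hl.
pose l' := flatten [seq [seq (p.1, p.2 * x.2) | p <- e x.1] | x <- l].
have hl' : all (fun p => P p.1) l'.
  move: (hl); rewrite /l'; elim: (l) => //= x s IH /andP[hx hs].
  by rewrite all_cat IH // andbT all_map; apply: sub_all (he _ hx).
have := hK l' hl'; congr psd.
rewrite big_flatten big_map; apply: (eq_sum_all hl) => x hx.
rewrite big_map -[RHS]/(\sum_(q <- l) _).
transitivity (\sum_(p <- e x.1) \sum_(y <- l) \sum_(q <- e y.1)
   star (p.2 * x.2) * K p.1 q.1 * (q.2 * y.2)).
  apply: eq_bigr => p _; rewrite big_flatten big_map; apply: eq_bigr => y _.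
  by rewrite big_map.
rewrite exchange_big /=; apply: (eq_sum_all hl) => y hy.
rewrite hL // mulr_sumr mulr_suml; apply: eq_bigr => p _.
rewrite mulr_sumr mulr_suml; apply: eq_bigr => q _.
by rewrite starM !mulrA.
Qed.

Lemma pdk_add (T : Type) (P : pred T) K L :
  pdk P K -> pdk P L -> pdk P (fun x y => K x y + L x y).
Proof.
move=> hK hL l hl; have := psdD (hK l hl) (hL l hl); congr psd.
rewrite -big_split; apply: eq_bigr => p _; rewrite -big_split; apply: eq_bigr => q _.
by rewrite /= mulrDr mulrDl.
Qed.

Lemma psd_gram (T : Type) (l : seq T) (f : T -> B) :
  psd (\sum_(p <- l) \sum_(q <- l) star (f p) * f q).
Proof.
have := psd_starM (\sum_(p <- l) f p); congr psd.
by rewrite star_sum mulr_suml; apply: eq_bigr => p _; rewrite mulr_sumr.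
Qed.

Lemma pdk_rank1 (T : Type) (P : pred T) (f : T -> B) :
  pdk P (fun x y => star (f x) * f y).
Proof.
move=> l hl; have := psd_gram l (fun p => f p.1 * p.2); congr psd.
by apply: eq_bigr => p _; apply: eq_bigr => q _; rewrite starM !mulrA.
Qed.

(** Cholesky decomposition: the Schur complement of the first entry, which is
    invertible, satisfies the same lower bound. *)
Lemma cholesky n (A : nat -> nat -> B) (e : R) : 0 < e ->
  (forall i j, (i < n)%N -> (j < n)%N -> star (A i j) = A j i) ->
  (forall b : nat -> B,
     psd (\sum_(i < n) \sum_(j < n) star (b i) * A i j * b j
          - e%:C *: \sum_(i < n) star (b i) * b i)) ->
  exists C : nat -> nat -> B, forall i j, (i < n)%N -> (j < n)%N ->
    A i j = \sum_(k < n) star (C k i) * C k j.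
Proof.
move=> e0; elim: n A => [|n IH] A hA pA; first by exists (fun _ _ => 0).
pose a := A 0%N 0%N.
have pa : psd (a - e%:B).
  have := pA (fun i => if i is 0%N then 1 else 0); congr (psd (_ - _)).
    rewrite big_ord_recl [X in _ + X]big1 ?addr0 => [|i _]; last first.
      by rewrite big1 // => j _; rewrite /= star0 !mul0r.
    rewrite big_ord_recl [X in _ + X]big1 ?addr0 => [|i _]; last by rewrite /= mulr0.
    by rewrite /= star1 mulr1 mul1r.
  rewrite big_ord_recl [X in _ + X]big1 ?addr0 => [|i _]; last by rewrite /= mulr0.
  by rewrite /= star1 mulr1.
have [v [pv av va]] := psd_inverse e0 pa.
have sa : star a = a by apply: hA.
have [r [pr er cr]] := csqrt pv.
have car : GRing.comm a r by apply: cr; rewrite /GRing.comm av va.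
pose S i j := A i.+1 j.+1 - A i.+1 0%N * v * A 0%N j.+1.
have hS i j : (i < n)%N -> (j < n)%N -> star (S i j) = S j i.
  by move=> hi hj; rewrite starB !starM (psd_sa pv) !hA ?ltnS // mulrA.
have [b|C hC] := IH S hS.
  pose w := \sum_(j < n) A 0%N j.+1 * b j.
  pose b' i := if i is k.+1 then b k else - (v * w).
  have sw : star w = \sum_(i < n) star (b i) * A i.+1 0%N.
    by rewrite star_sum; apply: eq_bigr => i _; rewrite starM hA ?ltnS.
  have := psdD (pA b') (psdZ (ltW e0) (psd_starM (v * w))); congr psd.
  rewrite !big_ord_recl /=.
  have -> : \sum_(i < n) \sum_(j < n.+1) star (b' (bump 0 i)) * A (bump 0 i) j * b' j =
     - star w * (v * w) + \sum_(i < n) \sum_(j < n) star (b i) * A i.+1 j.+1 * b j.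
    rewrite sw -sumrN mulr_suml -big_split; apply: eq_bigr => i _.
    by rewrite big_ord_recl /= mulrN mulNr.
  have -> : \sum_(i < n) star (- (v * w)) * A 0%N (bump 0 i) * b' (bump 0 i) =
    - (star (v * w) * w).
    by rewrite starN -mulNr [RHS]mulr_sumr; apply: eq_bigr => i _; rewrite /= mulrA.
  have -> : \sum_(i < n) \sum_(j < n) star (b i) * S i j * b j =
      \sum_(i < n) \sum_(j < n) star (b i) * A i.+1 j.+1 * b j - star w * (v * w).
    rewrite sw mulr_suml -sumrB; apply: eq_bigr => i _.
    rewrite !mulr_sumr -sumrB; apply: eq_bigr => j _.
    by rewrite mulrBr mulrBl !mulrA.
  rewrite -/a starN mulrNN starM (psd_sa pv) mulNr.
  rewrite !mulNr !mulrN !opprK -!mulrA (mulrA a v) av mul1r scalerDr.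
  set X := star w * _; set Y := \sum_(i < n) _; set Z := \sum_(i < n) _.
  set U := _ *: _; set V := _ *: _; abel.
exists (fun k j => if k is k'.+1 then if j is j'.+1 then C k' j' else 0
                   else r * A 0%N j).
have rr : r * r = v by rewrite -expr2.
move=> [|i] [|j] hi hj; rewrite big_ord_recl /=.
- rewrite big1 => [|k _]; last by rewrite star0 mul0r.
  by rewrite addr0 starM -/a sa (psd_sa pr) mulrA -(mulrA a) rr av mul1r.
- rewrite big1 => [|k _]; last by rewrite star0 mul0r.
  by rewrite addr0 starM -/a sa (psd_sa pr) mulrA -(mulrA a) rr av mul1r.
- rewrite big1 => [|k _]; last by rewrite mulr0.
  by rewrite addr0 starM (psd_sa pr) hA // mulrA -(mulrA _ r r) rr -mulrA va mulr1.
- rewrite -hC // /S starM (psd_sa pr) hA // mulrA -(mulrA _ r r) rr.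
  by rewrite addrC subrK.
Qed.

Lemma tends_invn (x d : B) : tends (fun n => x + (n.+1%:R^-1 : R)%:C *: d) x.
Proof.
move=> e e0; exists (Num.bound (cnorm d / e)) => n hn.
rewrite addrC addKr cnormZ_ge0 ?invr_ge0 // mulrC ltr_pdivrMr //.
rewrite mulrC -ltr_pdivrMr //; apply: (@lt_le_trans _ _ (Num.bound (cnorm d / e))%:R).
  by apply: archi_boundP; rewrite divr_ge0 ?cnorm_ge0 // ltW.
by rewrite ler_nat; apply: leqW.
Qed.

(** A positive-definite kernel [K] is, up to [e] times the identity, a Gram
    matrix [C^* C], and [phi] is positive on each Gram term of rank one; this is the
    positivity of the inner product on the interior tensor product of two
    Hilbert modules. *)
Lemma pdk_tensor (T S : Type) (P : pred T) (K : T -> T -> B) (phi : B -> S -> S -> B) :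
  pdk P K ->
  (forall x y s t, phi (x + y) s t = phi x s t + phi y s t) ->
  (forall (r : R) x s t, phi (r%:C *: x) s t = r%:C *: phi x s t) ->
  pdk predT (fun u v : B * S => phi (star u.1 * v.1) u.2 v.2) ->
  pdk (fun u : T * S => P u.1) (fun u v : T * S => phi (K u.1 v.1) u.2 v.2).
Proof.
move=> hK phiD phiZ hphi l hl.
have phi0 s t : phi 0 s t = 0.
  by apply: (addrI (phi 0 s t)); rewrite -phiD !addr0.
have phi_sum n (F : 'I_n -> B) s t : phi (\sum_(k < n) F k) s t = \sum_(k < n) phi (F k) s t.
  by apply: (big_morph (fun x => phi x s t)).
case: l hl => [|x0 l0] hl; first by rewrite big_nil; exact: psd0.
set l := x0 :: l0 in hl *; set n := size l.
pose t i := (nth x0 l i).1.1; pose s i := (nth x0 l i).1.2; pose b i := (nth x0 l i).2.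
have sumE (F : (T * S) * B -> B) : \sum_(p <- l) F p = \sum_(i < n) F (nth x0 l i).
  by rewrite (big_nth x0) big_mkord.
have Pt i : (i < n)%N -> P (t i) by move=> hi; exact: (all_nthP x0 hl).
pose D := \sum_(i < n) star (b i) * phi 1 (s i) (s i) * b i.
set X := \sum_(p <- l) _; apply: (psd_lim _ (tends_invn X D)) => m.
set e : R := m.+1%:R^-1; have e0 : 0 < e by rewrite invr_gt0 ltr0n.
pose A i j := K (t i) (t j) + (if i == j then e%:B else 0).
have [|b'|C hC] := @cholesky n A e e0.
- move=> i j hi hj; rewrite /A starD (pdk_herm hK) ?Pt // eq_sym.
  by case: ifP => _; rewrite ?star_scal ?star0.
- have hl' : all (fun p : T * B => P p.1) [seq (t i, b' i) | i <- iota 0 n].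
    by rewrite all_map; apply/allP => i; rewrite mem_iota => /andP[_ hi] /=; exact: Pt.
  have := hK _ hl'; congr psd.
  have e1 (F : T * B -> B) : \sum_(p <- [seq (t i, b' i) | i <- iota 0 n]) F p =
      \sum_(i < n) F (t i, b' i).
    by rewrite big_map -[X in iota 0 X]subn0 -/(index_iota 0 n) big_mkord.
  rewrite e1 scaler_sumr -sumrB; apply: eq_bigr => i _.
  rewrite e1 /= /A; transitivity (\sum_(j < n) (star (b' i) * K (t i) (t j) * b' j +
     (if val i == val j then star (b' i) * e%:B * b' j else 0)) - e%:C *: (star (b' i) * b' i)).
    rewrite big_split /= [X in _ = _ + X - _](bigD1 i) //= eqxx [X in _ = _ + (_ + X) - _]big1.
      rewrite addr0 mulr_scal -scalerAl addrK //.
    by move=> j /negPf; rewrite eq_sym -val_eqE => /= ->.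
  congr (_ - _); apply: eq_bigr => j _; rewrite mulrDr mulrDl.
  by case: ifP => _; rewrite ?mulr0 ?mul0r.
have : psd (\sum_(k < n) \sum_(p <- [seq ((C k i, s i), b i) | i <- iota 0 n])
   \sum_(q <- [seq ((C k i, s i), b i) | i <- iota 0 n])
     star p.2 * phi (star p.1.1 * q.1.1) p.1.2 q.1.2 * q.2).
  by apply: psd_sum => k _; apply: hphi; exact: all_predT.
congr psd.
have e1 (k : 'I_n) (F : (B * S) * B -> B) :
    \sum_(p <- [seq ((C k i, s i), b i) | i <- iota 0 n]) F p =
    \sum_(i < n) F ((C k i, s i), b i).
  by rewrite big_map -[X in iota 0 X]subn0 -/(index_iota 0 n) big_mkord.
transitivity (\sum_(i < n) \sum_(j < n) star (b i) * phi (A i j) (s i) (s j) * b j).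
  under eq_bigr => k _ do (rewrite e1; under eq_bigr do rewrite e1 /=).
  rewrite exchange_big; apply: eq_bigr => i _; rewrite exchange_big; apply: eq_bigr => j _ /=.
  by rewrite hC // phi_sum mulr_sumr mulr_suml.
rewrite /X sumE /D scaler_sumr -big_split; apply: eq_bigr => i _ /=.
rewrite sumE /A -/(t i) -/(s i) -/(b i).
transitivity (\sum_(j < n) (star (b i) * phi (K (t i) (t j)) (s i) (s j) * b j +
     (if val i == val j then star (b i) * phi (e%:B) (s i) (s j) * b j else 0))).
  apply: eq_bigr => j _; rewrite phiD mulrDr mulrDl; congr (_ + _).
  by case: ifP => _; rewrite ?phi0 ?mulr0 ?mul0r.
rewrite big_split /=; congr (_ + _); rewrite (bigD1 i) //= eqxx big1 ?addr0.
  by rewrite phiZ -scalerAr -scalerAl.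
by move=> j /negPf; rewrite eq_sym -val_eqE => /= ->.
Qed.

(** The matrix of the [x_i^* x_j] is [C^* C] for the matrix [C] with first row [x] and
    zeros elsewhere; its image under [f] is then [D^* D], a sum of Gram kernels. *)
Lemma cp_kernel (f : B -> B) : completely_positive f ->
  pdk predT (fun u v : B * unit => f (star u.1 * v.1)).
Proof.
move=> hf l _; case: l => [|x0 l0]; first by rewrite big_nil; exact: psd0.
set l := x0 :: l0; pose n := size l0.
have sumE (F : (B * unit) * B -> B) : \sum_(p <- l) F p = \sum_(i < n.+1) F (nth x0 l i).
  by rewrite (big_nth x0) big_mkord.
pose x i := (nth x0 l i).1.1; pose b i := (nth x0 l i).2.
pose A : 'M[B]_n.+1 := \matrix_(i, j) (star (x i) * x j).
have [|D hD] := hf n.+1 A.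
  exists (\matrix_(i, j) if i == 0 then x j else 0); apply/matrixP => i j.
  rewrite !mxE big_ord_recl !mxE big1 ?addr0 // => k _; rewrite !mxE /=.
  by rewrite mulr0.
have := @psd_sum _ _ _ (index_enum 'I_n.+1) predT
  (fun k => \sum_(p <- enum 'I_n.+1) \sum_(q <- enum 'I_n.+1) star (D k p * b p) * (D k q * b q))
  (fun k _ => psd_gram _ _).
congr psd; rewrite sumE exchange_big big_enum /=; apply: eq_bigr => i _.
rewrite sumE exchange_big big_enum /=; apply: eq_bigr => j _.
have := congr1 (fun M : 'M[B]_n.+1 => M i j) hD; rewrite /= !mxE => ->.
rewrite mulr_sumr mulr_suml; apply: eq_bigr => k _.
by rewrite !mxE starM !mulrA.
Qed.

End Kernels.

(** * Cutting words into consecutive pieces *)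

Section Splits.
Variables (T : eqType) (V : zmodType).
Implicit Types (s t : seq T).

Fixpoint splits (s : seq T) : seq (seq T * seq T) :=
  if s is b :: s' then ([::], s) :: [seq (b :: p.1, p.2) | p <- splits s']
  else [:: ([::], [::])].

(** A word is cut or not after its first letter, whence the two branches; the
    factors are nonempty, so that only the empty word has the empty decomposition. *)
Fixpoint chunks (s : seq T) : seq (seq (seq T)) :=
  if s is b :: s' then
    [seq [:: b] :: c | c <- chunks s'] ++
    [seq (b :: head [::] c) :: behead c | c <- chunks s' & c != [::]]
  else [:: [::]].

Arguments splits : simpl never.
Arguments chunks : simpl never.

Lemma sum_splits_nil (F : seq T * seq T -> V) :
  \sum_(p <- splits [::]) F p = F ([::], [::]).
Proof. exact: big_seq1. Qed.

Lemma sum_splits_cons b s (F : seq T * seq T -> V) :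
  \sum_(p <- splits (b :: s)) F p =
  F ([::], b :: s) + \sum_(p <- splits s) F (b :: p.1, p.2).
Proof. by rewrite big_cons big_map. Qed.

Lemma splits_cat p s : p \in splits s -> p.1 ++ p.2 = s.
Proof.
elim: s p => [|b s IH] p /=; first by rewrite inE => /eqP ->.
by rewrite inE => /orP[/eqP ->//|/mapP[q /IH <- ->]].
Qed.

Lemma splits_size p s : p \in splits s -> (size p.1 + size p.2 = size s)%N.
Proof. by move=> /splits_cat <-; rewrite size_cat. Qed.

Lemma splits_sizer p s n : p \in splits s -> (size s < n)%N -> (size p.2 < n)%N.
Proof. by move=> /splits_size <-; apply: leq_ltn_trans; exact: leq_addl. Qed.

Lemma splits_sizel p s n : p \in splits s -> (size s < n)%N -> (size p.1 < n)%N.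
Proof. by move=> /splits_size <-; apply: leq_ltn_trans; exact: leq_addr. Qed.

Lemma sum_splits_mid s x t (F : seq T * seq T -> V) :
  \sum_(p <- splits (s ++ x :: t)) F p =
  \sum_(p <- splits s) F (p.1, p.2 ++ x :: t) +
  \sum_(q <- splits t) F (s ++ x :: q.1, q.2).
Proof.
elim: s F => [|b s IH] F; first by rewrite sum_splits_nil sum_splits_cons.
by rewrite /= -[LHS]/(\sum_(p <- splits (b :: (s ++ x :: t))) _) !sum_splits_cons IH addrA.
Qed.

Lemma sum_splits_assoc s (F : seq T -> seq T -> seq T -> V) :
  \sum_(p <- splits s) \sum_(q <- splits p.1) F q.1 q.2 p.2 =
  \sum_(p <- splits s) \sum_(q <- splits p.2) F p.1 q.1 q.2.
Proof.
elim: s F => [|b s IH] F; first by rewrite !sum_splits_nil.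
rewrite !sum_splits_cons /= ?sum_splits_cons ?sum_splits_nil -addrA; congr (_ + _).
rewrite -(IH (fun u v w => F (b :: u) v w)) -big_split; apply: eq_bigr => p _.
by rewrite sum_splits_cons.
Qed.

Lemma sum_splits_rev s (F : seq T * seq T -> V) :
  \sum_(p <- splits (rev s)) F p = \sum_(p <- splits s) F (rev p.2, rev p.1).
Proof.
elim: s F => [|b s IH] F; first by rewrite !sum_splits_nil.
rewrite rev_cons -cats1 sum_splits_mid sum_splits_nil sum_splits_cons addrC IH.
rewrite /= cats1 -rev_cons; congr (_ + _).
by apply: eq_bigr => p _; rewrite cats1 -rev_cons.
Qed.

Lemma sum_splits_last s (F : seq T * seq T -> V) :
  \sum_(p <- splits s) F p =
  F (s, [::]) + \sum_(p <- splits s | (size p.1 < size s)%N) F p.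
Proof.
elim: s F => [|b s IH] F.
  by rewrite /= big_seq1 big_cons big_nil /= addr0.
rewrite sum_splits_cons IH big_cons /= big_map addrCA; congr (_ + (_ + _)).
Qed.

Lemma sum_chunks_nil (F : seq (seq T) -> V) : \sum_(c <- chunks [::]) F c = F [::].
Proof. exact: big_seq1. Qed.

Lemma sum_chunks_cons b s (F : seq (seq T) -> V) :
  \sum_(c <- chunks (b :: s)) F c =
  \sum_(p <- splits s) \sum_(c <- chunks p.2) F ((b :: p.1) :: c).
Proof.
elim: s b F => [|a s IH] b F.
  by rewrite sum_splits_nil /= sum_chunks_nil big_cons big_nil addr0.
rewrite sum_splits_cons [chunks (b :: _)]/= -/(chunks (a :: s)) big_cat !big_map /=.
rewrite -/(chunks (a :: s)) big_filter; congr (_ + _).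
by rewrite big_mkcond IH.
Qed.

Lemma chunks_flatten c s : c \in chunks s -> flatten c = s.
Proof.
elim: s c => [|b s IH] c; first by rewrite inE => /eqP ->.
rewrite /= mem_cat => /orP[/mapP[d /IH <- ->]//|/mapP[d]].
by rewrite mem_filter; case: d => [|g d] //= /IH <- ->.
Qed.

Lemma chunks_size c s : c \in chunks s -> (size c <= size s)%N.
Proof.
elim: s c => [|b s IH] c; first by rewrite inE => /eqP ->.
rewrite /= mem_cat => /orP[/mapP[d /IH h ->]//|/mapP[d]].
by rewrite mem_filter; case: d => [|g d] //= /IH /= h -> /=; apply: leqW.
Qed.

Lemma chunk_size g c s : c \in chunks s -> g \in c -> (size g <= size s)%N.
Proof.
move=> /chunks_flatten <-; elim: c => //= a c IH; rewrite inE size_cat.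
by case/orP => [/eqP ->|/IH /leq_trans]; [exact: leq_addr | apply; exact: leq_addl].
Qed.

Lemma sum_chunks_top s (F : seq (seq T) -> V) :
  \sum_(c <- chunks s) F c =
  F [seq [:: b] | b <- s] + \sum_(c <- chunks s | (size c < size s)%N) F c.
Proof.
elim: s F => [|b s IH] F.
  by rewrite /= big_seq1 big_cons big_nil /= addr0.
rewrite /= !big_cat !big_map /= (IH (fun c => F ([:: b] :: c))) -addrA; congr (_ + (_ + _)).
rewrite big_filter big_filter_cond big_seq_cond [RHS]big_seq_cond; apply: eq_bigl => c.
case hc : (c \in _) => //=; case: c hc => //= g c /chunks_size h.
by rewrite ltnS h.
Qed.

End Splits.

Arguments splits : simpl never.
Arguments chunks : simpl never.

Section Chunks.
Variables (T : eqType) (V : zmodType).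
Implicit Types (s t : seq T).

Lemma sum_chunks_conv s (F : seq (seq T) -> seq (seq T) -> V) :
  \sum_(c <- chunks s) \sum_(q <- splits c) F q.1 q.2 =
  \sum_(p <- splits s) \sum_(c <- chunks p.1) \sum_(d <- chunks p.2) F c d.
Proof.
have [n] := ubnP (size s); elim: n s F => // n IH [|b s] F /= hs.
  by rewrite !sum_splits_nil !sum_chunks_nil sum_splits_nil.
rewrite -[chunks (b :: s)]/(chunks (b :: s)) sum_chunks_cons sum_splits_cons sum_chunks_nil.
rewrite sum_chunks_cons.
under eq_bigr => p _ do (under eq_bigr do rewrite sum_splits_cons; rewrite big_split).
rewrite big_split; congr (_ + _).
transitivity (\sum_(p <- splits s) \sum_(q <- splits p.2)
    \sum_(c <- chunks q.1) \sum_(d <- chunks q.2) F ((b :: p.1) :: c) d).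
  apply: eq_big_seq => p /splits_sizer/(_ hs) hp /=.
  by rewrite (IH _ (fun c d => F ((b :: p.1) :: c) d)) //.
rewrite -(sum_splits_assoc s (fun u v w => \sum_(c <- chunks v) \sum_(d <- chunks w) F ((b :: u) :: c) d)).
by apply: eq_bigr => p _; rewrite sum_chunks_cons.
Qed.

(** The marked letter lies in exactly one chunk; what precedes and follows it in that
    chunk cuts off the chunks of the two remaining parts. *)
Lemma sum_chunks_mid s x t (F : seq (seq T) -> V) :
  \sum_(c <- chunks (s ++ x :: t)) F c =
  \sum_(p <- splits s) \sum_(q <- splits t) \sum_(c <- chunks p.1) \sum_(d <- chunks q.2)
    F (c ++ (p.2 ++ x :: q.1) :: d).
Proof.
have [n] := ubnP (size s); elim: n s F => // n IH [|b s] F /= hs.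
  rewrite sum_splits_nil sum_chunks_cons; apply: eq_bigr => q _.
  by rewrite sum_chunks_nil.
rewrite sum_splits_cons sum_chunks_cons sum_splits_mid addrC; congr (_ + _).
  by apply: eq_bigr => q _; rewrite sum_chunks_nil.
transitivity (\sum_(p <- splits s) \sum_(r <- splits p.2) \sum_(q <- splits t)
    \sum_(c <- chunks r.1) \sum_(d <- chunks q.2)
      F ((b :: p.1) :: (c ++ (r.2 ++ x :: q.1) :: d))).
  apply: eq_big_seq => p /splits_sizer/(_ hs) hp /=.
  by rewrite (IH _ (fun c => F ((b :: p.1) :: c))) //.
rewrite -(sum_splits_assoc s (fun u v w => \sum_(q <- splits t) \sum_(c <- chunks v)
  \sum_(d <- chunks q.2) F ((b :: u) :: (c ++ (w ++ x :: q.1) :: d)))).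
apply: eq_bigr => p _; rewrite exchange_big; apply: eq_bigr => q _ /=.
by rewrite sum_chunks_cons.
Qed.

Lemma sum_chunks_rev s (F : seq (seq T) -> V) :
  \sum_(c <- chunks (rev s)) F c = \sum_(c <- chunks s) F (rev [seq rev g | g <- c]).
Proof.
have [n] := ubnP (size s); elim: n s F => // n IH [|b s] F /= hs.
  by rewrite !sum_chunks_nil.
rewrite sum_chunks_cons rev_cons -cats1 sum_chunks_mid sum_splits_rev.
apply: eq_big_seq => p /splits_sizer/(_ hs) hp; rewrite sum_splits_nil /=.
transitivity (\sum_(c <- chunks (rev p.2)) F (c ++ [:: rev p.1 ++ [:: b]])).
  by apply: eq_bigr => c _; rewrite sum_chunks_nil.
rewrite IH //.
by apply: eq_bigr => c _; rewrite !rev_cons -!cats1.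
Qed.

End Chunks.

Lemma sum_splits_map (T U : eqType) (V : zmodType) (h : T -> U) s (F : seq U * seq U -> V) :
  \sum_(p <- splits (map h s)) F p = \sum_(p <- splits s) F (map h p.1, map h p.2).
Proof.
elim: s F => [|b s IH] F; first by rewrite !sum_splits_nil.
by rewrite /= -/(map h (b :: s)) -/(splits (h b :: map h s)) -/(splits (b :: s)) !sum_splits_cons IH.
Qed.

Lemma sum_chunks_map (T U : eqType) (V : zmodType) (h : T -> U) s (F : seq (seq U) -> V) :
  \sum_(c <- chunks (map h s)) F c = \sum_(c <- chunks s) F (map (map h) c).
Proof.
have [n] := ubnP (size s); elim: n s F => // n IH [|b s] F /= hs.
  by rewrite !sum_chunks_nil.
rewrite -/(chunks (h b :: map h s)) -/(chunks (b :: s)) !sum_chunks_cons sum_splits_map.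
apply: eq_big_seq => p /splits_sizer/(_ hs) hp /=.
by rewrite IH //.
Qed.

(** * Series, convolution and substitution *)

Section SeriesCalculus.
Variables (R : realType) (B : cstarAlgType R).
Implicit Types (f g h F K m : seq B -> B) (k s t : seq B) (b x y : B).

(** A word [b0; ..; bn] stands for the monomial [b0 X b1 .. X bn], and a function on
    words for a formal series; this is the product of series, with unit [delta]. *)
Definition conv f g s : B := \sum_(p <- splits s) f p.1 * g p.2.
Definition delta s : B := if s is [::] then 1 else 0.

(** Substitution of [m] into [f]: for scalar series in one variable it would be the
    composition of power series. *)
Definition comp (V : zmodType) (f : seq B -> V) m s : V :=
  \sum_(c <- chunks s) f [seq m k | k <- c].

Lemma conv_delta g : conv delta g =1 g.
Proof.
case=> [|b s]; first by rewrite /conv sum_splits_nil mul1r.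
by rewrite /conv sum_splits_cons mul1r big1 ?addr0 // => p _; rewrite mul0r.
Qed.

Lemma conv_deltar g : conv g delta =1 g.
Proof.
move=> s; rewrite /conv sum_splits_last mulr1 big_seq_cond big1 ?addr0 // => p.
move=> /andP[/splits_size e h]; case: p e h => [u [|v w]] /=; last by rewrite mulr0.
by rewrite addn0 => ->; rewrite ltnn.
Qed.

Lemma convA f g h : conv (conv f g) h =1 conv f (conv g h).
Proof.
move=> s; rewrite /conv.
transitivity (\sum_(p <- splits s) \sum_(q <- splits p.1) f q.1 * g q.2 * h p.2).
  by apply: eq_bigr => p _; rewrite mulr_suml.
rewrite (sum_splits_assoc s (fun u v w => f u * g v * h w)).
by apply: eq_bigr => p _; rewrite mulr_sumr; apply: eq_bigr => q _; rewrite mulrA.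
Qed.

Lemma eq_conv_le f g f' g' s :
  (forall t, (size t <= size s)%N -> f t = f' t) ->
  (forall t, (size t <= size s)%N -> g t = g' t) -> conv f g s = conv f' g' s.
Proof.
move=> hf hg; apply: eq_big_seq => p hp.
by rewrite hf ?hg // -ltnS ?(splits_sizel hp) ?(splits_sizer hp).
Qed.

Lemma eq_conv f g f' g' : f =1 f' -> g =1 g' -> conv f g =1 conv f' g'.
Proof. by move=> hf hg s; apply: eq_conv_le. Qed.

Lemma convDl f g h s : conv (fun s => f s + g s) h s = conv f h s + conv g h s.
Proof. by rewrite -big_split; apply: eq_bigr => p _; rewrite /= mulrDl. Qed.

Lemma convDr f g h s : conv f (fun s => g s + h s) s = conv f g s + conv f h s.
Proof. by rewrite -big_split; apply: eq_bigr => p _; rewrite /= mulrDr. Qed.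

Lemma conv_cons f g b s : conv f g (b :: s) = f [::] * g (b :: s) + conv (f \o cons b) g s.
Proof. by rewrite /conv sum_splits_cons. Qed.

Lemma comp_nil (V : zmodType) (f : seq B -> V) m : comp f m [::] = f [::].
Proof. exact: sum_chunks_nil. Qed.

Lemma comp_cons (V : zmodType) (f : seq B -> V) m b s :
  comp f m (b :: s) = \sum_(p <- splits s) comp (f \o cons (m (b :: p.1))) m p.2.
Proof. exact: sum_chunks_cons. Qed.

Lemma eq_comp_le (V : zmodType) (f f' : seq B -> V) m m' s :
  f =1 f' -> (forall t, (size t <= size s)%N -> m t = m' t) -> comp f m s = comp f' m' s.
Proof.
move=> hf h; apply: eq_big_seq => c hc; rewrite hf; congr (f' _).
by apply/eq_in_map => u hu; apply: h; exact: chunk_size hu.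
Qed.

Lemma eq_comp (V : zmodType) (f f' : seq B -> V) m m' :
  f =1 f' -> m =1 m' -> comp f m =1 comp f' m'.
Proof. by move=> hf h s; apply: eq_comp_le. Qed.

Lemma comp_additive (V W : zmodType) (phi : {additive V -> W}) (f : seq B -> V) m s :
  comp (phi \o f) m s = phi (comp f m s).
Proof. by rewrite raddf_sum. Qed.

Lemma comp_delta m s : comp delta m s = delta s.
Proof.
case: s => [|b s]; first by rewrite comp_nil.
by rewrite comp_cons big1 // => p _; rewrite /comp big1.
Qed.

(** To split a chunked word between two chunks is to split the word and to chunk
    both parts. *)
Lemma comp_conv f g m : comp (conv f g) m =1 conv (comp f m) (comp g m).
Proof.
move=> s; rewrite /comp /conv.
transitivity (\sum_(c <- chunks s) \sum_(q <- splits c)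
    f [seq m k | k <- q.1] * g [seq m k | k <- q.2]).
  by apply: eq_bigr => c _; rewrite sum_splits_map.
rewrite (sum_chunks_conv s (fun c d => f [seq m k | k <- c] * g [seq m k | k <- d])).
by apply: eq_bigr => p _; rewrite mulr_suml; apply: eq_bigr => c _; rewrite mulr_sumr.
Qed.

(** ** Multilinearity *)

(** The truncation of [Ser] that recursions on the length of words preserve: it
    concerns the words of length at most [n]. *)
Definition SerN n f : Prop :=
  forall s t (c : R[i]) x y, (size s + size t < n)%N ->
    f (s ++ (c *: x + y) :: t) = c *: f (s ++ x :: t) + f (s ++ y :: t).

Lemma Ser_SerN f : Ser f <-> forall n, SerN n f.
Proof.
split=> [h n s t c x y _|h s t c x y]; first exact: h.
exact: (h (size s + size t).+1).
Qed.

Lemma Ser_additive f s t x y : Ser f -> f (s ++ (x + y) :: t) = f (s ++ x :: t) + f (s ++ y :: t).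
Proof. by move=> hf; have := hf s t 1 x y; rewrite !scale1r. Qed.

Lemma Ser0 f s t : Ser f -> f (s ++ 0 :: t) = 0.
Proof.
by move=> hf; apply: (addrI (f (s ++ 0 :: t))); rewrite -Ser_additive // !addr0.
Qed.

Lemma Ser_scale f s t c x : Ser f -> f (s ++ (c *: x) :: t) = c *: f (s ++ x :: t).
Proof. by move=> hf; have := hf s t c x 0; rewrite addr0 Ser0 // addr0. Qed.

Lemma Ser_sum (I : Type) (r : seq I) (G : I -> B) f s t : Ser f ->
  f (s ++ (\sum_(i <- r) G i) :: t) = \sum_(i <- r) f (s ++ G i :: t).
Proof.
move=> hf; elim: r => [|i r IH]; first by rewrite !big_nil Ser0.
by rewrite !big_cons Ser_additive // IH.
Qed.

Lemma Ser_cons f x : Ser f -> Ser (f \o cons x).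
Proof. by move=> hf s t c y z; exact: (hf (x :: s)). Qed.

Lemma Ser_linear f (phi : {linear B -> B}) : Ser f -> Ser (phi \o f).
Proof. by move=> hf s t c x y; rewrite /= hf linearP. Qed.

Lemma conv_SerN n f g : SerN n f -> SerN n g -> SerN n (conv f g).
Proof.
move=> hf hg s t c x y h; rewrite /conv !sum_splits_mid.
rewrite scalerDr addrACA; congr (_ + _).
  rewrite scaler_sumr -big_split; apply: eq_big_seq => p /splits_size hp.
  rewrite /= hg ?mulrDr ?scalerAr //.
  by apply: leq_ltn_trans h; rewrite leq_add2r -hp leq_addl.
rewrite scaler_sumr -big_split; apply: eq_big_seq => p /splits_size hp.
rewrite /= hf ?mulrDl ?scalerAl //.
by apply: leq_ltn_trans h; rewrite leq_add2l -hp leq_addr.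
Qed.

Lemma comp_SerN n f m : Ser f -> SerN n m -> SerN n (comp f m).
Proof.
move=> hf hm s t c x y h; rewrite /comp !sum_chunks_mid.
rewrite scaler_sumr -big_split; apply: eq_big_seq => p /splits_size hp.
rewrite scaler_sumr -big_split; apply: eq_big_seq => q /splits_size hq.
rewrite scaler_sumr -big_split; apply: eq_bigr => d _.
rewrite scaler_sumr -big_split; apply: eq_bigr => e _.
rewrite !map_cat /= hm //; apply: leq_ltn_trans h.
by rewrite -hp -hq leq_add ?leq_addl ?leq_addr.
Qed.

Lemma comp_Ser f m : Ser f -> Ser m -> Ser (comp f m).
Proof. by move=> hf /Ser_SerN hm; apply/Ser_SerN => n; apply: comp_SerN. Qed.

(** ** Associativity of substitution *)

(** Both sides sum over chunkings of a chunked word; multilinearity of [f] brings the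
    inner sums outside. *)
Lemma comp_assoc f m1 m2 : Ser f -> comp f (comp m1 m2) =1 comp (comp f m1) m2.
Proof.
move=> hf s; have [n] := ubnP (size s); elim: n f hf s => // n IH f hf [|b s] hs.
  by rewrite !comp_nil.
rewrite comp_cons [RHS]comp_cons.
transitivity (\sum_(p <- splits s)
   comp (comp (f \o cons (comp m1 m2 (b :: p.1))) m1) m2 p.2).
  apply: eq_big_seq => p hp; apply: IH; first exact: Ser_cons.
  exact: splits_sizer hp hs.
transitivity (\sum_(p <- splits s) \sum_(q <- splits p.1) \sum_(c <- chunks q.2)
   \sum_(d <- chunks p.2)
     comp (f \o cons (m1 (m2 (b :: q.1) :: [seq m2 k | k <- c]))) m1 [seq m2 k | k <- d]).
  apply: eq_bigr => p _; under [RHS]eq_bigr => q _ do rewrite exchange_big.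
  rewrite [RHS]exchange_big; apply: eq_bigr => d _ /=.
  under [RHS]eq_bigr => q _ do rewrite exchange_big.
  rewrite [RHS]exchange_big; apply: eq_bigr => e _ /=.
  have -> : comp m1 m2 (b :: p.1) = \sum_(q <- splits p.1) \sum_(c <- chunks q.2)
      m1 (m2 (b :: q.1) :: [seq m2 k | k <- c]) by exact: sum_chunks_cons.
  rewrite (Ser_sum _ _ [::]) //; apply: eq_bigr => q _.
  by rewrite (Ser_sum _ _ [::]).
rewrite (sum_splits_assoc s (fun u v w => \sum_(c <- chunks v) \sum_(d <- chunks w)
  comp (f \o cons (m1 (m2 (b :: u) :: [seq m2 k | k <- c]))) m1 [seq m2 k | k <- d])).
apply: eq_bigr => p _; rewrite -sum_chunks_conv; apply: eq_bigr => c _ /=.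
by rewrite comp_cons sum_splits_map.
Qed.

(** ** Boolean and free cumulants *)

(** [m] has the Boolean cumulants [K]: the moment of a word is the sum over the
    first block of an interval partition. *)
Definition boolean_moments m K : Prop :=
  m [::] = 0 /\ forall b s, m (b :: s) = b * (delta s + conv K m s).

Lemma boolean_moments1 m K b : boolean_moments m K -> m [:: b] = b.
Proof.
by move=> [m0 mE]; rewrite mE /conv sum_splits_nil m0 mulr0 addr0 mulr1.
Qed.

Lemma eq_boolean_moments m K K' : K =1 K' -> boolean_moments m K -> boolean_moments m K'.
Proof.
by move=> h [m0 mE]; split=> // b s; rewrite mE; congr (_ * (_ + _)); apply: eq_conv.
Qed.

Lemma boolean_moments_SerN m K n : boolean_moments m K -> SerN n K -> SerN n m ->
  SerN n.+1 m.
Proof.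
move=> [m0 mE] hK hm [|b s] t c x y h /=; rewrite !mE.
  by rewrite mulrDl scalerAl.
rewrite (@conv_SerN n) // scalerAr -mulrDr; congr (_ * _).
have d0 z : delta (s ++ z :: t) = 0 by case: (s).
by rewrite !d0 !add0r.
Qed.

(** The moments with free cumulants [F]: their Boolean cumulants are obtained by
    substituting the moments into [F]. The recursive calls are at shorter words but not at
    subterms, hence the bound [n] on the length. *)
Fixpoint mom_rec F (n : nat) s : B :=
  if n isn't n'.+1 then 0 else
  if s isn't b :: s' then 0 else
  b * (delta s' + conv (comp F (mom_rec F n')) (mom_rec F n') s').

Definition mom F s := mom_rec F (size s) s.

Lemma mom_recE F n s : (size s <= n)%N -> mom_rec F n s = mom F s.
Proof.
rewrite /mom; have [k] := ubnP (size s).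
elim: k n s => // k IH [|n] [|b s] //= hs hn.
congr (_ * (_ + _)); apply: eq_conv_le => t ht.
  apply: eq_comp_le => // u hu; have h := leq_trans hu ht.
  by rewrite IH ?(leq_trans h) ?(IH (size s)) // (leq_ltn_trans h).
by rewrite IH ?(leq_trans ht) ?(IH (size s)) // (leq_ltn_trans ht).
Qed.

Lemma mom_boolean F : boolean_moments (mom F) (comp F (mom F)).
Proof.
split=> // b s; rewrite /mom /= -/(mom F); congr (_ * (_ + _)).
apply: eq_conv_le => t ht; last exact: mom_recE.
by apply: eq_comp_le => // u hu; apply: mom_recE; exact: leq_trans ht.
Qed.

Lemma mom_uniq F m : boolean_moments m (comp F m) -> m =1 mom F.
Proof.
move=> [m0 mE] s; have [n] := ubnP (size s); elim: n s => // n IH [|b s] hs //.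
rewrite mE (mom_boolean F).2; congr (_ * (_ + _)).
have h t : (size t <= size s)%N -> m t = mom F t.
  by move=> ht; apply: IH; exact: leq_ltn_trans ht hs.
apply: eq_conv_le => t ht; last exact: h.
by apply: eq_comp_le => // u hu; apply: h; exact: leq_trans ht.
Qed.

Lemma mom_Ser F : Ser F -> Ser (mom F).
Proof.
move=> hF; apply/Ser_SerN; elim=> [|n IH]; first by move=> s t c x y.
by apply: (boolean_moments_SerN (mom_boolean F)) => //; exact: comp_SerN.
Qed.

(** ** Solving for the cumulants *)

Lemma comp_top F m s : (forall b, m [:: b] = b) ->
  comp F m s = F s + \sum_(c <- chunks s | (size c < size s)%N) F [seq m k | k <- c].
Proof.
move=> h; rewrite /comp sum_chunks_top -map_comp; congr (F _ + _).
by rewrite -[RHS]map_id; apply: eq_map.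
Qed.

Lemma comp_inj F G m : (forall b, m [:: b] = b) -> comp F m =1 comp G m -> F =1 G.
Proof.
move=> m1 h s; have [n] := ubnP (size s); elim: n s => // n IH s hs.
have := h s; rewrite !comp_top //.
rewrite (eq_bigr (fun c => G [seq m k | k <- c])) => [|c hc]; first by move/addIr.
by apply: IH; rewrite size_map; exact: leq_trans hc hs.
Qed.

Lemma conv_injl f g m : m [::] = 0 -> (forall b, m [:: b] = b) ->
  conv f m =1 conv g m -> f =1 g.
Proof.
move=> m0 m1 h s; have [n] := ubnP (size s); elim: n s => // n IH s hs.
have := h (s ++ [:: 1]).
rewrite /conv !sum_splits_mid !sum_splits_nil /= m0 !mulr0 !addr0.
rewrite sum_splits_last [RHS]sum_splits_last /= m1 !mulr1.
rewrite (eq_bigr (fun p => g p.1 * m (p.2 ++ [:: 1]))) => [|p hp]; first by move/addIr.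
by rewrite IH //; exact: leq_trans hp hs.
Qed.

Fixpoint cumulant_rec K m (n : nat) s : B :=
  if n isn't n'.+1 then 0 else
  K s - \sum_(c <- chunks s | (size c < size s)%N) cumulant_rec K m n' [seq m k | k <- c].

(** The chunking into single letters contributes [F s], and all the others involve [F] at
    shorter words only, which determines [F] recursively. *)
Lemma comp_solve K m : (forall b, m [:: b] = b) -> Ser K -> Ser m ->
  exists2 F, Ser F & comp F m =1 K.
Proof.
move=> m1 hK hm; pose F s := cumulant_rec K m (size s).+1 s.
have recE n s : (size s < n)%N -> cumulant_rec K m n s = F s.
  rewrite /F; have [k] := ubnP (size s); elim: k n s => // k IH [|n] // s hs hn.
  rewrite /=; congr (_ - _); apply: eq_bigr => c hc.
  have h1 : (size [seq m k | k <- c] < size s)%N by rewrite size_map.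
  by rewrite !IH // (leq_trans h1).
have FE s : F s = K s - \sum_(c <- chunks s | (size c < size s)%N) F [seq m k | k <- c].
  rewrite /F /=; congr (_ - _); apply: eq_bigr => c hc.
  by apply: recE; rewrite size_map.
pose trunc n c := if (size c < n)%N then F c else 0.
have FE' s : F s = K s - comp (trunc (size s)) m s.
  rewrite FE /comp [in RHS](bigID (fun c => size c < size s)%N) /=.
  rewrite [X in _ - (_ + X)]big1 ?addr0 => [|c /negPf h]; last by rewrite /trunc size_map h.
  by congr (_ - _); apply: eq_bigr => c h; rewrite /trunc size_map h.
exists F; last by move=> s; rewrite comp_top // {1}FE subrK.
apply/Ser_SerN; elim=> [|n IH]; first by move=> s t c x y.
move=> s t c x y; rewrite ltnS => hst; rewrite !FE' !size_cat /= !addnS.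
set N := (size s + size t)%N in hst *.
have hT : Ser (trunc N.+1).
  move=> s' t' c' x' y'; rewrite /trunc !size_cat /= addnS ltnS.
  case: ltnP => h; last by rewrite scaler0 addr0.
  by apply: IH; exact: leq_trans h hst.
rewrite hK (comp_Ser hT hm) scalerBr opprD addrACA //.
Qed.

(** ** Two-sided expansions of Boolean moments *)

(** Either the cut is visible in the interval partition, or it lies inside a
    unique block. *)
Lemma boolean_moments_cut m K l x y t : boolean_moments m K ->
  m (l ++ x * y :: t) = m (l ++ [:: x]) * m (y :: t) +
    \sum_(p <- splits l) \sum_(q <- splits t) m p.1 * K (p.2 ++ x * y :: q.1) * m q.2.
Proof.
move=> hm; have [m0 mE] := hm.
have [n] := ubnP (size l); elim: n l => // n IH [|a l] hl.
  rewrite /= sum_splits_nil (boolean_moments1 x hm) [in RHS]big1 ?addr0 => [|q _].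
    by rewrite !mE mulrA.
  by rewrite m0 !mul0r.
have d0 z u : delta (l ++ z :: u) = 0 by case: (l).
rewrite /= !mE !d0 !add0r {1 2}/conv !sum_splits_mid sum_splits_nil /= m0 mulr0 addr0.
rewrite sum_splits_cons /= m0 [X in _ = _ + (X + _)]big1 ?add0r => [|q _]; last by rewrite !mul0r.
have -> : \sum_(p <- splits l) K p.1 * m (p.2 ++ x * y :: t) =
  \sum_(p <- splits l) (K p.1 * m (p.2 ++ [:: x]) * m (y :: t)) +
  \sum_(p <- splits l) \sum_(r <- splits p.2) \sum_(q <- splits t)
     K p.1 * (m r.1 * K (r.2 ++ x * y :: q.1) * m q.2).
  rewrite -big_split; apply: eq_big_seq => p hp.
  rewrite (IH _ (splits_sizer hp hl)) mulrDr mulrA; congr (_ + _).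
  by rewrite mulr_sumr; apply: eq_bigr => r _; rewrite mulr_sumr.
rewrite -mulr_suml -addrA mulrDr mulrA mE; congr (_ + _).
rewrite -(sum_splits_assoc l (fun u v w => \sum_(q <- splits t)
     K u * (m v * K (w ++ x * y :: q.1) * m q.2))).
have -> : \sum_(q <- splits t) K (l ++ x * y :: q.1) * m q.2 =
  \sum_(p <- splits l) \sum_(q <- splits t) delta p.1 * (K (p.2 ++ x * y :: q.1) * m q.2).
  have := conv_delta (fun u => \sum_(q <- splits t) K (u ++ x * y :: q.1) * m q.2) l.
  by rewrite /conv => <-; apply: eq_bigr => p _; rewrite mulr_sumr.
rewrite addrC -big_split mulr_sumr; apply: eq_bigr => p _ /=.
rewrite exchange_big -big_split mulr_sumr; apply: eq_bigr => q _ /=.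
rewrite mE -!mulrA; congr (_ * _).
rewrite mulrDl /conv mulr_suml; congr (_ + _).
by apply: eq_bigr => r _; rewrite !mulrA.
Qed.

(** The recursion read from the last block of an interval partition. *)
Lemma boolean_moments_last m K s b : boolean_moments m K ->
  m (s ++ [:: b]) = (delta s + conv m K s) * b.
Proof.
move=> hm; have [m0 mE] := hm.
have [n] := ubnP (size s); elim: n s => // n IH [|a s] hs.
  by rewrite (boolean_moments1 b hm) /conv sum_splits_nil m0 mul0r addr0 mul1r.
have d0 z u : delta (s ++ z :: u) = 0 by case: (s).
rewrite /= mE d0 add0r {1}/conv sum_splits_mid sum_splits_nil /= m0 mulr0 addr0.
rewrite add0r.
have -> : \sum_(p <- splits s) K p.1 * m (p.2 ++ [:: b]) =
    conv K (fun t => delta t + conv m K t) s * b.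
  rewrite mulr_suml; apply: eq_big_seq => p hp.
  by rewrite (IH _ (splits_sizer hp hs)) mulrA.
have -> : conv m K (a :: s) = a * conv (fun t => delta t + conv K m t) K s.
  rewrite conv_cons m0 mul0r add0r mulr_sumr; apply: eq_bigr => p _.
  by rewrite /= mE mulrA.
by rewrite convDr convDl conv_deltar conv_delta convA mulrA.
Qed.

(** ** Adjoints *)

Definition srev s := rev [seq star b | b <- s].

Lemma srev_cons b s : srev (b :: s) = srev s ++ [:: star b].
Proof. by rewrite /srev /= rev_cons cats1. Qed.

Lemma srev_cat s t : srev (s ++ t) = srev t ++ srev s.
Proof. by rewrite /srev map_cat rev_cat. Qed.

Lemma srevK s : srev (srev s) = s.
Proof.
rewrite /srev map_rev revK -map_comp -[RHS]map_id; apply: eq_map => b /=.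
exact: starK.
Qed.

Lemma sum_splits_srev (V : zmodType) s (G : seq B * seq B -> V) :
  \sum_(p <- splits (srev s)) G p = \sum_(p <- splits s) G (srev p.2, srev p.1).
Proof. by rewrite sum_splits_rev sum_splits_map. Qed.

Lemma comp_star n f m : (forall s, f (srev s) = star (f s)) ->
  (forall s, (size s <= n)%N -> m (srev s) = star (m s)) ->
  forall s, (size s <= n)%N -> comp f m (srev s) = star (comp f m s).
Proof.
move=> hf hm s hs; rewrite /comp sum_chunks_rev sum_chunks_map star_sum.
apply: eq_big_seq => c hc; rewrite -hf; congr (f _).
rewrite /srev map_rev -!map_comp; congr rev; apply/eq_in_map => u hu /=.
by rewrite -/(srev u) hm // (leq_trans (chunk_size hc hu)).
Qed.

Lemma boolean_moments_star m K : boolean_moments m K ->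
  (forall n, (forall s, (size s <= n)%N -> m (srev s) = star (m s)) ->
     forall s, (size s <= n)%N -> K (srev s) = star (K s)) ->
  forall s, m (srev s) = star (m s).
Proof.
move=> hm hK s; have [m0 mE] := hm.
have [n] := ubnP (size s); elim: n s => // n IH [|b s] hs.
  by rewrite m0 star0.
rewrite srev_cons (boolean_moments_last _ _ hm) mE starM starD; congr ((_ + _) * _).
  by rewrite /srev; case: (s) => [|c u] /=; rewrite ?star1 ?star0 // rev_cons; case: rev.
rewrite /conv sum_splits_srev star_sum; apply: eq_big_seq => p hp /=.
rewrite starM (IH _ (splits_sizer hp hs)); congr (_ * _).
apply: (hK (size s)) => [u hu|]; first by apply: IH; exact: leq_ltn_trans hu hs.
by rewrite -ltnS (splits_sizel hp).
Qed.

(** ** Adding a completely positive part to the identity *)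

(** In terms of the convolution inverse of [m], which is [I^-1 - K] when [I] is the
    identity on words of length 1, the claim reads
    [(I^-1 - beta Q) - Q = I^-1 - (Q + beta Q)]. *)
Lemma boolean_moments_comp (beta : B -> B) mm K mt Q :
  boolean_moments mm K -> Q =1 comp K mt -> boolean_moments mt (beta \o Q) ->
  boolean_moments (comp mm mt) (fun s => Q s + beta (Q s)).
Proof.
move=> [mm0 mmE] hQ [mt0 mtE]; split=> [|b s]; first by rewrite comp_nil.
pose m' := comp mm mt; rewrite -/m'; pose Z s := delta s + conv Q m' s.
have e1 t : m' t = conv mt Z t.
  case: t => [|a t]; first by rewrite /m' comp_nil mm0 /conv sum_splits_nil mt0 mul0r.
  rewrite conv_cons mt0 mul0r add0r /m' comp_cons; apply: eq_bigr => p _ /=.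
  have -> : comp (mm \o cons (mt (a :: p.1))) mt p.2 =
     comp (fun c => mt (a :: p.1) * (delta c + conv K mm c)) mt p.2.
    by apply: eq_comp => // c; rewrite /= mmE.
  rewrite {1}/comp -mulr_sumr big_split -/(comp delta mt p.2) -/(comp (conv K mm) mt p.2).
  rewrite comp_delta comp_conv /Z; congr (_ * (_ + _)).
  by apply: eq_conv => // t'; rewrite hQ.
rewrite e1 conv_cons mt0 mul0r add0r.
have -> : conv (mt \o cons b) Z s =
    b * conv (fun t => delta t + conv (beta \o Q) mt t) Z s.
  by rewrite mulr_sumr; apply: eq_bigr => p _; rewrite /= mtE mulrA.
rewrite convDl conv_delta convA convDl /Z -addrA; congr (_ * (_ + (_ + _))).
by apply: eq_conv => // t; rewrite -e1.
Qed.

End SeriesCalculus.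

(** * Non-crossing partitions as bracket words *)

(* A letter (x, y) tells whether the block of a point has an earlier element
   and whether it has a later one, so that (false, true) opens a block,
   (true, true) continues it and (true, false) closes it. *)
Section BracketWords.
Implicit Types (w : nat -> bool * bool) (i j k l N : nat).

Definition push i (k : bool * bool) (st : seq nat) : seq nat :=
  match k with
  | (false, true) => i :: st
  | (true, false) => behead st
  | _ => st
  end.

(** the first points of the blocks that are open just before [i], innermost first *)
Fixpoint opened w i : seq nat :=
  if i is j.+1 then push j (w j) (opened w j) else [::].

(** the first point of the block of [i] *)
Definition opener w i : nat := if (w i).1 then head i (opened w i) else i.

Definition bracketed w N : Prop :=
  (forall i, (i < N)%N -> (w i).1 -> opened w i != [::]) /\ opened w N = [::].

Lemma opened_lt w i j : j \in opened w i -> (j < i)%N.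
Proof.
elim: i j => // i IH j /=; rewrite /push; case: (w i) => [[] []].
- by move/IH/ltnW.
- by move=> /mem_behead/IH/ltnW.
- by rewrite inE => /orP[/eqP ->//|/IH/ltnW].
- by move/IH/ltnW.
Qed.

Lemma opened_sorted w i : sorted gtn (opened w i).
Proof.
elim: i => //= i IH; rewrite /push; case: (w i) => [[] []] //.
  by case: (opened w i) IH => //= a s /path_sorted.
have := @opened_lt w i; case: (opened w i) IH => //= a s -> /(_ a).
by rewrite mem_head andbT; apply.
Qed.

Lemma opened_head w i j d : j \in opened w i -> (j <= head d (opened w i))%N.
Proof.
have := opened_sorted w i; case: (opened w i) => //= a s.
rewrite (path_sortedE (rev_trans ltn_trans)) => /andP[/allP h _].
by rewrite inE => /orP[/eqP ->//|/h/ltnW].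
Qed.

Lemma opened_behead w i j d : j \in behead (opened w i) ->
  j \in opened w i /\ j != head d (opened w i).
Proof.
have := opened_sorted w i; case: (opened w i) => //= a s.
rewrite (path_sortedE (rev_trans ltn_trans)) => /andP[/allP h _] hj.
split; first by rewrite inE hj orbT.
by rewrite neq_ltn (h _ hj).
Qed.

Lemma mem_behead_opened w i j d : j \in opened w i -> j != head d (opened w i) ->
  j \in behead (opened w i).
Proof. by case: (opened w i) => //= a s; rewrite inE => /orP[/eqP ->|//]; rewrite eqxx. Qed.

Lemma opened_mono w i j k : (j < i)%N -> (i <= k)%N -> j \in opened w k -> j \in opened w i.
Proof.
move=> ji /subnK <-; elim: (k - i)%N => [|n IH] //; rewrite addSn /= => h.
apply: IH; move: h; rewrite /push; case: (w _) => [[] []] //.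
  exact: mem_behead.
by rewrite inE => /orP[/eqP e|//]; move: ji; rewrite e ltnNge leq_addl.
Qed.

Lemma opened_opening w i j : j \in opened w i -> w j = (false, true).
Proof.
elim: i => // i IH /=; rewrite /push; case e : (w i) => [[] []] //.
  by move=> /mem_behead.
by rewrite inE => /orP[/eqP ->|].
Qed.

Section FromWord.
Variables (w : nat -> bool * bool) (N : nat).
Hypothesis wN : bracketed w N.

Lemma opener_opened i : (i < N)%N -> (w i).1 -> opener w i \in opened w i.
Proof.
move=> hi h; rewrite /opener h; case: wN => /(_ i hi h) + _.
by case: (opened w i) => //= a s _; exact: mem_head.
Qed.

Lemma opener_le i : (i < N)%N -> (opener w i <= i)%N.
Proof.
move=> hi; case h : (w i).1; last by rewrite /opener h.
exact/ltnW/opened_lt/opener_opened.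
Qed.

Lemma opener_id j i : j \in opened w i -> opener w j = j.
Proof. by move=> /opened_opening h; rewrite /opener h. Qed.

Lemma opened_closed i j : (i <= N)%N -> j \in opened w i ->
  exists2 k, (i <= k < N)%N & opener w k = j.
Proof.
move=> hi; have [n] := ubnP (N - i)%N; elim: n i hi => // n IH i hi hn hj.
have iN : (i < N)%N.
  by rewrite ltn_neqAle hi andbT; apply: contraTneq hj => ->; rewrite wN.2.
case h : (j \in opened w i.+1).
  have [|k /andP[hk kN] e] := IH i.+1 iN _ h; first by lia.
  by exists k; rewrite // kN ltnW.
exists i; rewrite ?leqnn //; move: h; rewrite /= /push /opener.
case: (w i) => [[] []] /=; rewrite ?hj // ?inE ?hj ?orbT //.
by move=> /negbT; apply: contraNeq => e; apply: (mem_behead_opened (d := i)) => //; rewrite eq_sym.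
Qed.

Lemma opener_before i : (i < N)%N ->
  has (fun j => opener w i == opener w j) (iota 0 i) = (w i).1.
Proof.
move=> hi; case h : (w i).1; last first.
  apply/negbTE/hasPn => j; rewrite mem_iota => /= ji.
  have jN := ltn_trans ji hi; have := opener_le jN.
  rewrite {2}/opener h => hj; rewrite neq_ltn; apply/orP; right.
  exact: leq_ltn_trans hj ji.
have o := opener_opened hi h; apply/hasP; exists (opener w i).
  by rewrite mem_iota /= (opened_lt o).
by rewrite (opener_id o).
Qed.

Lemma opener_after i : (i < N)%N ->
  has (fun j => opener w i == opener w j) (iota i.+1 (N - i.+1)) = (w i).2.
Proof.
move=> hi; case h : (w i).2.
  have o : opener w i \in opened w i.+1.
    have := @opener_opened i hi; rewrite /= /push /opener; case: (w i) h => [[] []] //= _.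
      by apply.
    by rewrite mem_head.
  have [k /andP[hk kN] e] := opened_closed hi o.
  apply/hasP; exists k; last by rewrite e.
  by rewrite mem_iota hk /= subnKC.
apply/negbTE/hasPn => j; rewrite mem_iota subnKC // => /andP[ij jN].
apply/eqP => e.
have wj : (w j).1.
  apply: contraLR (opener_le hi) => /negbTE hj; rewrite e /opener hj -ltnNge.
  exact: ij.
have := opener_opened jN wj; rewrite -e => o.
have o1 : opener w i \in opened w i.+1.
  by apply: (opened_mono _ ij) o; rewrite ltnS opener_le.
have := o1; rewrite /= /push; case e1 : (w i) h => [[] []] //= _.
  move=> /(@opened_behead _ _ _ i) [_]; rewrite /opener e1 /= eqxx //.
by rewrite /opener e1 /= => /opened_lt; rewrite ltnn.
Qed.

Lemma opener_noncrossing i j k l : (i < j)%N -> (j < k)%N -> (k < l)%N -> (l < N)%N ->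
  opener w i = opener w k -> opener w j = opener w l -> opener w i = opener w j.
Proof.
move=> ij jk kl lN eik ejl.
have kN := ltn_trans kl lN; have jN := ltn_trans jk kN; have iN := ltn_trans ij jN.
have hi := opener_le iN; have hj := opener_le jN.
have wk : (w k).1.
  by apply: contraLR hi => /negbTE h; rewrite eik /opener h -ltnNge (ltn_trans ij).
have wl : (w l).1.
  by apply: contraLR hj => /negbTE h; rewrite ejl /opener h -ltnNge (ltn_trans jk).
have pk := opener_opened kN wk; have ql := opener_opened lN wl.
rewrite -eik in pk; rewrite -ejl in ql.
have qk : opener w j \in opened w k.
  by apply: opened_mono ql; [exact: leq_ltn_trans hj jk | exact: ltnW].
have pj : opener w i \in opened w j.
  by apply: opened_mono pk; [exact: leq_ltn_trans hi ij | exact: ltnW].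
apply/eqP; rewrite eqn_leq; apply/andP; split.
  rewrite {2}/opener; case: (w j).1; first exact: opened_head.
  by apply: leq_trans hi _; exact: ltnW.
by rewrite eik {2}/opener wk; exact: opened_head.
Qed.

End FromWord.

Section FromPartition.
Variables (E : rel nat) (N : nat) (w : nat -> bool * bool).
Hypothesis Er : forall i, (i < N)%N -> E i i.
Hypothesis Es : forall i j, (i < N)%N -> (j < N)%N -> E i j -> E j i.
Hypothesis Et : forall i j k, (i < N)%N -> (j < N)%N -> (k < N)%N -> E i j -> E j k -> E i k.
Hypothesis Enc : forall i j k l, (i < j)%N -> (j < k)%N -> (k < l)%N -> (l < N)%N ->
  E i k -> E j l -> E i j.
Hypothesis wE : forall i, (i < N)%N ->
  w i = (has (E i) (iota 0 i), has (E i) (iota i.+1 (N - i.+1))).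

Let w1P i : (i < N)%N -> reflect (exists2 j, (j < i)%N & E i j) (w i).1.
Proof.
move=> hi; rewrite wE //; apply: (iffP hasP) => -[j]; rewrite ?mem_iota /= => h e; exists j => //.
by rewrite mem_iota.
Qed.

Let w2P i : (i < N)%N -> reflect (exists2 j, (i < j < N)%N & E i j) (w i).2.
Proof.
move=> hi; rewrite wE //; apply: (iffP hasP) => -[j]; rewrite ?mem_iota /= ?subnKC // => h e; exists j => //.
by rewrite mem_iota subnKC.
Qed.

(* the invariant of the recursion that defines the stack *)
Let spec i := forall j, (j < i)%N ->
  reflect (~~ (w j).1 /\ exists2 l, (i <= l < N)%N & E j l) (j \in opened w i).

Let opener_spec i : (i < N)%N -> spec i ->
  [/\ E i (opener w i), ~~ (w (opener w i)).1, (opener w i <= i)%N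
    & (w i).1 -> opened w i != [::]].
Proof.
move=> hi sp; rewrite /opener; case h : (w i).1; last first.
  by split=> //; [exact: Er | rewrite h].
have [m [mi Em wm]] : exists m, [/\ (m < i)%N, E i m & ~~ (w m).1].
  have ex : exists m, (m < i)%N && E i m.
    by case/(w1P hi): h => j ji e; exists j; rewrite ji.
  case: (ex_minnP ex) => m /andP[mi Em] hm; exists m; split=> //.
  have mN := ltn_trans mi hi.
  apply/negP => /(w1P mN)[j jm e]; have jN := ltn_trans jm mN.
  have := hm j; rewrite (ltn_trans jm mi) (Et hi mN jN Em e) => /(_ isT).
  by rewrite leqNgt jm.
have mN := ltn_trans mi hi.
have mo : m \in opened w i.
  by apply/(sp m mi); split=> //; exists i; rewrite ?leqnn // Es.
set p := head i _; have mp : (m <= p)%N by exact: opened_head.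
have po : p \in opened w i.
  by rewrite /p; case: (opened w i) mo => //= a s _; exact: mem_head.
have pi := opened_lt po; have pN := ltn_trans pi hi.
have [wp [l /andP[il lN] El]] := sp p pi po.
suff <- : m = p.
  by split=> //; [exact: ltnW | move=> _; case: (opened w i) mo].
apply/eqP; rewrite eqn_leq mp leqNgt; apply/negP => mp'.
have Emp : E m p.
  have [e|ne] := eqVneq l i.
    by apply: (Et mN hi pN); [exact: Es | rewrite Es // -e].
  have il' : (i < l)%N by rewrite ltn_neqAle eq_sym ne.
  by apply: (Enc mp' pi il' lN) => //; exact: Es.
by case/negP: wp; apply/(w1P pN); exists m => //; exact: Es.
Qed.

Let specP i : (i <= N)%N -> spec i.
Proof.
elim: i => [|i IH] hi //; have sp := IH (ltnW hi).
have [Eo wo oi on] := opener_spec hi sp.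
move=> j ji.
have [e|ne] := eqVneq j i.
  rewrite e; have hno : i \notin opened w i by apply/negP => /opened_lt; rewrite ltnn.
  have hnb : i \notin behead (opened w i) by apply: contra hno; exact: mem_behead.
  rewrite /= /push; apply: (iffP idP) => [|[w1 [l /andP[il lN] El]]].
    case ew : (w i) => [[] []]; rewrite ?(negPf hno) ?(negPf hnb) // inE eqxx /= => _.
    split=> //; have /(w2P hi)[l /andP[il lN] El] : (w i).2 by rewrite ew.
    by exists l; rewrite // il lN.
  have w2 : (w i).2 by apply/(w2P hi); exists l; rewrite // il lN.
  by move: w1 w2; case: (w i) => [[] []] //= _ _; exact: mem_head.
have ji' : (j < i)%N by move: ji; rewrite ltnS leq_eqVlt (negPf ne).
have jN := ltn_trans ji' hi.
have same : (~~ (w j).1 /\ exists2 l, (i.+1 <= l < N)%N & E j l) -> j \in opened w i.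
  move=> [w1 [l /andP[il lN] El]]; apply/(sp j ji'); split=> //.
  by exists l => //; rewrite lN ltnW.
have conv : j \in opened w i -> (E j i -> exists2 l, (i.+1 <= l < N)%N & E j l) ->
    (~~ (w j).1 /\ exists2 l, (i.+1 <= l < N)%N & E j l).
  move=> /(sp j ji')[w1 [l /andP[il lN] El]] h; split=> //.
  have [e|nl] := eqVneq l i; first by apply: h; rewrite -e.
  by exists l => //; rewrite lN andbT ltn_neqAle eq_sym nl.
rewrite /= /push; case ew : (w i) => [[] []].
- apply: (iffP idP) => [h|]; last exact: same.
  apply: conv => // e; have /(w2P hi)[l /andP[il lN] El] : (w i).2 by rewrite ew.
  by exists l; rewrite ?il ?lN //; exact: Et El.
- have hd : opener w i = head i (opened w i) by rewrite /opener ew.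
  apply: (iffP idP) => [/(@opened_behead _ _ _ i)[h jo]|h].
    apply: conv => // e; case/negP: (sp j ji' h).1.
    have oN : (opener w i < N)%N by exact: leq_ltn_trans hi.
    have Ejo : E j (opener w i) by apply: (Et jN hi oN).
    have [lt|ge] := ltnP (opener w i) j; first by apply/(w1P jN); exists (opener w i).
    move: ge; rewrite leq_eqVlt; move: jo; rewrite -hd => /negPf -> /= lt.
    by case/negP: wo; apply/(w1P oN); exists j => //; exact: Es.
  apply: (mem_behead_opened (d := i)); first exact: same.
  apply/eqP; rewrite -hd => e; case: h => _ [l /andP[il lN] El].
  have : (w i).2 by apply/(w2P hi); exists l; rewrite ?il ?lN //; apply: (Et hi jN lN) => //; rewrite e.
  by rewrite ew.
- rewrite inE (negPf ne) /=; apply: (iffP idP) => [h|]; last exact: same.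
  apply: conv => // e; have : (w i).1 by apply/(w1P hi); exists j => //; exact: Es.
  by rewrite ew.
- apply: (iffP idP) => [h|]; last exact: same.
  apply: conv => // e; have : (w i).1 by apply/(w1P hi); exists j => //; exact: Es.
  by rewrite ew.
Qed.

Lemma bracketed_of_partition : bracketed w N.
Proof.
split=> [i hi|]; first by case: (opener_spec hi (specP (ltnW hi))).
case e : (opened w N) => [|j s] //.
have jo : j \in opened w N by rewrite e mem_head.
have [_ [l]] := specP (leqnn N) (opened_lt jo) jo.
by case/andP => h1 h2; move: (leq_ltn_trans h1 h2); rewrite ltnn.
Qed.

Lemma opener_eqE i j : (i < N)%N -> (j < N)%N -> (opener w i == opener w j) = E i j.
Proof.
move=> hi hj.
have [Ei wi oi _] := opener_spec hi (specP (ltnW hi)).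
have [Ej wj oj _] := opener_spec hj (specP (ltnW hj)).
have oiN := leq_ltn_trans oi hi; have ojN := leq_ltn_trans oj hj.
apply/eqP/idP => [e|e].
  by apply: (Et hi oiN hj) => //; rewrite e; exact: Es.
have Eo : E (opener w i) (opener w j).
  by apply: (Et oiN hi ojN); [exact: Es | exact: Et Ej].
apply/eqP; rewrite eqn_leq; apply/andP; split; rewrite leqNgt; apply/negP => lt.
  by case/negP: wi; apply/(w1P oiN); exists (opener w j).
by case/negP: wj; apply/(w1P ojN); exists (opener w i) => //; exact: Es.
Qed.

End FromPartition.
End BracketWords.

Section PartitionWords.
Variable n : nat.
Let N := n.+1.
Implicit Types (pi : {set {set 'I_n.+1}}) (w : N.-tuple (bool * bool)) (i j : 'I_n.+1).

Definition letter pi i : bool * bool :=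
  ([exists j in pblock pi i, (j < i)%N], [exists j in pblock pi i, (i < j)%N]).

Definition word_of pi : N.-tuple (bool * bool) := [tuple letter pi i | i < N].

Definition partition_of w : {set {set 'I_n.+1}} :=
  preim_partition (fun i : 'I_n.+1 => opener (nth (false, false) w) i) [set: 'I_n.+1].

Let rel_of pi k l := (inord l : 'I_n.+1) \in pblock pi (inord k : 'I_n.+1).

Let letterE pi i :
  letter pi i = (has (rel_of pi i) (iota 0 i), has (rel_of pi i) (iota i.+1 (N - i.+1))).
Proof.
congr (_, _).
  apply/existsP/hasP => [[j /andP[hj lt]]|[k]]; last first.
    rewrite mem_iota /= /rel_of inord_val => lt hk; exists (inord k).
    by rewrite hk inordK // (ltn_trans lt) // ltn_ord.
  by exists (val j); rewrite ?mem_iota // /rel_of !inord_val.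
apply/existsP/hasP => [[j /andP[hj lt]]|[k]]; last first.
  rewrite mem_iota subnKC // /rel_of inord_val => /andP[lt kN] hk; exists (inord k).
  by rewrite hk inordK.
by exists (val j); rewrite ?mem_iota ?subnKC ?lt ?ltn_ord // /rel_of !inord_val.
Qed.

Let nth_word pi k : (k < N)%N -> nth (false, false) (word_of pi) k =
  (has (rel_of pi k) (iota 0 k), has (rel_of pi k) (iota k.+1 (N - k.+1))).
Proof.
move=> hk; rewrite -[k]/(val (Ordinal hk)) -letterE.
by rewrite -tnth_nth tnth_mktuple.
Qed.

Let mem_pblock_of w i j : (j \in pblock (partition_of w) i) =
  (opener (nth (false, false) w) i == opener (nth (false, false) w) j).
Proof.
by rewrite /partition_of /preim_partition pblock_equivalence_partition ?inE //; split=> // /eqP ->.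
Qed.

Let word_ofK w : bracketed (nth (false, false) w) N -> word_of (partition_of w) = w.
Proof.
move=> h; apply: eq_from_tnth => i; rewrite tnth_mktuple letterE (tnth_nth (false, false)).
have e k : (k < N)%N -> rel_of (partition_of w) i k =
    (opener (nth (false, false) w) i == opener (nth (false, false) w) k).
  by move=> hk; rewrite /rel_of mem_pblock_of !inordK.
rewrite [RHS]surjective_pairing -(opener_before h (ltn_ord i)) -(opener_after h (ltn_ord i)).
congr (_, _); apply: eq_in_has => k; rewrite mem_iota.
  by move=> /= hk; rewrite e // (ltn_trans hk) // ltn_ord.
by rewrite subnKC // => /andP[_]; exact: e.
Qed.

Let partition_of_NC w : bracketed (nth (false, false) w) N -> partition_of w \in NC n.+1.
Proof.
move=> h; rewrite inE /noncrossing preim_partitionP /=.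
have [_ tiP _] := and3P (preim_partitionP (fun i : 'I_n.+1 => opener (nth (false, false) w) i) [set: 'I_n.+1]).
apply/forall_inP => V hV; apply/forall_inP => W hW.
apply/forallP => i; apply/forallP => j; apply/forallP => k; apply/forallP => l.
apply/implyP => /and5P[ij jk kl iV /and3P[kV jW lW]].
have eV := def_pblock tiP hV iV; have eW := def_pblock tiP hW jW.
have e1 : opener (nth (false, false) w) i = opener (nth (false, false) w) k.
  by apply/eqP; rewrite -mem_pblock_of eV.
have e2 : opener (nth (false, false) w) j = opener (nth (false, false) w) l.
  by apply/eqP; rewrite -mem_pblock_of eW.
have := opener_noncrossing h ij jk kl (ltn_ord l) e1 e2.
move=> /eqP; rewrite -mem_pblock_of eV => jV.
by rewrite -eW -(def_pblock tiP hV jV).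
Qed.

Section NCpi.
Variable pi : {set {set 'I_n.+1}}.
Hypothesis piNC : pi \in NC n.+1.

Let piP : partition pi [set: 'I_n.+1].
Proof. by move: piNC; rewrite inE => /andP[]. Qed.

Let cov i : i \in cover pi. Proof. by rewrite (cover_partition piP) inE. Qed.
Let tiP : trivIset pi. Proof. by case/and3P: piP. Qed.

Let same_sym i j : j \in pblock pi i -> i \in pblock pi j.
Proof.
by move=> h; rewrite (same_pblock tiP h) mem_pblock.
Qed.

Let relP : [/\ bracketed (nth (false, false) (word_of pi)) N
   & forall k l, (k < N)%N -> (l < N)%N ->
      (opener (nth (false, false) (word_of pi)) k == opener (nth (false, false) (word_of pi)) l)
      = rel_of pi k l].
Proof.
have Er k : (k < N)%N -> rel_of pi k k by move=> _; rewrite /rel_of mem_pblock.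
have Es k l : (k < N)%N -> (l < N)%N -> rel_of pi k l -> rel_of pi l k.
  by move=> _ _; exact: same_sym.
have Et (j k l : nat) : (j < N)%N -> (k < N)%N -> (l < N)%N -> rel_of pi j k -> rel_of pi k l -> rel_of pi j l.
  by rewrite /rel_of => _ _ _ h1; rewrite (same_pblock tiP h1).
have Enc (i j k l : nat) : (i < j)%N -> (j < k)%N -> (k < l)%N -> (l < N)%N ->
    rel_of pi i k -> rel_of pi j l -> rel_of pi i j.
  move=> ij jk kl lN h1 h2; have kN := ltn_trans kl lN; have jN := ltn_trans jk kN.
  have iN := ltn_trans ij jN.
  have := piNC; rewrite inE => /andP[_ /forall_inP/(_ (pblock pi (inord i)))].
  rewrite pblock_mem // => /(_ isT)/forall_inP/(_ (pblock pi (inord j))).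
  rewrite pblock_mem // => /(_ isT)/forallP/(_ (inord i))/forallP/(_ (inord j)).
  move=> /forallP/(_ (inord k))/forallP/(_ (inord l))/implyP.
  rewrite !inordK // ij jk kl !mem_pblock !cov; move: h1 h2; rewrite /rel_of => -> -> /(_ isT)/eqP e.
  by rewrite e mem_pblock.
split; first exact: (bracketed_of_partition Er Es Et Enc (nth_word pi)).
exact: (opener_eqE Er Es Et Enc (nth_word pi)).
Qed.

Let partition_ofK : partition_of (word_of pi) = pi.
Proof.
rewrite -[RHS](equivalence_partition_pblock piP); apply: eq_in_imset => i _.
apply/setP => j; rewrite !inE /=; have [_ ->] := relP; rewrite ?ltn_ord //.
by rewrite /rel_of !inord_val.
Qed.

Lemma NC_word_of : partition_of (word_of pi) = pi /\ bracketed (nth (false, false) (word_of pi)) N.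
Proof. by split; [exact: partition_ofK | case: relP]. Qed.

End NCpi.

(** A non-crossing partition can be recovered from its letters: the block that a
    letter continues or closes is the one opened last among those still open. *)
Lemma sum_NC (V : zmodType) (G : N.-tuple (bool * bool) -> V) :
  \sum_(pi in NC n.+1) G (word_of pi) =
  \sum_(w : n.+1.-tuple (bool * bool) | `[< bracketed (nth (false, false) w) n.+1 >]) G w.
Proof.
rewrite (reindex_onto partition_of word_of) => [|pi hpi]; last by case: (NC_word_of hpi).
apply: eq_big => [w|w /andP[_ /eqP ->]] //.
apply/andP/asboolP => [[h /eqP e]|h]; first by rewrite -e; case: (NC_word_of h).
by rewrite partition_of_NC // word_ofK.
Qed.

End PartitionWords.

(** * Moments as sums over non-crossing partitions *)

Section Reading.
Variables (R : realType) (B : cstarAlgType R).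
Variable F : seq B -> B.
Hypothesis hF : Ser F.
Implicit Types (s : seq B) (b cur : B) (stk : seq (B * seq B)) (st : B * seq (B * seq B)).

Let m := mom F.
Let m0 : m [::] = 0 := proj1 (mom_boolean F).
Let mE : forall b s, m (b :: s) = b * (delta s + conv (comp F m) m s) := proj2 (mom_boolean F).

Lemma mom_mull x y s : mom F (x * y :: s) = x * mom F (y :: s).
Proof. by rewrite -/m !mE mulrA. Qed.

Definition token_of (k : bool * bool) : token B :=
  match k with
  | (false, false) => Single B
  | (false, true) => Open B
  | (true, true) => Comma B
  | (true, false) => Close B
  end.

Definition read2 st (k : bool * bool) b := read F (read F st (token_of k)) (Coef b).

(** The sum of the results of all the balanced ways to continue reading from the
    state [st], where [s] lists the coefficients to come. *)
Fixpoint total st s : B :=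
  if s isn't b :: s' then if st.2 is [::] then st.1 else 0 else
  total (read2 st (false, false) b) s' + total (read2 st (false, true) b) s' +
  (if st.2 is [::] then 0 else
   total (read2 st (true, true) b) s' + total (read2 st (true, false) b) s').

Fixpoint balanced_from (d : nat) (w : seq (bool * bool)) : bool :=
  if w isn't (x, y) :: w' then d == 0%N else
  if x then (0 < d)%N && balanced_from (if y then d else d.-1) w'
  else balanced_from (if y then d.+1 else d) w'.

Definition run st (w : seq (bool * bool)) s :=
  foldl (fun st p => read2 st p.1 p.2) st (zip w s).

Lemma big_tuple_cons (T : finType) n (P : pred (seq T)) (G : seq T -> B) :
  \sum_(w : n.+1.-tuple T | P w) G w = \sum_(x : T) \sum_(w : n.-tuple T | P (x :: w)) G (x :: w).
Proof.
rewrite pair_big_dep /= (reindex (fun p : T * n.-tuple T => [tuple of p.1 :: p.2])) //=.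
exists (fun w : n.+1.-tuple T => (thead w, [tuple of behead w])) => [[x w]|w] _ /=.
  by rewrite theadE; congr (_, _); apply: val_inj.
by rewrite [RHS]tuple_eta; apply: val_inj.
Qed.

Lemma total_words st s : total st s =
  \sum_(w : (size s).-tuple (bool * bool) | balanced_from (size st.2) w) (run st w s).1.
Proof.
elim: s st => [|b s IH] st.
  transitivity (\sum_(w : 0.-tuple (bool * bool) | size st.2 == 0%N) st.1).
    rewrite /=; case: st.2 => [|p l] /=; last by rewrite big_pred0.
    rewrite (big_pred1 [tuple]) // => w.
    by change (true = pred1 [tuple] w); apply/esym/eqP; exact: tuple0.
  by apply: eq_big => w; rewrite (tuple0 w).
rewrite /= (big_tuple_cons _ (balanced_from (size st.2)) (fun w => (run st w (b :: s)).1)).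
transitivity (\sum_(x : bool) \sum_(y : bool) \sum_(w : (size s).-tuple (bool * bool) |
   balanced_from (size st.2) ((x, y) :: w)) (run st ((x, y) :: w) (b :: s)).1); last first.
  by rewrite pair_bigA; apply: eq_bigr => -[x y].
rewrite !big_bool /= [RHS]addrC; congr (_ + _).
  by rewrite addrC !IH; congr (_ + _); case: st.
case: st => cur [|[o args] l] /=; first by rewrite !big_pred0_eq addr0.
by rewrite !IH.
Qed.

Lemma bracketed_balanced (w : seq (bool * bool)) :
  `[< bracketed (nth (false, false) w) (size w) >] = balanced_from 0 w.
Proof.
set x0 := (false, false).
have gen v i : drop i w = v -> (i <= size w)%N ->
   ((forall j, (i <= j < size w)%N -> (nth x0 w j).1 -> opened (nth x0 w) j != [::]) /\
    opened (nth x0 w) (size w) = [::]) <-> balanced_from (size (opened (nth x0 w) i)) v.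
  elim: v i => [|[x y] v IH] i hd hi.
    have e : i = size w.
      by apply/eqP; rewrite eqn_leq hi -subn_eq0 -size_drop hd.
    rewrite e /=; split=> [[_ ->]//|/nilP h]; split=> // j.
    by case/andP => h1 h2; move: (leq_ltn_trans h1 h2); rewrite ltnn.
  have iN : (i < size w)%N by rewrite ltnNge -subn_eq0 -size_drop hd.
  have wi : nth x0 w i = (x, y) by have := nth_drop i x0 w 0; rewrite hd addn0 => <-.
  have hd' : drop i.+1 w = v by rewrite -add1n -drop_drop hd /= drop0.
  have {IH} := IH i.+1 hd' iN; rewrite /= wi.
  set A := _ /\ _; set A' := _ /\ _ => IH.
  have AA' : A' <-> (x -> opened (nth x0 w) i != [::]) /\ A.
    split=> [[h1 h2]|[h1 [h2 h3]]].
      split=> [hx|]; first by apply: h1; rewrite ?leqnn // wi.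
      by split=> // j /andP[ij jN]; apply: h1; rewrite jN ltnW.
    split=> // j /andP[]; rewrite leq_eqVlt => /orP[/eqP <- _|ij jN].
      by rewrite wi.
    by apply: h2; rewrite ij.
  rewrite AA' IH; case: x {wi hd AA'} IH => /=.
    rewrite lt0n size_eq0; case: (opened _ i) => [|a l] /= _; first by split=> [[/(_ isT)]|].
    by case: y => /=; split=> [[]|] // h; split.
  by case: y => /= _; split=> [[]|].
have := gen w 0%N (drop0 w) (leq0n _); rewrite /= => h.
by apply/asboolP/idP => [/h|/h] //.
Qed.

Let total_m s : Prop := forall cur, total (cur, [::]) s = m (cur :: s).
Let total_add s : Prop := forall x y stk, total (x + y, stk) s = total (x, stk) s + total (y, stk) s.
Let total_frame s : Prop := forall cur o args stk,
  total (cur, (o, args) :: stk) s =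
  \sum_(p <- splits s) if p.2 is b :: r then
     total (o * comp (F \o cat args) m (cur :: p.1) * b, stk) r else 0.

Let Ser_cat args : Ser (F \o cat args).
Proof. by move=> s t c x y /=; rewrite !catA hF. Qed.

(* the first gap of the block consists of [cur] alone, or the first [X] in it
   belongs to a block with one element or to a larger one *)
Let comp_step f cur b h : Ser f ->
  comp f m (cur :: b :: h) = comp (f \o cons cur) m (b :: h) +
    (comp f m (cur * F [::] * b :: h) +
     \sum_(p <- splits h) if p.2 is b' :: r then
        comp f m (cur * comp F m (b :: p.1) * b' :: r) else 0).
Proof.
move=> hf; have m1 x : m [:: x] = x by exact: boolean_moments1 (mom_boolean F).
rewrite comp_cons sum_splits_cons /= m1; congr (_ + _).
have madd x y s : comp (f \o cons (x + y)) m s = comp (f \o cons x) m s + comp (f \o cons y) m s.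
  by rewrite -big_split; apply: eq_bigr => c _; exact: (Ser_additive [::]).
have msum (I : Type) (r : seq I) (G : I -> B) s :
    comp (f \o cons (\sum_(i <- r) G i)) m s = \sum_(i <- r) comp (f \o cons (G i)) m s.
  rewrite exchange_big; apply: eq_bigr => c _; exact: (Ser_sum _ _ [::]).
have mz s : comp (f \o cons 0) m s = 0.
  by rewrite /comp big1 // => c _; exact: (Ser0 [::]).
transitivity (\sum_(p <- splits h) (comp (f \o cons (m (cur * F [::] * b :: p.1))) m p.2 +
   \sum_(q <- splits p.1) comp (f \o cons (cur * comp F m (b :: q.1) * m q.2)) m p.2)).
  apply: eq_bigr => p _; rewrite -msum -madd; congr (comp (f \o cons _) m _).
  rewrite mE add0r conv_cons comp_nil mulrDr /m !mom_mull -/m mulrA; congr (_ + _).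
  by rewrite mulr_sumr; apply: eq_bigr => q _; rewrite mulrA.
rewrite big_split comp_cons; congr (_ + _).
rewrite (sum_splits_assoc h (fun u v w => comp (f \o cons (cur * comp F m (b :: u) * m v)) m w)).
apply: eq_bigr => p _; case: p.2 => [|b' r].
  by rewrite sum_splits_nil /= m0 mulr0 mz.
rewrite sum_splits_cons /= m0 mulr0 mz add0r [RHS]comp_cons; apply: eq_bigr => q _.
by rewrite /m mom_mull.
Qed.

Let total_spec s : [/\ total_m s, total_frame s & total_add s].
Proof.
have [n] := ubnP (size s); elim: n s => // n IH s hs.
have IHm r : (size r < size s)%N -> total_m r.
  by move=> h; case: (IH r (leq_trans h hs)).
have IHf r : (size r < size s)%N -> total_frame r.
  by move=> h; case: (IH r (leq_trans h hs)).
have IHa r : (size r < size s)%N -> total_add r.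
  by move=> h; case: (IH r (leq_trans h hs)).
have IH0 r stk : (size r < size s)%N -> total (0, stk) r = 0.
  by move=> h; apply: (addrI (total (0, stk) r)); rewrite -IHa // !addr0.
have IHs (I : Type) (l : seq I) (G : I -> B) stk r : (size r < size s)%N ->
    total (\sum_(i <- l) G i, stk) r = \sum_(i <- l) total (G i, stk) r.
  move=> h; elim: l => [|i l IHl]; first by rewrite !big_nil IH0.
  by rewrite !big_cons IHa // IHl.
have Hm : total_m s.
  move=> cur; case: s hs IHm IHf {IH IHa IH0 IHs} => [|b s] hs IHm IHf.
    by rewrite /= /m (boolean_moments1 _ (mom_boolean F)).
  rewrite /= addr0 /read2 /= IHm // IHf // [RHS]mE add0r conv_cons comp_nil mulrDr.
  rewrite /m !mom_mull -/m mulrA; congr (_ + _).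
  rewrite mulr_sumr; apply: eq_big_seq => p /splits_size hp.
  case: p hp => u [|b' r] /= hp; first by rewrite m0 !mulr0.
  rewrite IHm; last by rewrite /=; lia.
  by rewrite mul1r /m mom_mull -/m mulrA.
have Hf : total_frame s.
  move=> cur o args stk; case: s hs IHm IHf IHa IHs IH0 {Hm IH} => [|b s] hs IHm IHf IHa IHs IH0.
    by rewrite sum_splits_nil.
  rewrite sum_splits_cons /= /read2 /= comp_cons sum_splits_nil comp_nil /=.
  have m1 : m [:: cur] = cur by exact: boolean_moments1 (mom_boolean F).
  rewrite m1 cats1 !mul1r.
  rewrite addrA addrC; congr (_ + _).
  rewrite IHf // (IHf s) // (IHf s) //.
  set G := F \o cat args.
  transitivity (\sum_(p <- splits s) (
     (if p.2 is b' :: r then total (o * comp (G \o cons cur) m (b :: p.1) * b', stk) r else 0) +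
     ((if p.2 is b' :: r then total (o * comp G m (cur * F [::] * b :: p.1) * b', stk) r else 0) +
      \sum_(q <- splits p.1) if p.2 is b' :: r then if q.2 is b2 :: r2 then
         total (o * comp G m (cur * comp F m (b :: q.1) * b2 :: r2) * b', stk) r else 0 else 0))).
    rewrite !big_split /= addrC; congr (_ + _).
      apply: eq_bigr => p _; case: p.2 => // b' r; congr (total (o * _ * _, _) _).
      by apply: eq_comp => // c; rewrite /= /G /= -cats1 -catA.
    congr (_ + _).
    rewrite (sum_splits_assoc s (fun u v w => if w is b' :: r then if v is b2 :: r2 then
       total (o * comp G m (cur * comp F m (b :: u) * b2 :: r2) * b', stk) r else 0 else 0)).
    apply: eq_big_seq => p /splits_size hp; case: p hp => u [|b2 v] /= hp.
      by rewrite sum_splits_nil.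
    rewrite sum_splits_cons /= IHf; last by rewrite /=; lia.
    rewrite -[LHS]add0r; congr (_ + _).
  apply: eq_big_seq => p /splits_size hp; case: p hp => u [|b' r] /= hp.
    by rewrite big1 ?addr0.
  rewrite (comp_step _ _ _ (Ser_cat args)) -/G.
  have rs : (size r < (size s).+1)%N by rewrite -hp ltnS (leq_trans (leqnSn _)) // leq_addl.
  rewrite !mulrDr !mulrDl !IHa //; congr (_ + (_ + _)).
  rewrite mulr_sumr mulr_suml IHs //; apply: eq_bigr => q _.
  by case: q.2 => // *; rewrite ?mulr0 ?mul0r ?IH0.
split=> // x y [|[o args] stk]; first by rewrite !Hm !mE mulrDl.
rewrite !Hf -big_split; apply: eq_big_seq => p /splits_size hp; case: p hp => u [|b r] /= hp.
  by rewrite addr0.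
rewrite (Ser_additive [::]); last exact: comp_Ser (Ser_cat args) (mom_Ser hF).
by rewrite mulrDr mulrDl IHa //; lia.
Qed.

Lemma total_mom cur s : total (cur, [::]) s = mom F (cur :: s).
Proof. by case: (total_spec s). Qed.

Lemma run_string (I : Type) (f : I -> B) (g : I -> bool * bool) (e : seq I) k st :
  (foldl (read F) st (token_of k :: flatten [seq [:: Coef (f i); token_of (g i)] | i <- e])).1 =
  (run st (k :: [seq g i | i <- e]) ([seq f i | i <- e] ++ [:: 1])).1.
Proof.
elim: e k st => [|i e IH] k st; last by rewrite /run /= -IH.
by rewrite /run /= /read2; case: (read F st _) => c l /=; rewrite mulr1.
Qed.

Lemma nested_run n (pi : {set {set 'I_n.+1}}) (bs : seq B) : size bs = n ->
  nested F pi bs = (run (1, [::]) (word_of pi) (bs ++ [:: 1])).1.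
Proof.
move=> sbs; rewrite /nested /token_string.
have tokE i : block_token B pi i = token_of (letter pi i).
  by rewrite /block_token /letter; case: [exists j in _, _]; case: [exists j in _, _].
have -> : bs ++ [:: 1] = [seq bs`_(val i) | i <- enum 'I_n] ++ [:: 1].
  rewrite (map_comp (nth 0 bs) val) val_enum_ord.
  by have := mkseq_nth 0 bs; rewrite /mkseq sbs => ->.
have -> : word_of pi = letter pi ord0 :: [seq letter pi (lift ord0 i) | i <- enum 'I_n] :> seq _.
  by rewrite /word_of /= enum_ordSl /= -map_comp.
by rewrite -run_string tokE; under eq_map => i do rewrite tokE.
Qed.

(** The string machine that evaluates nested functionals visits the blocks of
    all the non-crossing partitions; summed over the partitions, its value obeys the
    recursion of the moments over the block of the first point. *)
Theorem sum_nested (bs : seq B) :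
  \sum_(pi in NC (size bs).+1) nested F pi bs = mom F (1 :: bs ++ [:: 1]).
Proof.
rewrite -total_mom total_words size_cat addn1.
under eq_bigr => pi _ do rewrite (nested_run pi (erefl (size bs))).
rewrite (sum_NC (fun w => (run (1, [::]) w (bs ++ [:: 1])).1)) /=.
apply: eq_bigl => w; rewrite -bracketed_balanced size_tuple //.
Qed.

End Reading.

(** * Polynomials in one variable over B *)

Section Polynomials.
Variables (R : realType) (B : cstarAlgType R).
Implicit Types (P Q : ncpoly B) (a b c x y : B) (s t : seq B).

Local Open Scope quotient_scope.

Let pi_ (p : rawpoly B) : ncpoly B := \pi_(ncpoly B) p.

(** The value 0 at the empty list is the convention of the recursion for Boolean
    moments. *)
Definition wpoly s : ncpoly B := if s is b :: t then \pi_(ncpoly B) [:: (b, t)] else 0.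

Arguments wpoly : simpl never.

Lemma nc_addE' (p q : rawpoly B) : pi_ p + pi_ q = pi_ (p ++ q).
Proof. exact: nc_addE. Qed.

Lemma nc_mulE' (p q : rawpoly B) : pi_ p * pi_ q = pi_ (raw_mul p q).
Proof. exact: nc_mulE. Qed.

Lemma ncpoly_sum (p : rawpoly B) : pi_ p = \sum_(w <- p) wpoly (wseq w).
Proof.
elim: p => [|[a s] p IH]; first by rewrite big_nil.
by rewrite big_cons -IH -[wpoly _]/(pi_ [:: (a, s)]) nc_addE'.
Qed.

Lemma ncpoly_ind (K : ncpoly B -> Prop) :
  (forall p : rawpoly B, K (\sum_(w <- p) wpoly (wseq w))) -> forall P, K P.
Proof. by move=> h P; elim/ncW: P => p; rewrite -/(pi_ p) ncpoly_sum. Qed.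

Lemma ncC_linear : linear (ncC : B -> ncpoly B).
Proof.
move=> c x y; transitivity (nc_add (nc_scale c (ncC x)) (ncC y)); last by [].
rewrite /ncC nc_scaleE nc_addE; apply: nc_eq => V phi h.
by rewrite /raw_eval /= !big_cons !big_nil /wseq /= !addr0 (h.1 [::]).
Qed.

HB.instance Definition _ := GRing.isLinear.Build R[i] B (ncpoly B) _ ncC ncC_linear.

Lemma ncC_mul x y : ncC (x * y) = ncC x * ncC y :> ncpoly B.
Proof. rewrite -[ncC x]/(pi_ [:: (x, [::])]) -[ncC y]/(pi_ [:: (y, [::])]).
by rewrite nc_mulE'. Qed.

Lemma ncC1 : ncC 1 = 1 :> ncpoly B. Proof. by []. Qed.

Lemma wpoly1 b : wpoly [:: b] = ncC b. Proof. by []. Qed.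

Lemma wpoly_cons b c s : wpoly (b :: c :: s) = ncC b * (ncX * wpoly (c :: s)).
Proof.
rewrite -[wpoly (b :: _)]/(pi_ [:: (b, c :: s)]) -[wpoly _]/(pi_ [:: (c, s)]).
rewrite -[ncC b]/(pi_ [:: (b, [::])]) -[ncX]/(pi_ [:: (1, [:: 1])]) !nc_mulE'.
by rewrite /raw_mul /= /wmul /= /wseq /= mul1r mulr1.
Qed.

Lemma wpoly_cat s a b t : wpoly (s ++ [:: a]) * wpoly (b :: t) = wpoly (s ++ (a * b) :: t).
Proof.
elim: s => [|c s IH] /=.
  case: t => [|d t]; first by rewrite !wpoly1 ncC_mul.
  by rewrite wpoly1 !wpoly_cons ncC_mul mulrA.
by case: s IH => [|d s] IH; rewrite !wpoly_cons -!mulrA IH.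
Qed.

Lemma monomialE b0 bs : monomial ncC ncX b0 bs = wpoly (b0 :: bs).
Proof.
elim: bs b0 => [|b bs IH] b0; first by rewrite /monomial big_nil mulr1.
by rewrite wpoly_cons -IH /monomial big_cons !mulrA.
Qed.

Lemma wpoly_Ser s t (c : R[i]) x y :
  wpoly (s ++ (c *: x + y) :: t) = c *: wpoly (s ++ x :: t) + wpoly (s ++ y :: t).
Proof.
elim: s => [|b s IH] /=.
  case: t => [|d t]; first by rewrite !wpoly1 linearP.
  by rewrite !wpoly_cons linearP mulrDl scalerAl.
case: s IH => [|d s] IH; rewrite !wpoly_cons IH !mulrDr; congr (_ + _).
  by rewrite !scalerAr.
by rewrite !scalerAr.
Qed.

Lemma nc_star_wpoly s : nc_star (wpoly s) = wpoly (srev s).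
Proof.
case: s => [|b s]; first exact: (nc_starE [::]).
rewrite /wpoly nc_starE /= srev_cons.
have := wseq_wstar (b, s); rewrite -/(srev (b :: s)) srev_cons.
by case: (wstar (b, s)) => a u <-.
Qed.

Lemma nc_starD P Q : nc_star (P + Q) = nc_star P + nc_star Q.
Proof.
elim/ncW: P => p; elim/ncW: Q => q.
rewrite -[_ + _ in LHS]/(nc_add _ _) -[RHS]/(nc_add _ _).
by rewrite !(nc_starE, nc_addE) /raw_star map_cat.
Qed.

Lemma nc_star0 : nc_star 0 = 0 :> ncpoly B. Proof. exact: (nc_starE [::]). Qed.

Lemma nc_star_sum (I : Type) (r : seq I) (F : I -> ncpoly B) :
  nc_star (\sum_(i <- r) F i) = \sum_(i <- r) nc_star (F i).
Proof. exact: (big_morph _ nc_starD nc_star0). Qed.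

Lemma nc_starK P : nc_star (nc_star P) = P.
Proof.
elim/ncpoly_ind: P => p; rewrite !nc_star_sum; apply: eq_bigr => w _.
by rewrite !nc_star_wpoly srevK.
Qed.

Lemma nc_starM P Q : nc_star (P * Q) = nc_star Q * nc_star P.
Proof.
elim/ncpoly_ind: P => p; elim/ncpoly_ind: Q => q.
have h (v w : word B) : nc_star (wpoly (wseq v) * wpoly (wseq w)) =
    nc_star (wpoly (wseq w)) * nc_star (wpoly (wseq v)).
  case: v w => [a s] [b t]; rewrite /wseq /= lastI -cats1 wpoly_cat !nc_star_wpoly.
  rewrite !srev_cat !srev_cons -catA (_ : srev [::] = [::]) //=.
  by rewrite wpoly_cat starM.
rewrite !nc_star_sum mulr_suml nc_star_sum mulr_sumr; apply: eq_bigr => v _.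
by rewrite mulr_sumr nc_star_sum mulr_suml; apply: eq_bigr => w _.
Qed.

Lemma nc_starC b : nc_star (ncC b) = ncC (star b).
Proof. exact: (nc_star_wpoly [:: b]). Qed.

Lemma nc_starX : nc_star ncX = ncX :> ncpoly B.
Proof.
have -> : ncX = wpoly [:: 1; 1] by [].
by rewrite nc_star_wpoly /srev /= star1.
Qed.

End Polynomials.
Arguments wpoly : simpl never.

Section AlgebraicDistributions.
Variables (R : realType) (B : cstarAlgType R).
Implicit Types (P Q : ncpoly B) (a b c x y : B) (s t : seq B) (m : seq B -> B).

(** The result does not depend on the representative when [m] is multilinear. *)
Definition dist_of m P : B := raw_eval m (repr P).

Lemma Ser_balanced m : Ser m -> Defs.balanced m.
Proof.
move=> hm; split=> [s t x y|s t u c x y]; first exact: Ser_additive.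
by rewrite Ser_scale // -!cat_cons !catA Ser_scale.
Qed.

Lemma dist_of_wpoly m b s : Ser m -> dist_of m (wpoly (b :: s)) = m (b :: s).
Proof.
move=> hm; rewrite /dist_of /wpoly repr_evalE; last exact: Ser_balanced.
by rewrite /raw_eval big_seq1.
Qed.

Lemma dist_of_linear m : Ser m -> linear (dist_of m).
Proof.
move=> hm c P Q; elim/ncW: P => p; elim/ncW: Q => q.
have hb := Ser_balanced hm.
transitivity (dist_of m (nc_add (nc_scale c (\pi_(ncpoly B)%qT p)) (\pi_(ncpoly B)%qT q))); first by [].
rewrite nc_scaleE nc_addE /dist_of !repr_evalE // raw_eval_cat; congr (_ + _).
rewrite /raw_eval big_map scaler_sumr; apply: eq_bigr => w _.
by rewrite /wseq /= (Ser_scale [::]).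
Qed.

Section Dist.
Variable mu : ncpoly B -> B.
Hypothesis hmu : Sigma_alg mu.

Let mu_linear : linear mu. Proof. by case: hmu. Qed.
HB.instance Definition _ := GRing.isLinear.Build R[i] (ncpoly B) B _ mu mu_linear.

Lemma dist_mulC b P : mu (ncC b * P) = b * mu P.
Proof.
by case: hmu => _ h _; have := h b 1 P; rewrite ncC1 !mulr1.
Qed.

Lemma dist_mulCr b P : mu (P * ncC b) = mu P * b.
Proof.
by case: hmu => _ h _; have := h 1 b P; rewrite ncC1 !mul1r.
Qed.

Lemma distC b : mu (ncC b) = b. Proof. by case: hmu. Qed.

Lemma dist_sum (I : Type) (r : seq I) (F : I -> ncpoly B) :
  mu (\sum_(i <- r) F i) = \sum_(i <- r) mu (F i).
Proof. exact: raddf_sum. Qed.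

Lemma distB P Q : mu (P - Q) = mu P - mu Q. Proof. exact: raddfB. Qed.

Definition moments s : B := mu (wpoly s).

Lemma moments_Ser : Ser moments.
Proof. by move=> s t c x y; rewrite /moments wpoly_Ser mu_linear. Qed.

Lemma moments_nil : moments [::] = 0. Proof. exact: raddf0. Qed.

Lemma moments1 b : moments [:: b] = b. Proof. exact: distC. Qed.

Lemma moments_mull x y s : moments (x * y :: s) = x * moments (y :: s).
Proof. by rewrite -dist_mulC -wpoly1 (wpoly_cat [::]). Qed.

Lemma moments_mulr s x y : moments (s ++ [:: x * y]) = moments (s ++ [:: x]) * y.
Proof. by rewrite -dist_mulCr -wpoly1 wpoly_cat. Qed.

Lemma moment_seriesE bs : moment_series mu bs = moments (1 :: bs ++ [:: 1]).
Proof.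
rewrite /moment_series /moments; congr mu.
elim: bs => [|b bs IH]; first by rewrite big_nil mul1r wpoly_cons ncC1 mul1r wpoly1 mulr1.
rewrite big_cons -mulrA IH wpoly_cons ncC1 mul1r -mulrA; congr (_ * _).
by rewrite -wpoly1 (wpoly_cat [::]) mulr1.
Qed.

(** ** Boolean cumulants *)

(** In the Hilbert space picture, [zeta (b :: g)] is obtained from [zeta g] by
    multiplication by [X], projection onto the complement of the constants, and
    multiplication by [b]. *)
Fixpoint zeta s : ncpoly B :=
  if s is b :: g then ncC b * (ncX * zeta g - ncC (mu (ncX * zeta g))) else 1.

Definition bool_cumulants s : B := mu (ncX * zeta s).

Lemma zeta_Ser s t (k : R[i]) x y :
  zeta (s ++ (k *: x + y) :: t) = k *: zeta (s ++ x :: t) + zeta (s ++ y :: t).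
Proof.
elim: s => [|b s IH] /=; first by rewrite linearP mulrDl scalerAl.
have e : ncX * zeta (s ++ (k *: x + y) :: t) =
    k *: (ncX * zeta (s ++ x :: t)) + ncX * zeta (s ++ y :: t).
  by rewrite IH mulrDr scalerAr.
by rewrite e mu_linear linearP opprD addrACA -scalerBr mulrDr scalerAr.
Qed.

Lemma bool_cumulants_Ser : Ser bool_cumulants.
Proof.
by move=> s t k x y; rewrite /bool_cumulants zeta_Ser mulrDr -scalerAr mu_linear.
Qed.

(** Each multiplication by [X] splits off a constant, at a position that splits the word. *)
Lemma wpoly_zeta s : wpoly s = \sum_(p <- splits s) zeta p.1 * ncC (moments p.2).
Proof.
elim: s => [|b s IH]; first by rewrite sum_splits_nil moments_nil raddf0 mulr0.
rewrite sum_splits_cons /= mul1r; case: s IH => [|c s] IH.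
  by rewrite sum_splits_nil moments_nil raddf0 mulr0 addr0 moments1.
have e1 : ncX * wpoly (c :: s) =
    \sum_(p <- splits (c :: s)) ncX * zeta p.1 * ncC (moments p.2).
  by rewrite IH mulr_sumr; apply: eq_bigr => p _; rewrite mulrA.
have e2 : moments [:: b, c & s] =
    b * \sum_(p <- splits (c :: s)) mu (ncX * zeta p.1) * moments p.2.
  rewrite {1}/moments wpoly_cons dist_mulC e1 dist_sum; congr (_ * _).
  by apply: eq_bigr => p _; rewrite dist_mulCr.
have -> : \sum_(p <- splits (c :: s))
    ncC b * (ncX * zeta p.1 - ncC (mu (ncX * zeta p.1))) * ncC (moments p.2) =
    ncC b * (ncX * wpoly (c :: s)) - ncC (moments [:: b, c & s]).
  rewrite e1 e2 ncC_mul raddf_sum -mulrBr -sumrB mulr_sumr; apply: eq_bigr => p _.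
  by rewrite -[X in _ = _ * (_ - X)]/(ncC _) ncC_mul -mulrBl mulrA.
by rewrite addrC subrK wpoly_cons.
Qed.

(** Apply [mu] to [X] times the expansion of a monomial along the [zeta]'s. *)
Lemma moments_boolean : boolean_moments moments bool_cumulants.
Proof.
split=> [|b s]; first exact: moments_nil.
case: s => [|c s].
  by rewrite moments1 /conv sum_splits_nil moments_nil mulr0 addr0 mulr1.
rewrite {1}/moments wpoly_cons dist_mulC add0r; congr (_ * _).
rewrite wpoly_zeta mulr_sumr dist_sum; apply: eq_bigr => p _.
by rewrite mulrA dist_mulCr.
Qed.

(** ** The R-transform *)

(** The moment series only sees the words with outer coefficients 1, but the bimodule
    property and the recursion for [mom] determine the others in the same way. *)
Lemma is_RtransformP F : is_Rtransform mu F <-> Ser F /\ moments =1 mom F.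
Proof.
split=> [[hF h]|[hF h]]; split=> //; last first.
  by move=> bs; rewrite moment_seriesE h sum_nested.
have h1 bs : moments (1 :: bs ++ [:: 1]) = mom F (1 :: bs ++ [:: 1]).
  by rewrite -moment_seriesE h sum_nested.
have hm := mom_boolean F.
have mr s x : mom F (s ++ [:: x]) = mom F (s ++ [:: 1]) * x.
  by rewrite !(boolean_moments_last _ _ hm) mulr1.
case=> [|b s]; first by rewrite moments_nil hm.1.
case: (lastP s) => [|u x]; first by rewrite moments1 (boolean_moments1 _ hm).
rewrite -cats1 -[b]mulr1 moments_mull mom_mull -[x]mul1r.
by congr (_ * _); rewrite -cat_cons moments_mulr [in RHS]mr mul1r cat_cons h1.
Qed.

Lemma comp_cumulants F : moments =1 mom F -> comp F moments =1 bool_cumulants.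
Proof.
move=> h; apply: (conv_injl moments_nil moments1) => s.
have hm := mom_boolean F; have := h (1 :: s).
rewrite (moments_boolean).2 hm.2 !mul1r => /addrI ->.
by apply: eq_conv => // t; apply: eq_comp => // u; rewrite h.
Qed.

Lemma Rtransform_uniq F G : is_Rtransform mu F -> is_Rtransform mu G -> F =1 G.
Proof.
move=> /is_RtransformP[_ /comp_cumulants hF] /is_RtransformP[_ /comp_cumulants hG].
by apply: (comp_inj moments1) => s; rewrite hF hG.
Qed.

Lemma RtransformP : is_Rtransform mu (Rtransform mu).
Proof.
have [F hF e] := comp_solve moments1 bool_cumulants_Ser moments_Ser.
suff h : is_Rtransform mu F by exact: (xgetPex (fun=> 0) (ex_intro _ F h)).
apply/is_RtransformP; split=> //; apply: mom_uniq.
by apply: eq_boolean_moments moments_boolean => s; rewrite e.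
Qed.

Lemma RtransformE F : is_Rtransform mu F -> Rtransform mu = F.
Proof. by move=> h; apply/funext; apply: Rtransform_uniq h; exact: RtransformP. Qed.

End Dist.

Lemma dist_of_Sigma_alg F : Ser F -> Sigma_alg (dist_of (mom F)) /\
  moments (dist_of (mom F)) =1 mom F.
Proof.
move=> hF; have hm := mom_Ser hF; have lin := dist_of_linear hm.
have hb := mom_boolean F.
pose nu := dist_of (mom F).
pose nuL := GRing.isLinear.Build R[i] (ncpoly B) B _ nu lin.
have nu_sum (r : seq (word B)) (G : word B -> ncpoly B) : nu (\sum_(w <- r) G w) = \sum_(w <- r) nu (G w).
  pose nu' : {linear ncpoly B -> B} := HB.pack nu nuL.
  exact: (raddf_sum nu').
split; last first.
  case=> [|b s]; last exact: dist_of_wpoly.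
  have e0 : nu 0 = 0 by have := nu_sum [::] (fun=> 0); rewrite !big_nil.
  by rewrite -[LHS]/(nu 0) e0 hb.1.
split=> // [a b P|b]; last first.
  by rewrite -wpoly1 dist_of_wpoly // (boolean_moments1 _ hb).
elim/ncpoly_ind: P => p; rewrite mulr_sumr mulr_suml -/nu !nu_sum mulr_sumr mulr_suml.
apply: eq_bigr => -[x s] _; rewrite /wseq /= -!wpoly1 (wpoly_cat [::]) /= /nu.
rewrite [in RHS]dist_of_wpoly //.
case: (lastP s) => [|u y].
  rewrite (wpoly_cat [::]) dist_of_wpoly //.
  by rewrite !(boolean_moments1 _ hb).
rewrite -cats1 -cat_cons wpoly_cat dist_of_wpoly // mom_mull -cat_cons.
by rewrite -!cat_cons !(boolean_moments_last _ _ hb) !mulrA.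
Qed.

Lemma boxplus_powP mu (alpha : {linear B -> B}) : Sigma_alg mu ->
  Sigma_alg (boxplus_pow mu alpha) /\
  moments (boxplus_pow mu alpha) =1 mom (alpha \o Rtransform mu).
Proof.
move=> hmu; have [hR _] := RtransformP hmu.
have haR : Ser (alpha \o Rtransform mu) by exact: Ser_linear.
have [h1 h2] := dist_of_Sigma_alg haR.
have : [set nu | Sigma_alg nu /\ Rtransform nu = alpha \o Rtransform mu]%classic (boxplus_pow mu alpha).
  apply: xgetPex; exists (dist_of (mom (alpha \o Rtransform mu))); split=> //.
  by apply: RtransformE => //; apply/is_RtransformP.
move=> [h3 h4]; split=> //; rewrite -h4.
by have [] := (is_RtransformP h3 _).1 (RtransformP h3).
Qed.

End AlgebraicDistributions.

(** * Positivity of the convolution power *)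

Section Positivity.
Variables (R : realType) (B : cstarAlgType R).
Implicit Types (P Q : ncpoly B) (a b : B) (s t : seq B) (m K : seq B -> B).

(** The pair [(a, s)] stands for the monomial of [a :: s]; for the moments of [mu] this is
    the kernel of the pairing [mu (P^* Q)] on monomials. *)
Definition word_kernel m (u v : B * seq B) : B := m (srev u.2 ++ (star u.1 * v.1) :: v.2).

Definition shorter n : pred (B * seq B) := fun u => (size u.2 < n)%N.

Lemma pdk_pullback (T S : Type) (f : S -> T) (p : pred T) (q : pred S) (K : T -> T -> B) :
  (forall x, q x -> p (f x)) -> pdk p K -> pdk q (fun x y => K (f x) (f y)).
Proof.
move=> h hK; apply: (pdk_expand (e := fun x => [:: (f x, 1)]) hK) => [x /h|x y _ _].
  by rewrite /= => ->.
by rewrite !big_seq1 /= star1 mul1r mulr1.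
Qed.

(** Positive-definiteness concerns finitely many words at a time. *)
Lemma pdk_words (K : B * seq B -> B * seq B -> B) :
  (forall n, pdk (shorter n) K) -> pdk predT K.
Proof.
move=> h l _; apply: (h (\sum_(p <- l) size p.1.2).+1).
elim: l => //= p l IH; rewrite big_cons /shorter ltnS leq_addr /=.
by apply: sub_all IH => q; rewrite /shorter !ltnS => /leq_trans; apply; exact: leq_addl.
Qed.

Lemma pdk_cp (T : Type) (p : pred T) (K : T -> T -> B) (beta : {linear B -> B}) :
  completely_positive beta -> pdk p K -> pdk p (fun x y => beta (K x y)).
Proof.
move=> hb hK; pose phi (x : B) (_ _ : unit) := beta x.
have h : pdk (fun u : T * unit => p u.1) (fun u v => phi (K u.1 v.1) u.2 v.2).
  apply: pdk_tensor hK _ _ _ => [x y s t|r x s t|]; rewrite /phi.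
  - exact: raddfD.
  - exact: linearZ.
  - exact: cp_kernel.
exact: (pdk_pullback (f := fun x => (x, tt)) _ h).
Qed.

Lemma cp_star (beta : B -> B) (x : B) : completely_positive beta -> beta (star x) = star (beta x).
Proof.
move=> /cp_kernel h; have := @pdk_herm _ _ _ _ _ (1, tt) (x, tt) h isT isT.
by rewrite /= star1 mul1r mulr1.
Qed.

(** ** From Boolean cumulants to moments *)

(** Cutting a word at the junction of its two halves gives a term of rank one and a
    congruence transform of the kernel of [K] at strictly shorter words. *)
Lemma pdk_boolean_moments m K n : boolean_moments m K ->
  (forall s, m (srev s) = star (m s)) ->
  pdk (shorter n) (word_kernel K) -> pdk (shorter n.+1) (word_kernel m).
Proof.
move=> hm ms hK; have [m0 _] := hm.
pose rest (u v : B * seq B) := \sum_(p <- splits u.2 | (size p.1 < size u.2)%N)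
  \sum_(q <- splits v.2 | (size q.1 < size v.2)%N)
    star (m p.2) * word_kernel K (u.1, p.1) (v.1, q.1) * m q.2.
have hr : pdk (shorter n.+1) rest.
  pose e (u : B * seq B) := [seq ((u.1, p.1), m p.2) | p <- splits u.2 & (size p.1 < size u.2)%N].
  apply: (pdk_expand (e := e) hK) => [u|u v _ _].
    rewrite /shorter /= ltnS => hu; rewrite all_map; apply/allP => p.
    by rewrite mem_filter => /andP[h _] /=; exact: leq_trans h hu.
  rewrite big_map big_filter; apply: eq_bigr => p _.
  by rewrite big_map big_filter.
have h1 : pdk (shorter n.+1) (fun u v : B * seq B => star (m (u.1 :: u.2)) * m (v.1 :: v.2)).
  exact: pdk_rank1.
apply: pdk_ext (pdk_add h1 hr) => -[a s] [b t]; rewrite /word_kernel /rest /=.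
rewrite (boolean_moments_cut _ _ _ _ hm) -srev_cons ms sum_splits_srev; congr (_ + _).
rewrite sum_splits_last /= [X in X + _ = _]big1 ?add0r => [|q _]; last first.
  by rewrite m0 !mul0r.
apply: eq_bigr => p _; rewrite sum_splits_last /= m0 mulr0 add0r.
by apply: eq_bigr => q _; rewrite ms.
Qed.

(** ** Substitution *)

(** The point of junction of the two halves of a word lies in one chunk, which
    is cut into two halves too; the kernel of [comp K m] is thus a sum of values of the
    kernel of [K] at arguments that involve the kernel of [m]. *)
Lemma pdk_comp m K n : Ser K -> (forall s, m (srev s) = star (m s)) ->
  pdk predT (word_kernel K) -> pdk (shorter n) (word_kernel m) ->
  pdk (shorter n) (word_kernel (comp K m)).
Proof.
move=> hK ms pK pm.
pose phi (x : B) (C D : seq B) := K (srev C ++ x :: D).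
have h : pdk (fun u : (B * seq B) * seq B => shorter n u.1)
    (fun u v => phi (word_kernel m u.1 v.1) u.2 v.2).
  apply: pdk_tensor pm _ _ _ => [x y C D|r x C D|]; rewrite /phi.
  - exact: Ser_additive.
  - exact: Ser_scale.
  - exact: pK.
pose e (u : B * seq B) : seq (((B * seq B) * seq B) * B) :=
  [seq (((u.1, p.1), [seq m g | g <- c]), 1) | p <- splits u.2, c <- chunks p.2].
have eE (F : ((B * seq B) * seq B) * B -> B) u : \sum_(p <- e u) F p =
    \sum_(p <- splits u.2) \sum_(c <- chunks p.2) F (((u.1, p.1), [seq m g | g <- c]), 1).
  by rewrite big_allpairs_dep.
apply: (pdk_expand (e := e) h) => [u hu|[a s] [b t] _ _].
  apply/allP => w /allpairsPdep[p [c [hp _ ->]]] /=.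
  exact: splits_sizel hp hu.
rewrite eE /word_kernel /comp sum_chunks_mid sum_splits_srev; apply: eq_bigr => p _ /=.
transitivity (\sum_(q <- splits t) \sum_(c <- chunks p.2) \sum_(d <- chunks q.2)
   phi (word_kernel m (a, p.1) (b, q.1)) [seq m g | g <- c] [seq m g | g <- d]).
  apply: eq_bigr => q _; rewrite /srev sum_chunks_rev sum_chunks_map.
  apply: eq_bigr => c _; apply: eq_bigr => d _; rewrite /phi map_cat /=; congr (K (_ ++ _)).
  rewrite /srev map_rev -!map_comp; congr rev; apply: eq_map => g /=.
  by rewrite -/(srev g) ms.
rewrite exchange_big; apply: eq_bigr => c _; rewrite eE; apply: eq_bigr => q _.
by apply: eq_bigr => d _; rewrite /= star1 mul1r mulr1.
Qed.

(** ** Positive distributions *)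

Section Distribution.
Variable mu : ncpoly B -> B.
Hypothesis hmu : Sigma_alg mu.

Lemma dist_kernel (u v : B * seq B) :
  mu (nc_star (wpoly (u.1 :: u.2)) * wpoly (v.1 :: v.2)) = word_kernel (moments mu) u v.
Proof. by rewrite nc_star_wpoly srev_cons wpoly_cat. Qed.

(** The coefficients in [B] can be absorbed into the polynomials. *)
Lemma pdk_dist : (forall P, positive (mu (nc_star P * P))) ->
  pdk predT (fun P Q => mu (nc_star P * Q)).
Proof.
move=> pos l _; have /positiveP := pos (\sum_(p <- l) p.1 * ncC p.2); congr psd.
rewrite nc_star_sum mulr_suml (dist_sum hmu); apply: eq_bigr => p _.
rewrite mulr_sumr (dist_sum hmu); apply: eq_bigr => q _.
by rewrite nc_starM nc_starC mulrA dist_mulCr // -mulrA dist_mulC.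
Qed.

Lemma positive_of_kernel : pdk predT (word_kernel (moments mu)) ->
  forall P, positive (mu (nc_star P * P)).
Proof.
move=> h P; apply/positiveP; elim/ncpoly_ind: P => p.
have := h [seq (w, 1) | w <- p] (all_predT _); congr psd.
rewrite big_map nc_star_sum mulr_suml (dist_sum hmu); apply: eq_bigr => u _.
rewrite big_map mulr_sumr (dist_sum hmu); apply: eq_bigr => v _.
by rewrite /= star1 mul1r mulr1 -dist_kernel.
Qed.

Hypothesis pos : forall P, positive (mu (nc_star P * P)).

Lemma dist_star P : mu (nc_star P) = star (mu P).
Proof.
have := @pdk_herm _ _ _ _ _ 1 P (pdk_dist pos) isT isT.
by rewrite -{1}ncC1 nc_starC star1 ncC1 mul1r mulr1.
Qed.

Lemma moments_star s : moments mu (srev s) = star (moments mu s).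
Proof. by rewrite /moments -nc_star_wpoly dist_star. Qed.

Lemma zeta_starE a g : nc_star (zeta mu (a :: g)) =
  (nc_star (zeta mu g) * ncX - ncC (star (bool_cumulants mu g))) * ncC (star a).
Proof.
by rewrite /= nc_starM nc_starC nc_starD -raddfN !nc_starC starN raddfN nc_starM nc_starX.
Qed.

Lemma zeta_pairX g h :
  mu (nc_star (zeta mu g) * (ncX * zeta mu h)) = bool_cumulants mu (srev g ++ h).
Proof.
elim: g h => [|a g IH] h; first by rewrite /= -ncC1 nc_starC star1 ncC1 mul1r.
rewrite srev_cons -catA -IH zeta_starE; set z := nc_star (zeta mu g).
have e1 : mu (z * ncX) = star (bool_cumulants mu g).
  by rewrite -nc_starX -nc_starM dist_star.
rewrite /= !mulrBr mulrBl mulrBl !(distB hmu) !mulrA; congr (_ - _).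
rewrite -ncC_mul -mulrA dist_mulC // -[z * ncX * _ * _]mulrA -ncC_mul dist_mulCr //.
by rewrite e1 mulrA.
Qed.

(** Boolean cumulants are the moments of the compression of [X] to the orthogonal
    complement of the constants, and the [zeta]'s are the words in that compression. *)
Lemma zeta_pair a g b h :
  mu (nc_star (zeta mu (a :: g)) * zeta mu (b :: h)) =
  word_kernel (bool_cumulants mu) (a, g) (b, h).
Proof.
rewrite /word_kernel /= -zeta_pairX zeta_starE -mulrA.
have -> : ncC (star a) * (ncC b * (ncX * zeta mu h - ncC (mu (ncX * zeta mu h)))) =
    zeta mu (star a * b :: h) by rewrite /= mulrA -ncC_mul.
rewrite mulrBl (distB hmu) dist_mulC // -mulrA.
have -> : mu (zeta mu (star a * b :: h)) = 0.
  by rewrite /= dist_mulC // (distB hmu) distC // subrr mulr0.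
by rewrite mulr0 subr0.
Qed.

Lemma bool_cumulants_star s : bool_cumulants mu (srev s) = star (bool_cumulants mu s).
Proof.
have := zeta_pairX s [::]; rewrite cats0 /= mulr1 => <-.
by rewrite -nc_starX -nc_starM dist_star.
Qed.

Lemma bool_cumulants_kernel : pdk predT (word_kernel (bool_cumulants mu)).
Proof.
apply: pdk_ext (pdk_pullback (q := predT) (f := fun u : B * seq B => zeta mu (u.1 :: u.2)) _ (pdk_dist pos)) => //.
by move=> [a g] [b h]; rewrite zeta_pair.
Qed.

End Distribution.

(** ** The convolution power *)

(** [m_nu = comp m_mu m_tau], where [tau] has the free cumulants [beta \o B_mu]
    ([B_mu] the Boolean cumulants of [mu]), and its Boolean cumulants are the values of
    [1 + beta] at those of [comp B_mu m_tau]. *)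
Section Power.
Variables (mu : ncpoly B -> B) (beta : {linear B -> B}).
Hypothesis hmu : Sigma_alg mu.

Definition tau_moments : seq B -> B := mom (beta \o bool_cumulants mu).
Definition tau_cumulants : seq B -> B := comp (bool_cumulants mu) tau_moments.

Lemma tau_boolean : boolean_moments tau_moments (beta \o tau_cumulants).
Proof.
by apply: eq_boolean_moments (mom_boolean _) => s; rewrite comp_additive.
Qed.

Lemma power_boolean : boolean_moments (comp (moments mu) tau_moments)
  (fun s => tau_cumulants s + beta (tau_cumulants s)).
Proof. exact: boolean_moments_comp (moments_boolean hmu) _ tau_boolean. Qed.

(** The Boolean cumulants of the right-hand side are those of the left-hand side, as
    [bool_cumulants mu] is itself the substitution of the moments of [mu] into the
    R-transform and substitution is associative. *)
Lemma power_moments (alpha : {linear B -> B}) :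
  (forall x : B, alpha x = x + beta x) ->
  mom (alpha \o Rtransform mu) =1 comp (moments mu) tau_moments.
Proof.
move=> ha; have /(is_RtransformP hmu)[hR e] := RtransformP hmu.
move=> s; symmetry; apply: mom_uniq.
apply: eq_boolean_moments power_boolean => t; rewrite -ha comp_additive; congr (alpha _).
rewrite comp_assoc //; apply: eq_comp => // u; symmetry.
exact: comp_cumulants e u.
Qed.

Hypothesis pos : forall P, positive (mu (nc_star P * P)).
Hypothesis beta_cp : completely_positive beta.

Lemma tau_moments_star s : tau_moments (srev s) = star (tau_moments s).
Proof.
apply: (boolean_moments_star tau_boolean) => n h t ht /=.
rewrite -cp_star //; congr (beta _).
by apply: comp_star ht => // u; exact: bool_cumulants_star.
Qed.

(** Positivity of the words of length [n] for [tau] gives that of its Boolean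
    cumulants at the same length, hence that of the words of length [n + 1]. *)
Lemma tau_kernel : pdk predT (word_kernel tau_cumulants).
Proof.
have step n : pdk (shorter n) (word_kernel tau_moments) ->
    pdk (shorter n) (word_kernel tau_cumulants).
  apply: pdk_comp => //; first exact: bool_cumulants_Ser.
    exact: tau_moments_star.
  exact: bool_cumulants_kernel.
apply: pdk_words => n; apply: (step); elim: n => [|n IH].
  by case=> [|p l] // _; rewrite big_nil; exact: psd0.
apply: (pdk_boolean_moments tau_boolean tau_moments_star).
exact: (pdk_cp beta_cp (step n IH)).
Qed.

Lemma power_kernel : pdk predT (word_kernel (comp (moments mu) tau_moments)).
Proof.
apply: pdk_words => n; apply: (pdk_sub (Q := shorter n) (P := shorter n.+1)).
  by move=> u; rewrite /shorter => /ltnW.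
apply: (pdk_boolean_moments power_boolean).
  move=> s; apply: (@comp_star _ _ (size s)) => // [t|t _].
    exact: moments_star.
  exact: tau_moments_star.
apply: (pdk_sub (P := predT)) => //.
apply: pdk_add; first exact: tau_kernel.
exact: pdk_cp beta_cp tau_kernel.
Qed.

End Power.
End Positivity.

(** * Growth of moments *)

Section CauchySchwarz.
Variables (R : realType) (B : cstarAlgType R).

(** Positivity at the points [x] and [y] with the coefficients [- K x y / N] and 1, where
    [N] exceeds the norm of [K x x]. *)
Lemma pdk_cauchy_schwarz (T : Type) (P : pred T) (K : T -> T -> B) x y :
  pdk P K -> P x -> P y -> cnorm (K x y) ^+ 2 <= cnorm (K x x) * cnorm (K y y).
Proof.
move=> hK px py; set a := K x y; have ha := pdk_herm hK px py; rewrite -/a in ha.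
have bd (N : R) : cnorm (K x x) < N -> cnorm a ^+ 2 <= N * cnorm (K y y).
  move=> hN; have N0 : 0 < N by exact: le_lt_trans (cnorm_ge0 _) hN.
  have h1 : psd (star a * (N%:B - K x x) * a).
    apply: psd_conj; apply: psd_sub_norm; last exact: ltW.
    exact/psd_sa/(pdk_diag hK).
  have := hK [:: (x, - ((N^-1)%:C *: a)); (y, 1)].
  rewrite /= px py => /(_ isT); rewrite !big_cons !big_nil /= !addr0.
  rewrite star1 mul1r !mulr1 mul1r starN starZr -/a -ha.
  move=> /psdD/(_ (psdZ _ h1)) => /(_ (N^-1 * N^-1)).
  have Ni : 0 <= N^-1 by rewrite invr_ge0 ltW.
  move=> /(_ (mulr_ge0 Ni Ni)).
  set u := star a * K x x * a; set v := star a * a; set k := K y y.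
  have -> : - ((N^-1)%:C *: star a) * K x x * - ((N^-1)%:C *: a) = (N^-1 * N^-1)%:C *: u.
    by rewrite mulrN !mulNr opprK -!scalerAl -scalerAr scaleRA.
  have -> : - ((N^-1)%:C *: star a) * a = - ((N^-1)%:C *: v) by rewrite mulNr -scalerAl.
  have -> : star a * - ((N^-1)%:C *: a) = - ((N^-1)%:C *: v) by rewrite mulrN -scalerAr.
  have -> : (N^-1 * N^-1)%:C *: (star a * (N%:B - K x x) * a) =
      (N^-1)%:C *: v - (N^-1 * N^-1)%:C *: u.
    rewrite mulrBr mulrBl mulr_scal -scalerAl scalerBr scaleRA -mulrA mulVf ?gt_eqF //.
    by rewrite mulr1.
  move=> h2; have h3 : psd (k - (N^-1)%:C *: v).
    move: h2; congr psd; set w := _ *: u; set z := _ *: v; abel.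
  have := psd_norm_le (psdZ Ni (psd_starM a)) h3.
  by rewrite cnormZ_ge0 // cnorm_starM mulrC ler_pdivrMr // mulrC.
rewrite leNgt; apply/negP => lt.
set k := cnorm (K y y) in lt bd; have k0 : 0 <= k by exact: cnorm_ge0.
set d := cnorm (K x x) in lt bd.
(* exceeds [d] by so little that the bound still fails *)
have := bd (d + (cnorm a ^+ 2 - d * k) / (2 * (k + 1))).
have e0 : 0 < (cnorm a ^+ 2 - d * k) / (2 * (k + 1)).
  by rewrite divr_gt0 ?subr_gt0 // mulr_gt0 // ltr_wpDl.
rewrite ltrDl e0 => /(_ isT); rewrite mulrDl leNgt; apply/negP.
rewrite negbK -ltrBrDl mulrAC ltr_pdivrMr ?mulr_gt0 // ?ltr_wpDl //.
rewrite ltr_pM2l ?subr_gt0 //; lra.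
Qed.

End CauchySchwarz.

Section BoundedMaps.
Variables (R : realType) (A B : cstarAlgType R).

(** Schwarz's inequality makes completely positive maps bounded. *)
Lemma cp_bounded (L : {linear A -> B}) :
  pdk predT (fun x y : A => L (star x * y)) ->
  forall x, cnorm (L x) <= cnorm (L 1) * cnorm x.
Proof.
move=> hL x; have h := pdk_cauchy_schwarz (x := 1) (y := x) hL isT isT.
rewrite star1 !mul1r in h.
have p1 : psd (L 1) by have := pdk_diag (x := 1) hL isT; rewrite star1 mul1r.
have h2 : cnorm (L (star x * x)) <= cnorm x ^+ 2 * cnorm (L 1).
  have [s [ps es _]] : exists s, [/\ psd s, s ^+ 2 = (cnorm x ^+ 2)%:B - star x * x
      & forall z, GRing.comm z ((cnorm x ^+ 2)%:B - star x * x) -> GRing.comm z s].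
    by apply: csqrt; apply: psd_sub_norm; [exact/psd_sa/psd_starM | rewrite cnorm_starM].
  have := pdk_diag (x := s) hL isT; rewrite psd_sa // -expr2 es linearB linearZ /= => h3.
  have := psd_norm_le (pdk_diag (x := x) hL isT) h3.
  by rewrite cnormZ_ge0 // exprn_ge0 ?cnorm_ge0.
have h3 : cnorm (L x) ^+ 2 <= (cnorm (L 1) * cnorm x) ^+ 2.
  apply: le_trans h _; rewrite exprMn expr2 -mulrA ler_wpM2l ?cnorm_ge0 //.
  by rewrite mulrC.
by rewrite -(ler_pXn2r (n := 2)) ?nnegrE ?mulr_ge0 ?cnorm_ge0.
Qed.

End BoundedMaps.

Section Growth.
Variables (R : realType) (B : cstarAlgType R).
Implicit Types (b x : B) (s : seq B) (f m K : seq B -> B).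

Definition norms s : R := \prod_(x <- s) cnorm x.

Lemma norms_ge0 s : 0 <= norms s.
Proof. by apply: prodr_ge0 => x _; exact: cnorm_ge0. Qed.

Lemma norms_cons b s : norms (b :: s) = cnorm b * norms s.
Proof. exact: big_cons. Qed.

Lemma norms_cat s t : norms (s ++ t) = norms s * norms t.
Proof. exact: big_cat. Qed.

Definition geometric f : Prop :=
  exists A c : R, [/\ 0 < A, 0 < c & forall s, cnorm (f s) <= A * (c ^+ size s * norms s)].

Lemma sum_splits_size (G : nat -> nat -> R) s :
  \sum_(p <- splits s) G (size p.1) (size p.2) = \sum_(i < (size s).+1) G i (size s - i)%N.
Proof.
elim: s G => [|b s IH] G; first by rewrite sum_splits_nil big_ord1.
by rewrite sum_splits_cons /= (IH (fun i j => G i.+1 j)) [RHS]big_ord_recl subn0.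
Qed.

Lemma sum_splits_norms (f g : seq B -> R) (a c : nat -> R) s :
  (forall n, 0 <= a n) ->
  (forall t, 0 <= g t) ->
  (forall t, (size t <= size s)%N -> f t <= a (size t) * norms t) ->
  (forall t, (size t <= size s)%N -> g t <= c (size t) * norms t) ->
  \sum_(p <- splits s) f p.1 * g p.2 <=
  (\sum_(i < (size s).+1) a i * c (size s - i)%N) * norms s.
Proof.
move=> a0 g0 hf hg; rewrite -(sum_splits_size (fun i j => a i * c j)) mulr_suml.
rewrite big_seq [leRHS]big_seq; apply: ler_sum => p hp.
have -> : norms s = norms p.1 * norms p.2 by rewrite -norms_cat (splits_cat hp).
rewrite mulrACA.
have h1 : (size p.1 <= size s)%N by rewrite -ltnS (splits_sizel hp).
have h2 : (size p.2 <= size s)%N by rewrite -ltnS (splits_sizer hp).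
apply: (@le_trans _ _ (a (size p.1) * norms p.1 * g p.2)).
  by rewrite ler_wpM2r // hf.
by rewrite ler_wpM2l ?hg // mulr_ge0 // norms_ge0.
Qed.

(** ** From moments to Boolean cumulants *)

(** Solving the recursion for the term of full length [n]: the moment and the other
    terms contribute [1 + (1 + 2 + .. + 2^(n-1)) = 2^n] times the geometric rate. *)
Lemma boolean_cumulants_bound m K (c : R) : boolean_moments m K -> 0 < c ->
  (forall b s, cnorm (m (b :: s)) <= cnorm b * (c ^+ size s * norms s)) ->
  forall s, cnorm (K s) <= c * ((2 * c) ^+ size s * norms s).
Proof.
move=> hm c0 hc s; have [m0 mE] := hm.
have [n] := ubnP (size s); elim: n s => // n IH s hs.
have e : K s = m (1 :: s ++ [:: 1]) -
    \sum_(p <- splits s | (size p.1 < size s)%N) K p.1 * m (p.2 ++ [:: 1]).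
  rewrite mE mul1r.
  have -> : delta (s ++ [:: 1]) = 0 by case: (s).
  rewrite add0r /conv sum_splits_mid sum_splits_nil /= m0 mulr0 addr0.
  by rewrite sum_splits_last /= (boolean_moments1 _ hm) mulr1 addrK.
rewrite e; apply: le_trans (cnormB _ _) _.
have h1 : cnorm (m (1 :: s ++ [:: 1])) <= c ^+ (size s).+1 * norms s.
  apply: le_trans (hc _ _) _; rewrite cnorm1 mul1r size_cat addn1 norms_cat.
  by rewrite norms_cons cnorm1 /norms big_nil !mulr1.
have h2 : cnorm (\sum_(p <- splits s | (size p.1 < size s)%N) K p.1 * m (p.2 ++ [:: 1])) <=
    \sum_(p <- splits s | (size p.1 < size s)%N)
      c * ((2 * c) ^+ size p.1 * c ^+ size p.2) * norms s.
  apply: le_trans (cnorm_sum _ _ _) _.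
  rewrite big_seq_cond [leRHS]big_seq_cond; apply: ler_sum => p /andP[hp lt].
  apply: le_trans (cnormM _ _) _.
  have h3 := IH p.1 (leq_trans lt hs).
  have h4 : cnorm (m (p.2 ++ [:: 1])) <= c ^+ size p.2 * norms p.2.
    have sp := splits_size hp; case ep : p.2 => [|d u].
      by move: sp lt; rewrite ep addn0 => ->; rewrite ltnn.
    rewrite /=; apply: le_trans (hc _ _) _.
    rewrite size_cat addn1 norms_cat !norms_cons cnorm1 /norms big_nil !mulr1.
    by rewrite mulrCA.
  have -> : norms s = norms p.1 * norms p.2 by rewrite -norms_cat (splits_cat hp).
  apply: le_trans (ler_pM (cnorm_ge0 _) (cnorm_ge0 _) h3 h4) _.
  by rewrite le_eqVlt; apply/orP; left; apply/eqP; ring.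
apply: le_trans (lerD h1 h2) _; rewrite -mulr_suml -mulrDl mulrA ler_wpM2r ?norms_ge0 //.
have -> : \sum_(p <- splits s | (size p.1 < size s)%N) c * ((2 * c) ^+ size p.1 * c ^+ size p.2)
   = \sum_(i < size s) c * ((2 * c) ^+ i * c ^+ (size s - i)).
  have := sum_splits_size (fun i j => c * ((2 * c) ^+ i * c ^+ j)) s.
  by rewrite sum_splits_last big_ord_recr /= subnn [RHS]addrC => /addrI.
have -> : \sum_(i < size s) c * ((2 * c) ^+ i * c ^+ (size s - i)) =
    c ^+ (size s).+1 * \sum_(i < size s) 2 ^+ i.
  rewrite mulr_sumr; apply: eq_bigr => i _; rewrite exprMn exprS.
  have -> : c ^+ size s = c ^+ i * c ^+ (size s - i) by rewrite -exprD subnKC // ltnW.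
  ring.
have g : 1 + \sum_(i < size s) 2 ^+ i = 2 ^+ size s :> R.
  elim: (size s) => [|k IHk]; first by rewrite big_ord0 addr0.
  by rewrite big_ord_recr /= addrA IHk exprS; ring.
by rewrite -[X in X + _]mulr1 -mulrDr g exprS exprMn -mulrA [c ^+ _ * _]mulrC.
Qed.

(** ** A majorant for the recursion of free cumulants *)

(** The left-hand side is a part of the product of two polynomials with nonnegative
    coefficients. *)
Lemma cauchy_product (a c : nat -> R) (z : R) N : 0 <= z ->
  (forall n, 0 <= a n) -> (forall n, 0 <= c n) ->
  \sum_(n < N) z ^+ n * \sum_(i < n.+1) a i * c (n - i)%N <=
  (\sum_(n < N) a n * z ^+ n) * (\sum_(n < N) c n * z ^+ n).
Proof.
move=> z0 a0 c0; pose p := \poly_(i < N) a i; pose q := \poly_(i < N) c i.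
have coef_ge0 n : 0 <= (p * q)`_n.
  rewrite coefM; apply: sumr_ge0 => i _; rewrite !coef_poly.
  by case: ifP => _; case: ifP => _; rewrite ?mulr0 ?mul0r ?mulr_ge0.
rewrite -!horner_poly -/p -/q -hornerM.
rewrite (@horner_coef_wide _ (maxn N (size (p * q)))) ?leq_maxr //.
rewrite (big_ord_widen (maxn N (size (p * q)))
  (fun n => z ^+ n * \sum_(i < n.+1) a i * c (n - i)%N)) ?leq_maxl //.
rewrite big_mkcond; apply: ler_sum => n _; case: ifP => h; last first.
  by rewrite mulr_ge0 ?exprn_ge0.
rewrite mulrC ler_wpM2r ?exprn_ge0 // coefM; apply: ler_sum => i _.
rewrite !coef_poly (leq_ltn_trans (leq_ord i) h) (leq_ltn_trans _ h) //.
exact: leq_subr.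
Qed.

(** The sequences bound [m] and the sums over chunks of products of values of
    [m]; evaluated at a fixed small [z], the partial sums of their generating functions
    stay below constants that the recursion reproduces. *)
Lemma mom_geometric m K (phi : {linear B -> B}) (L : R) :
  0 <= L -> (forall x, cnorm (phi x) <= L * cnorm x) ->
  geometric K -> boolean_moments m (phi \o comp K m) ->
  forall f, geometric f -> geometric (comp f m).
Proof.
move=> L0 hL [A0 [c0 [A00 c00 hK]]] hm f [A1 [c1 [A10 c10 hf]]].
pose A := A0 + A1; pose c := c0 + c1.
have Ap : 0 < A by rewrite addr_gt0.
have cp : 0 < c by rewrite addr_gt0.
have cle (A' c' : R) n (x : R) : 0 < A' -> A' <= A -> 0 < c' -> c' <= c -> 0 <= x ->
    A' * (c' ^+ n * x) <= A * (c ^+ n * x).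
  move=> h1 h2 h3 h4 h5; apply: ler_pM => //; first exact: ltW.
    by rewrite mulr_ge0 // exprn_ge0 // ltW.
  by rewrite ler_wpM2r //; apply: lerXn2r => //; rewrite nnegrE ltW.
have hK' s : cnorm (K s) <= A * (c ^+ size s * norms s).
  apply: le_trans (hK s) (cle _ _ _ _ _ _ _ _ _); rewrite ?norms_ge0 //.
    by rewrite lerDl ltW.
  by rewrite lerDl ltW.
have hf' s : cnorm (f s) <= A * (c ^+ size s * norms s).
  apply: le_trans (hf s) (cle _ _ _ _ _ _ _ _ _); rewrite ?norms_ge0 //.
    by rewrite lerDr ltW.
  by rewrite lerDr ltW.
pose E s : R := comp (fun xs => \prod_(x <- xs) (c * cnorm x)) m s.
have prodE xs : \prod_(x <- xs) (c * cnorm x) = c ^+ size xs * norms xs.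
  by rewrite big_split /= big_const_seq count_predT iter_mulr_1.
have comp_le (g : seq B -> B) s : (forall s, cnorm (g s) <= A * (c ^+ size s * norms s)) ->
    cnorm (comp g m s) <= A * E s.
  move=> hg; apply: le_trans (cnorm_sum _ _ _) _; rewrite mulr_sumr.
  by apply: ler_sum => k _; rewrite prodE.
have E0 s : 0 <= E s.
  apply: sumr_ge0 => k _; apply: prodr_ge0 => x _.
  by rewrite mulr_ge0 ?cnorm_ge0 // ltW.
have E_nil : E [::] = 1 by rewrite /E comp_nil big_nil.
have E_cons b s : E (b :: s) = \sum_(p <- splits s) c * cnorm (m (b :: p.1)) * E p.2.
  rewrite /E comp_cons; apply: eq_bigr => p _; rewrite /comp mulr_sumr.
  by apply: eq_bigr => k _; rewrite /= big_cons.
have [m0 mE] := hm.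
pose A' := L * A; have A'0 : 0 <= A' by rewrite mulr_ge0 // ltW.
have m_cons b s : cnorm (m (b :: s)) <=
    cnorm b * ((s == [::])%:R + A' * \sum_(p <- splits s) E p.1 * cnorm (m p.2)).
  rewrite mE; apply: le_trans (cnormM _ _) _; rewrite ler_wpM2l ?cnorm_ge0 //.
  apply: le_trans (cnormD _ _) _; apply: lerD.
    by case: s => [|? ?]; rewrite /delta ?cnorm1 ?cnorm0.
  apply: le_trans (cnorm_sum _ _ _) _; rewrite mulr_sumr; apply: ler_sum => p _.
  apply: le_trans (cnormM _ _) _; rewrite mulrA ler_wpM2r ?cnorm_ge0 //=.
  apply: le_trans (hL _) _; rewrite /A' -mulrA ler_wpM2l //.
  exact: comp_le.
(* [T] and 2 are the bounds for the two generating functions at [z]: the choice of [z]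
   makes [z (1 + 2 A' T)] equal to [T], and that of [T] makes [1 + 2 c T] equal to 2 *)
pose T := (2 * c)^-1; have T0 : 0 < T by rewrite invr_gt0 mulr_gt0.
pose z := T / (1 + 2 * A' * T).
have den : 0 < 1 + 2 * A' * T by rewrite ltr_wpDr // !mulr_ge0 // ltW.
have z0 : 0 < z by rewrite divr_gt0.
have zT : z * (1 + 2 * A' * T) = T by rewrite divfK // gt_eqF.
pose good n (t e : nat -> R) := [/\ (forall k, 0 <= t k), (forall k, 0 <= e k),
  (forall N, \sum_(k < N) t k * z ^+ k <= T), (forall N, \sum_(k < N) e k * z ^+ k <= 2)
  & forall s, (size s < n)%N -> cnorm (m s) <= t (size s) * norms s /\ E s <= e (size s) * norms s].
have ex n : exists t e, good n t e.
  elim: n => [|n [t [e [t0 e0 tT e2 bd]]]].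
    exists (fun=> 0), (fun=> 0); split=> // N.
      by rewrite big1 ?ltW // => i _; rewrite mul0r.
    by rewrite big1 // => i _; rewrite mul0r.
  pose t' k := if k is j.+1 then (j == 0%N)%:R + A' * \sum_(i < j.+1) e i * t (j - i)%N else 0.
  pose e' k := if k is j.+1 then c * \sum_(i < j.+1) t' i.+1 * e (j - i)%N else 1.
  have t'0 k : 0 <= t' k.
    case: k => //= j; rewrite addr_ge0 // mulr_ge0 //.
    by apply: sumr_ge0 => i _; rewrite mulr_ge0.
  have e'0 k : 0 <= e' k.
    case: k => // j; rewrite /e' mulr_ge0 ?(ltW cp) //.
    by apply: sumr_ge0 => i _; rewrite mulr_ge0 // t'0.
  have t'T N : \sum_(k < N) t' k * z ^+ k <= T.
    case: N => [|N]; first by rewrite big_ord0 ltW.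
    rewrite big_ord_recl mul0r add0r /=.
    have -> : \sum_(i < N) ((i == 0 :> nat)%:R + A' * \sum_(i0 < i.+1) e i0 * t (i - i0)%N) * z ^+ i.+1
      = z * \sum_(i < N) ((i == 0 :> nat)%:R * z ^+ i) +
        z * A' * \sum_(i < N) z ^+ i * \sum_(i0 < i.+1) e i0 * t (i - i0)%N.
      by rewrite !mulr_sumr -big_split; apply: eq_bigr => i _ /=; rewrite exprS; ring.
    rewrite -zT mulrDr; apply: lerD.
      rewrite ler_wpM2l ?(ltW z0) //; case: N => [|N]; first by rewrite big_ord0.
      by rewrite big_ord_recl big1 ?addr0 ?mulr1 // => i _; rewrite mul0r.
    rewrite -mulrA (_ : 2 * A' * T = A' * (2 * T)); last by ring.
    rewrite ler_wpM2l ?(ltW z0) // ler_wpM2l //.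
    apply: le_trans (cauchy_product N (ltW z0) e0 t0) _.
    apply: ler_pM => //; apply: sumr_ge0 => i _; by rewrite mulr_ge0 // exprn_ge0 // ltW.
  have e'2 N : \sum_(k < N) e' k * z ^+ k <= 2.
    case: N => [|N]; first by rewrite big_ord0.
    rewrite big_ord_recl mulr1 /=.
    pose u k := t' k.+1 * z.
    have -> : \sum_(i < N) c * (\sum_(i0 < i.+1) t' i0.+1 * e (i - i0)%N) * z ^+ i.+1 =
       c * \sum_(i < N) z ^+ i * \sum_(i0 < i.+1) u i0 * e (i - i0)%N.
      rewrite mulr_sumr; apply: eq_bigr => i _; rewrite exprS -mulrA; congr (_ * _).
      by rewrite mulr_suml mulr_sumr; apply: eq_bigr => j _; rewrite /u; ring.
    have hu : \sum_(i < N) u i * z ^+ i <= T.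
      apply: le_trans (t'T N.+1); rewrite big_ord_recl mul0r add0r.
      by apply: ler_sum => i _; rewrite /u -mulrA -exprS; exact: lexx.
    have := cauchy_product N (ltW z0) (a := u) (c := e) _ e0.
    have u0 k : 0 <= u k by rewrite mulr_ge0 // ltW.
    move=> /(_ u0) h.
    have h2 : (\sum_(i < N) u i * z ^+ i) * (\sum_(i < N) e i * z ^+ i) <= T * 2.
      by apply: ler_pM => //; apply: sumr_ge0 => i _; rewrite mulr_ge0 // exprn_ge0 // ltW.
    have h3 : c * (T * 2) = 1 by rewrite /T; field; rewrite gt_eqF.
    have := ler_wpM2l (ltW cp) (le_trans h h2); rewrite h3; lra.
  have bt s : (size s < n.+1)%N -> cnorm (m s) <= t' (size s) * norms s.
    case: s => [|b s] hs; first by rewrite m0 cnorm0 mul0r.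
    apply: le_trans (m_cons b s) _; rewrite norms_cons /= mulrCA ler_wpM2l ?cnorm_ge0 // mulrDl.
    apply: lerD; first by case: s {hs} => [|? ?]; rewrite /norms ?big_nil ?mulr1 ?mul0r.
    rewrite -[leRHS]mulrA ler_wpM2l //.
    apply: (@sum_splits_norms E (fun s => cnorm (m s)) e t) => // u hu.
      by case: (bd u (leq_ltn_trans hu hs)).
    by case: (bd u (leq_ltn_trans hu hs)).
  exists t', e'; split=> // s hs; split; first exact: bt.
  case: s hs => [|b s] hs; first by rewrite E_nil /= mul1r /norms big_nil.
  rewrite E_cons norms_cons /=.
  have -> : \sum_(p <- splits s) c * cnorm (m (b :: p.1)) * E p.2 =
     c * \sum_(p <- splits s) cnorm (m (b :: p.1)) * E p.2.
    by rewrite mulr_sumr; apply: eq_bigr => p _; rewrite mulrA.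
  rewrite -mulrA ler_wpM2l ?(ltW cp) // mulrCA mulrA mulr_sumr.
  under [X in _ <= X * _]eq_bigr do rewrite mulrA.
  apply: (@sum_splits_norms (fun u => cnorm (m (b :: u))) E (fun k => cnorm b * t' k.+1) e) => //.
  - by move=> k; rewrite mulr_ge0 ?cnorm_ge0.
  - move=> u hu; apply: le_trans (bt (b :: u) _) _; last by rewrite norms_cons mulrCA mulrA.
    by rewrite /= ltnS (leq_ltn_trans hu).
  - by move=> u hu; case: (bd u (leq_ltn_trans hu hs)).
exists (A * 2), z^-1; split; rewrite ?mulr_gt0 ?invr_gt0 // => s.
apply: le_trans (comp_le f s hf') _.
rewrite -mulrA ler_wpM2l ?(ltW Ap) //.
have [t [e [_ e0 _ e2 bd]]] := ex (size s).+1.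
have [_ h] := bd s (ltnSn _); apply: le_trans h _.
rewrite mulrA ler_wpM2r ?norms_ge0 //.
have := e2 (size s).+1; rewrite big_ord_recr /= => h2.
have h3 : 0 <= \sum_(i < size s) e i * z ^+ i.
  by apply: sumr_ge0 => i _; rewrite mulr_ge0 // exprn_ge0 // ltW.
rewrite exprVn ler_pdivlMr ?exprn_gt0 //; lra.
Qed.

End Growth.

(** * Completion of a C*-seminorm *)

Section RealLimits.
Variable R : realType.
Implicit Types (x y : nat -> R) (l k e : R).

Definition tendsR x l : Prop :=
  forall e, 0 < e -> exists N, forall n, (N <= n)%N -> `|x n - l| < e.

Lemma tendsR_cauchy x :
  (forall e, 0 < e -> exists N, forall m n, (N <= m)%N -> (N <= n)%N -> `|x m - x n| < e) ->
  exists l, tendsR x l.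
Proof.
move=> hx; pose S := [set y | exists N, forall n, (N <= n)%N -> y <= x n]%classic.
have hS : has_sup S.
  have [N hN] := hx 1 ltr01; split.
    exists (x N - 1), N => n hn.
    by have := hN _ _ (leqnn N) hn; rewrite ltr_norml; lra.
  exists (x N + 1) => y [M hM].
  have := hN _ _ (leqnn N) (leq_maxl N M); have := hM _ (leq_maxr N M).
  by rewrite ltr_norml; lra.
exists (sup S) => e e0; have e2 : 0 < e / 2 by lra.
have [N hN] := hx _ e2; exists N => n hn.
have h1 : sup S <= x n + e / 2.
  apply: ge_sup; first exact: hS.1.
  move=> y [M hM]; have := hN _ _ hn (leq_trans hn (leq_maxl n M)).
  have := hM _ (leq_maxr n M); rewrite ltr_norml; lra.
have h2 : x n - e / 2 <= sup S.
  apply: ub_le_sup; first exact: hS.2.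
  by exists n => m hm; have := hN _ _ hn (leq_trans hn hm); rewrite ltr_norml; lra.
rewrite ltr_norml; lra.
Qed.

Lemma tendsR_le x y l k : tendsR x l -> tendsR y k -> (forall n, x n <= y n) -> l <= k.
Proof.
move=> hx hy h; rewrite leNgt; apply/negP => lt.
have e0 : 0 < (l - k) / 2 by lra.
have [N hN] := hx _ e0; have [M hM] := hy _ e0.
have := hN _ (leq_maxl N M); have := hM _ (leq_maxr N M); have := h (maxn N M).
rewrite !ltr_norml; lra.
Qed.

Lemma tendsR_uniq x l k : tendsR x l -> tendsR x k -> l = k.
Proof.
by move=> h1 h2; apply/eqP; rewrite eq_le (tendsR_le h1 h2) ?(tendsR_le h2 h1).
Qed.

Lemma tendsR_cst l : tendsR (fun=> l) l.
Proof. by move=> e e0; exists 0%N => n _; rewrite subrr normr0. Qed.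

Lemma tendsRD x y l k : tendsR x l -> tendsR y k -> tendsR (fun n => x n + y n) (l + k).
Proof.
move=> hx hy e e0; have e2 : 0 < e / 2 by lra.
have [N hN] := hx _ e2; have [M hM] := hy _ e2; exists (maxn N M) => n.
rewrite geq_max => /andP[/hN h1 /hM h2]; move: h1 h2; rewrite !ltr_norml; lra.
Qed.

Lemma tendsRM x y l k : tendsR x l -> tendsR y k -> tendsR (fun n => x n * y n) (l * k).
Proof.
move=> hx hy e e0; pose c := `|l| + `|k| + 1.
have c0 : 0 < c by rewrite ltr_wpDl ?addr_ge0.
pose d := Num.min 1 (e / c).
have d0 : 0 < d by rewrite lt_min ltr01 divr_gt0.
have [N hN] := hx _ d0; have [M hM] := hy _ d0; exists (maxn N M) => n.
rewrite geq_max => /andP[/hN h1 /hM h2].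
have -> : x n * y n - l * k = (x n - l) * (y n - k) + ((x n - l) * k + l * (y n - k)) by ring.
have d1 : d <= 1 by rewrite ge_min lexx.
have d2 : d * c <= e by rewrite -ler_pdivlMr // ge_min lexx orbT.
have h3 : `|(x n - l) * (y n - k)| < d.
  rewrite normrM; apply: le_lt_trans h1; rewrite -{2}[`|x n - l|]mulr1 ler_wpM2l //.
  exact: le_trans (ltW h2) d1.
apply: le_lt_trans (ler_normD _ _) _; apply: lt_le_trans d2.
have -> : d * c = d * (`|l| + `|k|) + d by rewrite /c; move: (d) => d'; ring.
rewrite addrC; apply: ler_ltD => //.
apply: le_trans (ler_normD _ _) _; rewrite !normrM mulrDr addrC; apply: lerD.
  by rewrite mulrC ler_wpM2r // ltW.
by rewrite ler_wpM2r // ltW.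
Qed.

End RealLimits.

(** Bundling the axioms lets the structures of the completion be inferred from its
    type, which depends on the seminorm. *)
Record cseminorm (R : realType) := CSeminorm {
  cs_alg : algType R[i];
  pnorm : cs_alg -> R;
  pstar : cs_alg -> cs_alg;
  pnormD : forall x y, pnorm (x + y) <= pnorm x + pnorm y;
  pnormZ : forall (c : R[i]) x, (pnorm (c *: x))%:C = `|c| * (pnorm x)%:C;
  pnormM : forall x y, pnorm (x * y) <= pnorm x * pnorm y;
  pstarK : forall x, pstar (pstar x) = x;
  pstarD : forall x y, pstar (x + y) = pstar x + pstar y;
  pstarZ : forall (c : R[i]) x, pstar (c *: x) = conjc c *: pstar x;
  pstarM : forall x y, pstar (x * y) = pstar y * pstar x;
  pnorm_starM : forall x, pnorm (pstar x * x) = pnorm x ^+ 2;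
  pnorm1_neq0 : pnorm 1 <> 0
}.

Section Completion.
Variables (R : realType) (p : cseminorm R).
Local Notation A := (cs_alg p).
Local Notation N := (@pnorm R p).
Local Notation st := (@pstar R p).
Implicit Types (x y : A).

Lemma pnormZr (r : R) x : N (r%:C *: x) = `|r| * N x.
Proof.
have := pnormZ r%:C x; rewrite normc_def /= expr0n addr0 sqrtr_sqr -rmorphM /=.
by case.
Qed.

Lemma pnorm0 : N 0 = 0.
Proof. by have := pnormZr 0 0; rewrite scaler0 normr0 mul0r. Qed.

Lemma pnormN x : N (- x) = N x.
Proof.
by have := pnormZr (-1) x; rewrite rmorphN rmorph1 scaleN1r normrN1 mul1r.
Qed.

Lemma pnorm_ge0 x : 0 <= N x.
Proof. by have := pnormD x (- x); rewrite subrr pnorm0 pnormN -mulr2n pmulrn_lge0. Qed.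

Lemma pdistC x y : N (x - y) = N (y - x).
Proof. by rewrite -opprB pnormN. Qed.

Lemma pnorm_dist x y : `|N x - N y| <= N (x - y).
Proof.
have h1 := pnormD (x - y) y; have h2 := pnormD (y - x) x; rewrite !subrK in h1 h2.
by rewrite pdistC in h2; rewrite ler_norml; lra.
Qed.

Lemma pnorm_star x : N (st x) = N x.
Proof.
have le y : N y <= N (st y).
  have [->|y0] := eqVneq (N y) 0; first exact: pnorm_ge0.
  rewrite -(@ler_pM2r _ (N y)) ?lt_def ?y0 ?pnorm_ge0 //.
  by rewrite -expr2 -pnorm_starM pnormM.
by apply/eqP; rewrite eq_le le -{2}(pstarK x) le.
Qed.

Lemma norm_real (c : R[i]) : exists2 r : R, 0 <= r & `|c| = r%:C.
Proof. by exists (Num.sqrt (complex.Re c ^+ 2 + complex.Im c ^+ 2)); rewrite ?sqrtr_ge0 ?normc_def. Qed.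

Lemma pstarB x y : st (x - y) = st x - st y.
Proof.
have s0 : st 0 = 0 by apply: (@addrI _ (st 0)); rewrite -pstarD !addr0.
rewrite pstarD; congr (_ + _); apply/eqP.
by rewrite -addr_eq0 -pstarD addNr s0.
Qed.

Definition cauchy (u : nat -> A) : Prop := forall e : R, 0 < e ->
  exists n0, forall m n, (n0 <= m)%N -> (n0 <= n)%N -> N (u m - u n) < e.

Record cseq := CSeq { cval :> nat -> A; cvalP : cauchy cval }.
HB.instance Definition _ := gen_eqMixin cseq.
HB.instance Definition _ := gen_choiceMixin cseq.

Lemma cauchy_cst x : cauchy (fun=> x).
Proof. by move=> e e0; exists 0%N => m n _ _; rewrite subrr pnorm0. Qed.

Lemma cauchy_add (u v : cseq) : cauchy (fun n => u n + v n).
Proof.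
move=> e e0; have e2 : 0 < e / 2 by lra.
have [n0 h0] := cvalP u e2; have [n1 h1] := cvalP v e2.
exists (maxn n0 n1) => m n; rewrite !geq_max => /andP[m0 m1] /andP[k0 k1].
rewrite opprD addrACA; apply: le_lt_trans (pnormD _ _) _.
have := h0 _ _ m0 k0; have := h1 _ _ m1 k1; lra.
Qed.

Lemma cauchy_scale (c : R[i]) (u : cseq) : cauchy (fun n => c *: u n).
Proof.
move=> e e0; have [r r0 rc] := norm_real c.
have [n0 h0] := cvalP u (e := e / (r + 1)) ltac:(by rewrite divr_gt0 // ltr_wpDl).
exists n0 => m n hm hn; rewrite -scalerBr.
have -> : N (c *: (u m - u n)) = r * N (u m - u n).
  by apply/complexI; rewrite pnormZ rc rmorphM.
have := h0 _ _ hm hn; rewrite ltr_pdivlMr ?ltr_wpDl //.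
have := pnorm_ge0 (u m - u n); nra.
Qed.

Lemma cauchy_star (u : cseq) : cauchy (fun n => st (u n)).
Proof.
by move=> e /(cvalP u)[n0 h0]; exists n0 => m n hm hn; rewrite -pstarB pnorm_star h0.
Qed.

Lemma cauchy_bounded (u : cseq) : exists2 c : R, 0 < c & exists n0, forall n, (n0 <= n)%N -> N (u n) <= c.
Proof.
have [n0 h0] := cvalP u ltr01; exists (1 + N (u n0)).
  by rewrite ltr_pwDl ?pnorm_ge0.
exists n0 => n hn; have := h0 _ _ hn (leqnn n0).
have := pnormD (u n - u n0) (u n0); rewrite subrK; lra.
Qed.

Lemma cauchy_mul (u v : cseq) : cauchy (fun n => u n * v n).
Proof.
move=> e e0; have [c c0 [n0 hc]] := cauchy_bounded u.
have [d d0 [n1 hd]] := cauchy_bounded v.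
have ec : 0 < e / (2 * c) by rewrite divr_gt0 // mulr_gt0.
have ed : 0 < e / (2 * d) by rewrite divr_gt0 // mulr_gt0.
have [n2 h2] := cvalP u ed; have [n3 h3] := cvalP v ec.
exists (maxn (maxn n0 n1) (maxn n2 n3)) => m n.
rewrite !geq_max => /andP[/andP[a0 a1] /andP[a2 a3]] /andP[/andP[b0 b1] /andP[b2 b3]].
have -> : u m * v m - u n * v n = (u m - u n) * v m + u n * (v m - v n).
  by rewrite mulrBl mulrBr addrA subrK.
apply: le_lt_trans (pnormD _ _) _.
have := pnormM (u m - u n) (v m); have := pnormM (u n) (v m - v n).
have k1 : N (u m - u n) * N (v m) < e / 2.
  apply: (@le_lt_trans _ _ (N (u m - u n) * d)); first by rewrite ler_wpM2l ?pnorm_ge0 ?hd.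
  by have := h2 _ _ a2 b2; rewrite !ltr_pdivlMr ?mulr_gt0 // mulrA [_ * 2]mulrC; lra.
have k2 : N (u n) * N (v m - v n) < e / 2.
  apply: (@le_lt_trans _ _ (c * N (v m - v n))); first by rewrite ler_wpM2r ?pnorm_ge0 ?hc.
  have := h3 _ _ a3 b3; rewrite !ltr_pdivlMr ?mulr_gt0 //; lra.
lra.
Qed.

Definition seq_cst x := CSeq (cauchy_cst x).
Definition seq_add u v := CSeq (cauchy_add u v).
Definition seq_mul u v := CSeq (cauchy_mul u v).
Definition seq_scale c u := CSeq (cauchy_scale c u).
Definition seq_star u := CSeq (cauchy_star u).

Definition null (w : nat -> A) : Prop :=
  forall e : R, 0 < e -> exists n0, forall n, (n0 <= n)%N -> N (w n) < e.

Lemma null_ext w w' : w =1 w' -> null w -> null w'.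
Proof. by move=> h hw e /hw[n0 h0]; exists n0 => n /h0; rewrite h. Qed.

Lemma null0 : null (fun=> 0).
Proof. by move=> e e0; exists 0%N => n _; rewrite pnorm0. Qed.

Lemma null_add w w' : null w -> null w' -> null (fun n => w n + w' n).
Proof.
move=> hw hw' e e0; have e2 : 0 < e / 2 by lra.
have [n0 h0] := hw _ e2; have [n1 h1] := hw' _ e2; exists (maxn n0 n1) => n.
rewrite geq_max => /andP[/h0 h2 /h1 h3]; apply: le_lt_trans (pnormD _ _) _; lra.
Qed.

Lemma null_scale (c : R[i]) w : null w -> null (fun n => c *: w n).
Proof.
move=> hw e e0; have [r r0 rc] := norm_real c.
have [n0 h0] := hw (e / (r + 1)) ltac:(by rewrite divr_gt0 // ltr_wpDl).
exists n0 => n hn; have -> : N (c *: w n) = r * N (w n).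
  by apply/complexI; rewrite pnormZ rc rmorphM.
have := h0 _ hn; rewrite ltr_pdivlMr ?ltr_wpDl //; have := pnorm_ge0 (w n); nra.
Qed.

Lemma null_opp w : null w -> null (fun n => - w n).
Proof. by move=> hw e /hw[n0 h0]; exists n0 => n /h0; rewrite pnormN. Qed.

Lemma null_mull (u : cseq) w : null w -> null (fun n => u n * w n).
Proof.
move=> hw e e0; have [c c0 [n0 hc]] := cauchy_bounded u.
have [n1 h1] := hw _ (divr_gt0 e0 c0); exists (maxn n0 n1) => n.
rewrite geq_max => /andP[/hc h2 /h1]; rewrite ltr_pdivlMr // => h3.
apply: le_lt_trans (pnormM _ _) _; apply: le_lt_trans h3.
by rewrite mulrC ler_wpM2l ?pnorm_ge0.
Qed.

Lemma null_mulr (u : cseq) w : null w -> null (fun n => w n * u n).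
Proof.
move=> hw e e0; have [c c0 [n0 hc]] := cauchy_bounded u.
have [n1 h1] := hw _ (divr_gt0 e0 c0); exists (maxn n0 n1) => n.
rewrite geq_max => /andP[/hc h2 /h1]; rewrite ltr_pdivlMr // => h3.
apply: le_lt_trans (pnormM _ _) _; apply: le_lt_trans h3.
by rewrite ler_wpM2l ?pnorm_ge0.
Qed.

Definition seq_equiv (u v : cseq) : bool := `[< null (fun n => u n - v n) >].

Lemma seq_equiv_refl : reflexive seq_equiv.
Proof. by move=> u; apply/asboolP; apply: null_ext null0 => n; rewrite subrr. Qed.

Lemma seq_equiv_sym : symmetric seq_equiv.
Proof.
by move=> u v; apply/asboolP/asboolP => /null_opp; apply: null_ext => n; rewrite opprB.
Qed.

Lemma seq_equiv_trans : transitive seq_equiv.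
Proof.
move=> v u w /asboolP h1 /asboolP h2; apply/asboolP; apply: null_ext (null_add h1 h2) => n.
by rewrite addrA subrK.
Qed.

Canonical seq_equiv_rel := EquivRel seq_equiv seq_equiv_refl seq_equiv_sym seq_equiv_trans.

Local Open Scope quotient_scope.

Definition compl : Type := {eq_quot seq_equiv_rel}.
HB.instance Definition _ := Choice.on compl.
HB.instance Definition _ := EqQuotient.on compl.

Definition cl (u : cseq) : compl := \pi_compl u.

Lemma complW (K : compl -> Prop) : (forall u, K (cl u)) -> forall P, K P.
Proof. by move=> h P; rewrite -[P]reprK; exact: h. Qed.

Lemma cl_eq (u v : cseq) : null (fun n => u n - v n) -> cl u = cl v.
Proof. by move=> h; apply/eqmodP/asboolP. Qed.

Lemma cl_null (u v : cseq) : cl u = cl v -> null (fun n => u n - v n).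
Proof. by move=> /eqmodP/asboolP. Qed.

Lemma cl_ext (u v : cseq) : (forall n, u n = v n) -> cl u = cl v.
Proof. by move=> h; apply: cl_eq; apply: null_ext null0 => n; rewrite h subrr. Qed.

Lemma repr_null u : null (fun n => repr (cl u) n - u n).
Proof. by apply: cl_null; rewrite /cl reprK. Qed.

Definition cadd (P Q : compl) : compl := cl (seq_add (repr P) (repr Q)).
Definition cmul (P Q : compl) : compl := cl (seq_mul (repr P) (repr Q)).
Definition cscale c (P : compl) : compl := cl (seq_scale c (repr P)).
Definition copp (P : compl) : compl := cscale (-1) P.
Definition cstar (P : compl) : compl := cl (seq_star (repr P)).
Definition cconst x : compl := cl (seq_cst x).

Lemma caddE u v : cadd (cl u) (cl v) = cl (seq_add u v).
Proof.
apply: cl_eq; apply: null_ext (null_add (repr_null u) (repr_null v)) => n /=.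
by rewrite opprD addrACA.
Qed.

Lemma cscaleE c u : cscale c (cl u) = cl (seq_scale c u).
Proof.
by apply: cl_eq; apply: null_ext (null_scale c (repr_null u)) => n /=; rewrite scalerBr.
Qed.

Lemma cmulE u v : cmul (cl u) (cl v) = cl (seq_mul u v).
Proof.
apply: cl_eq; apply: null_ext (null_add (null_mull (repr (cl u)) (repr_null v))
  (null_mulr v (repr_null u))) => n /=.
by rewrite mulrBr mulrBl addrA subrK.
Qed.

Lemma cstarE u : cstar (cl u) = cl (seq_star u).
Proof.
apply: cl_eq => e /(repr_null u)[n0 h0]; exists n0 => n /h0.
by rewrite /= -pstarB pnorm_star.
Qed.

Lemma caddA : associative cadd.
Proof.
elim/complW => u; elim/complW => v; elim/complW => w; rewrite !caddE.
by apply: cl_ext => n /=; rewrite addrA.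
Qed.
Lemma caddC : commutative cadd.
Proof.
elim/complW => u; elim/complW => v; rewrite !caddE.
by apply: cl_ext => n /=; rewrite addrC.
Qed.
Lemma cadd0 : left_id (cconst 0) cadd.
Proof. by elim/complW => u; rewrite caddE; apply: cl_ext => n /=; rewrite add0r. Qed.
Lemma caddN : left_inverse (cconst 0) copp cadd.
Proof.
elim/complW => u; rewrite /copp cscaleE caddE.
by apply: cl_ext => n /=; rewrite scaleN1r addNr.
Qed.

HB.instance Definition _ := GRing.isZmodule.Build compl caddA caddC cadd0 caddN.

Lemma cmulA : associative cmul.
Proof.
elim/complW => u; elim/complW => v; elim/complW => w; rewrite !cmulE.
by apply: cl_ext => n /=; rewrite mulrA.
Qed.
Lemma cmul1 : left_id (cconst 1) cmul.
Proof. by elim/complW => u; rewrite cmulE; apply: cl_ext => n /=; rewrite mul1r. Qed.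
Lemma cmulr1 : right_id (cconst 1) cmul.
Proof. by elim/complW => u; rewrite cmulE; apply: cl_ext => n /=; rewrite mulr1. Qed.
Lemma cmulDl : left_distributive cmul cadd.
Proof.
elim/complW => u; elim/complW => v; elim/complW => w; rewrite !(cmulE, caddE).
by apply: cl_ext => n /=; rewrite mulrDl.
Qed.
Lemma cmulDr : right_distributive cmul cadd.
Proof.
elim/complW => u; elim/complW => v; elim/complW => w; rewrite !(cmulE, caddE).
by apply: cl_ext => n /=; rewrite mulrDr.
Qed.
Lemma cone_neq0 : cconst 1 != cconst 0.
Proof.
apply/eqP => /cl_null h; have n1 : 0 < N 1.
  by rewrite lt_def pnorm_ge0 andbT; apply/eqP; exact: pnorm1_neq0.
by have [n0 /(_ _ (leqnn _))] := h _ n1; rewrite /= subr0 ltxx.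
Qed.

HB.instance Definition _ := GRing.Zmodule_isNzRing.Build compl
  cmulA cmul1 cmulr1 cmulDl cmulDr cone_neq0.

Lemma cscaleA a b P : cscale a (cscale b P) = cscale (a * b) P.
Proof. by elim/complW: P => u; rewrite !cscaleE; apply: cl_ext => n /=; rewrite scalerA. Qed.
Lemma cscale1 : left_id 1 cscale.
Proof. by elim/complW => u; rewrite cscaleE; apply: cl_ext => n /=; rewrite scale1r. Qed.
Lemma cscaleDr : right_distributive cscale +%R.
Proof.
move=> c; elim/complW => u; elim/complW => v; rewrite -[X in cscale c X]/(cadd _ _) -[RHS]/(cadd _ _).
by rewrite !(caddE, cscaleE); apply: cl_ext => n /=; rewrite scalerDr.
Qed.
Lemma cscaleDl P : {morph cscale^~ P : a b / a + b}.
Proof.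
move=> a b; elim/complW: P => u; rewrite -[RHS]/(cadd _ _) !(caddE, cscaleE).
by apply: cl_ext => n /=; rewrite scalerDl.
Qed.

HB.instance Definition _ := GRing.Zmodule_isLmodule.Build R[i] compl
  cscaleA cscale1 cscaleDr cscaleDl.

Lemma cscaleAl (c : R[i]) (P Q : compl) : c *: (P * Q) = (c *: P) * Q.
Proof.
rewrite -[LHS]/(cscale c (cmul P Q)) -[RHS]/(cmul (cscale c P) Q).
elim/complW: P => u; elim/complW: Q => v; rewrite !(cmulE, cscaleE).
by apply: cl_ext => n /=; rewrite scalerAl.
Qed.
HB.instance Definition _ := GRing.Lmodule_isLalgebra.Build R[i] compl cscaleAl.

Lemma cscaleAr (c : R[i]) (P Q : compl) : c *: (P * Q) = P * (c *: Q).
Proof.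
rewrite -[LHS]/(cscale c (cmul P Q)) -[RHS]/(cmul P (cscale c Q)).
elim/complW: P => u; elim/complW: Q => v; rewrite !(cmulE, cscaleE).
by apply: cl_ext => n /=; rewrite scalerAr.
Qed.
HB.instance Definition _ := GRing.Lalgebra_isAlgebra.Build R[i] compl cscaleAr.

(** Along a Cauchy sequence the norms form a Cauchy sequence of reals. *)
Definition qnorm (P : compl) : R := xget 0 [set l | tendsR (fun n => N (repr P n)) l]%classic.

Lemma norm_cauchy (u : cseq) : exists l, tendsR (fun n => N (u n)) l.
Proof.
apply: tendsR_cauchy => e /(cvalP u)[n0 h0]; exists n0 => m n hm hn.
exact: le_lt_trans (pnorm_dist _ _) (h0 _ _ hm hn).
Qed.

Lemma qnormP (u : cseq) : tendsR (fun n => N (u n)) (qnorm (cl u)).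
Proof.
have h : tendsR (fun n => N (repr (cl u) n)) (qnorm (cl u)).
  by rewrite /qnorm; have [l hl] := norm_cauchy (repr (cl u)); apply: xgetPex; exists l.
move=> e e0; have e2 : 0 < e / 2 by lra.
have [n0 h0] := h _ e2; have [n1 h1] := repr_null u e2.
exists (maxn n0 n1) => n; rewrite geq_max => /andP[/h0 k0 /h1 k1].
have := pnorm_dist (repr (cl u) n) (u n); move: k0.
rewrite ltr_norml ler_norml ltr_norml; lra.
Qed.

Lemma qnorm_cconst x : qnorm (cconst x) = N x.
Proof. by apply: (tendsR_uniq (qnormP (seq_cst x))); exact: (@tendsR_cst R (N x)). Qed.

Lemma qnorm_eq0 P : qnorm P = 0 -> P = 0.
Proof.
elim/complW: P => u h; have := qnormP u; rewrite h => h0.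
apply: cl_eq => e e0; have [n0 hn] := h0 _ e0; exists n0 => n /hn.
by rewrite subr0 /= subr0 ger0_norm ?pnorm_ge0.
Qed.

Lemma qnormD (P Q : compl) : qnorm (P + Q) <= qnorm P + qnorm Q.
Proof.
elim/complW: P => u; elim/complW: Q => v; rewrite -[X in qnorm X]/(cadd _ _) caddE.
by apply: tendsR_le (qnormP _) (tendsRD (qnormP _) (qnormP _)) _ => n; exact: pnormD.
Qed.

Lemma qnormZ (c : R[i]) (P : compl) : (qnorm (c *: P))%:C = `|c| * (qnorm P)%:C.
Proof.
elim/complW: P => u; rewrite -[X in qnorm X]/(cscale _ _) cscaleE.
have [r r0 rc] := norm_real c.
rewrite rc -rmorphM; congr (_%:C); apply: tendsR_uniq (qnormP _) _.
have := tendsRM (tendsR_cst (r)) (qnormP u).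
move=> h e /h[n0 h0]; exists n0 => n /h0 /=.
suff -> : N (c *: u n) = r * N (u n) by [].
by apply/complexI; rewrite pnormZ rc rmorphM.
Qed.

Lemma qnormM (P Q : compl) : qnorm (P * Q) <= qnorm P * qnorm Q.
Proof.
elim/complW: P => u; elim/complW: Q => v; rewrite -[X in qnorm X]/(cmul _ _) cmulE.
by apply: tendsR_le (qnormP _) (tendsRM (qnormP _) (qnormP _)) _ => n; exact: pnormM.
Qed.

Lemma cstarK P : cstar (cstar P) = P.
Proof. by elim/complW: P => u; rewrite !cstarE; apply: cl_ext => n /=; rewrite pstarK. Qed.

Lemma cstarD (P Q : compl) : cstar (P + Q) = cstar P + cstar Q.
Proof.
elim/complW: P => u; elim/complW: Q => v.
rewrite -[X in cstar X]/(cadd _ _) -[RHS]/(cadd _ _) !(caddE, cstarE).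
by apply: cl_ext => n /=; rewrite pstarD.
Qed.

Lemma cstarZ (c : R[i]) (P : compl) : cstar (c *: P) = conjc c *: cstar P.
Proof.
elim/complW: P => u; rewrite -[X in cstar X]/(cscale _ _) -[RHS]/(cscale _ _) !(cscaleE, cstarE).
by apply: cl_ext => n /=; rewrite pstarZ.
Qed.

Lemma cstarM (P Q : compl) : cstar (P * Q) = cstar Q * cstar P.
Proof.
elim/complW: P => u; elim/complW: Q => v.
rewrite -[X in cstar X]/(cmul _ _) -[RHS]/(cmul _ _) !(cmulE, cstarE).
by apply: cl_ext => n /=; rewrite pstarM.
Qed.

Lemma qnorm_starM (P : compl) : qnorm (cstar P * P) = qnorm P ^+ 2.
Proof.
elim/complW: P => u; rewrite -[X in qnorm X]/(cmul _ _) cstarE cmulE expr2.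
apply: tendsR_uniq (qnormP _) _; have := tendsRM (qnormP u) (qnormP u).
by move=> h e /h[n0 h0]; exists n0 => n /h0; rewrite /= pnorm_starM expr2.
Qed.

Lemma qnorm_opp (P : compl) : qnorm (- P) = qnorm P.
Proof. by apply/complexI; rewrite -scaleN1r qnormZ normrN1 mul1r. Qed.

Lemma qnorm_dense (P : compl) (e : R) : 0 < e -> exists x, qnorm (P - cconst x) < e.
Proof.
move=> e0; elim/complW: P => u; have e2 : 0 < e / 2 by lra.
have [n0 h0] := cvalP u e2; exists (u n0).
have -> : cl u - cconst (u n0) = cl (seq_add u (seq_scale (-1) (seq_cst (u n0)))).
  by rewrite -[LHS]/(cadd _ (cscale _ _)) cscaleE caddE.
apply: (@le_lt_trans _ _ (e / 2)); last by lra.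
have h := qnormP (seq_add u (seq_scale (-1) (seq_cst (u n0)))).
rewrite leNgt; apply/negP => lt; have d0 : 0 < qnorm (cl (seq_add u (seq_scale (-1) (seq_cst (u n0))))) - e / 2 by lra.
have [n1 h1] := h _ d0; have := h1 _ (leq_maxr n0 n1); rewrite /= scaleN1r.
have := h0 _ _ (leq_maxl n0 n1) (leqnn n0); rewrite ltr_norml; lra.
Qed.

Lemma qnorm_tri (P Q S : compl) : qnorm (P - S) <= qnorm (P - Q) + qnorm (Q - S).
Proof. by have := qnormD (P - Q) (Q - S); rewrite addrA subrK. Qed.

Lemma qdistC (P Q : compl) : qnorm (P - Q) = qnorm (Q - P).
Proof. by rewrite -opprB qnorm_opp. Qed.

Lemma cconstB x y : cconst x - cconst y = cconst (x - y).
Proof.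
rewrite -[LHS]/(cadd _ (cscale _ _)) /cconst cscaleE caddE.
by apply: cl_ext => n /=; rewrite scaleN1r.
Qed.

(** Each term is within [1 / (k + 1)] of a constant sequence [x k], and the sequence [x]
    represents the limit. *)
Lemma qnorm_complete (u : nat -> compl) :
  (forall e : R, 0 < e ->
     exists n0, forall m n, (n0 <= m)%N -> (n0 <= n)%N -> qnorm (u m - u n) < e) ->
  exists l : compl, forall e : R, 0 < e ->
     exists n0, forall n, (n0 <= n)%N -> qnorm (u n - l) < e.
Proof.
move=> hu; have hx k : exists x, qnorm (u k - cconst x) < k.+1%:R^-1.
  by apply: qnorm_dense; rewrite invr_gt0 ltr0n.
have [x xP] := choice hx.
have small (e : R) : 0 < e -> exists n0, forall n, (n0 <= n)%N -> n.+1%:R^-1 < e.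
  move=> e0; exists (Num.bound e^-1) => n hn.
  rewrite -[e]invrK ltf_pV2 ?posrE ?ltr0n ?invr_gt0 //.
  apply: (@lt_le_trans _ _ (Num.bound e^-1)%:R); first by rewrite archi_boundP // invr_ge0 ltW.
  by rewrite ler_nat leqW.
have cx : cauchy x.
  move=> e e0; have e3 : 0 < e / 3 by lra.
  have [n0 h0] := hu _ e3; have [n1 h1] := small _ e3.
  exists (maxn n0 n1) => m n; rewrite !geq_max => /andP[m0 m1] /andP[k0 k1].
  rewrite -qnorm_cconst -cconstB.
  have := qnorm_tri (cconst (x m)) (u m) (cconst (x n)).
  have := qnorm_tri (u m) (u n) (cconst (x n)).
  have := lt_trans (xP m) (h1 _ m1); have := lt_trans (xP n) (h1 _ k1).
  rewrite (qdistC (cconst (x m)) (u m)); have := h0 _ _ m0 k0; lra.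
exists (cl (CSeq cx)) => e e0; have e2 : 0 < e / 2 by lra.
have [n0 h0] := cx _ e2; have [n1 h1] := small _ e2.
exists (maxn n0 n1) => n; rewrite geq_max => /andP[k0 k1].
apply: le_lt_trans (qnorm_tri _ (cconst (x n)) _) _.
have h2 : qnorm (cconst (x n) - cl (CSeq cx)) <= e / 2.
  have -> : cconst (x n) - cl (CSeq cx) = cl (seq_add (seq_cst (x n)) (seq_scale (-1) (CSeq cx))).
    by rewrite -[LHS]/(cadd _ (cscale _ _)) cscaleE caddE.
  set w := seq_add _ _; rewrite leNgt; apply/negP => lt.
  have d0 : 0 < qnorm (cl w) - e / 2 by lra.
  have [n2 h2] := qnormP w d0; have := h2 _ (leq_maxr n0 n2); rewrite /= scaleN1r.
  have := h0 _ _ k0 (leq_maxl n0 n2); rewrite ltr_norml; lra.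
have := lt_trans (xP n) (h1 _ k1); lra.
Qed.

HB.instance Definition _ := Algebra_isCStar.Build R compl
  qnorm_eq0 qnormD qnormZ qnormM qnorm_complete cstarK cstarD cstarZ cstarM qnorm_starM.

Lemma cconst_linear : linear cconst.
Proof.
move=> c x y; rewrite -[RHS]/(cadd (cscale _ _) _) /cconst cscaleE caddE.
exact: cl_ext.
Qed.

Lemma cconst_mul : monoid_morphism cconst.
Proof.
split=> // x y; rewrite -[RHS]/(cmul _ _) /cconst cmulE; exact: cl_ext.
Qed.

HB.instance Definition _ := GRing.isLinear.Build R[i] A compl _ cconst cconst_linear.
HB.instance Definition _ := GRing.isMonoidMorphism.Build A compl cconst cconst_mul.

Theorem cstar_completion : exists (M : cstarAlgType R) (j : {lrmorphism A -> M}),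
  [/\ forall x, cnorm (j x) = N x, forall x, star (j x) = j (st x)
    & forall (P : M) (e : R), 0 < e -> exists x, cnorm (P - j x) < e].
Proof.
exists (compl : cstarAlgType R), (cconst : {lrmorphism A -> compl}); split.
- exact: qnorm_cconst.
- by move=> x; rewrite -[LHS]/(cstar _) /cconst cstarE; exact: cl_ext.
- exact: qnorm_dense.
Qed.

End Completion.

(** * The Gelfand-Naimark-Segal construction *)

Section Extension.
Variables (R : realType) (p : cseminorm R) (M B : cstarAlgType R).
Variables (j : {lrmorphism cs_alg p -> M}) (L : {linear cs_alg p -> B}).
Hypothesis j_isometric : forall x, cnorm (j x) = pnorm x.
Hypothesis j_dense : forall (P : M) (e : R), 0 < e -> exists x, cnorm (P - j x) < e.
Hypothesis L_contractive : forall x, cnorm (L x) <= pnorm x.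

Lemma dense_seq (P : M) : exists u : nat -> cs_alg p, tends (fun n => j (u n)) P.
Proof.
have h (n : nat) : exists x, cnorm (P - j x) < (n.+1%:R^-1 : R).
  by apply: j_dense; rewrite invr_gt0 ltr0n.
have [u hu] := choice h; exists u => e e0.
have [n0 h0] := tends_invn (0 : M) 1 e0; exists n0 => n hn.
have := h0 _ hn; rewrite add0r subr0 cnorm_scal ger0_norm ?invr_ge0 ?ler0n //.
by apply: lt_trans; rewrite cdistC.
Qed.

(** The limit does not depend on the sequence chosen, as [L] is a contraction. *)
Lemma extension : exists E : {linear M -> B},
  forall (u : nat -> cs_alg p) P, tends (fun n => j (u n)) P -> tends (fun n => L (u n)) (E P).
Proof.
have h P : exists l, forall u : nat -> cs_alg p,
    tends (fun n => j (u n)) P -> tends (fun n => L (u n)) l.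
  have [v hv] := dense_seq P.
  have dist (u : nat -> cs_alg p) : tends (fun n => j (u n)) P ->
      forall e : R, 0 < e -> exists n0, forall m n, (n0 <= m)%N -> (n0 <= n)%N ->
      cnorm (L (u m) - L (v n)) < e.
    move=> hu e e0; have e2 : 0 < e / 2 by lra.
    have [n0 h0] := hu _ e2; have [n1 h1] := hv _ e2; exists (maxn n0 n1) => m n.
    rewrite !geq_max => /andP[/h0 k0 _] /andP[_ /h1 k1].
    rewrite -linearB; apply: le_lt_trans (L_contractive _) _.
    rewrite -j_isometric linearB /=.
    have -> : j (u m) - j (v n) = (j (u m) - P) - (j (v n) - P) by abel.
    by apply: le_lt_trans (cnormB _ _) _; lra.
  have [l hl] := @cnorm_complete R B (fun n => L (v n)) (dist _ hv).
  exists l => u hu e e0; have e2 : 0 < e / 2 by lra.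
  have [n0 h0] := hl _ e2; have [n1 h1] := dist _ hu _ e2.
  exists (maxn n0 n1) => n; rewrite geq_max => /andP[k0 k1].
  have -> : L (u n) - l = (L (u n) - L (v n)) + (L (v n) - l) by abel.
  apply: le_lt_trans (cnormD _ _) _.
  have := h0 _ k0; have := h1 _ _ k1 k1; lra.
have [E hE] := choice h.
have E_linear : linear E.
  move=> c P Q; have [u hu] := dense_seq P; have [v hv] := dense_seq Q.
  have hw : tends (fun n => j (c *: u n + v n)) (c *: P + Q).
    by apply: tends_ext (tendsD (tendsZ c hu) hv) => n; rewrite linearP.
  apply: tends_uniq (hE _ _ hw) _.
  apply: tends_ext (tendsD (tendsZ c (hE _ _ hu)) (hE _ _ hv)) => n.
  by rewrite linearP.
pose m := GRing.isLinear.Build R[i] M B _ E E_linear.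
pose E' : {linear M -> B} := HB.pack E m.
by exists E' => u P; exact: hE.
Qed.

End Extension.

Section GNS.
Variables (R : realType) (B : cstarAlgType R) (nu : ncpoly B -> B).
Hypothesis hnu : Sigma_alg nu.
Hypothesis pos : forall P, positive (nu (nc_star P * P)).
Hypothesis growth : geometric (moments nu).
Implicit Types (P Q S : ncpoly B).

Let nu_linear : linear nu. Proof. by case: hnu. Qed.
HB.instance Definition _ := GRing.isLinear.Build R[i] (ncpoly B) B _ nu nu_linear.

Lemma nc_starZ (c : R[i]) P : nc_star (c *: P) = conjc c *: nc_star P.
Proof.
have h (k : R[i]) Q : k *: Q = ncC (k *: 1) * Q by rewrite linearZ /= -scalerAl ncC1 mul1r.
have h' (k : R[i]) Q : k *: Q = Q * ncC (k *: 1) by rewrite linearZ /= -scalerAr ncC1 mulr1.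
by rewrite h nc_starM nc_starC starZE star1 -h'.
Qed.

(** ** The seminorm of the Hilbert module *)

Definition vn P : R := Num.sqrt (cnorm (nu (nc_star P * P))).

Lemma vn_ge0 P : 0 <= vn P. Proof. exact: sqrtr_ge0. Qed.

Lemma vn_sq P : vn P ^+ 2 = cnorm (nu (nc_star P * P)).
Proof. by rewrite sqr_sqrtr ?cnorm_ge0. Qed.

Lemma le_sqr (x y : R) : 0 <= y -> x ^+ 2 <= y ^+ 2 -> x <= y.
Proof. by move=> y0 h; rewrite leNgt; apply/negP => lt; nra. Qed.

Lemma vn_cs P Q : cnorm (nu (nc_star P * Q)) <= vn P * vn Q.
Proof.
apply: le_sqr; first by rewrite mulr_ge0 ?vn_ge0.
rewrite exprMn !vn_sq.
exact: (pdk_cauchy_schwarz (K := fun P Q => nu (nc_star P * Q)) (pdk_dist hnu pos)).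
Qed.

Lemma vnD P Q : vn (P + Q) <= vn P + vn Q.
Proof.
apply: le_sqr; first by rewrite addr_ge0 ?vn_ge0.
rewrite vn_sq nc_starD mulrDl !mulrDr !raddfD /=.
have := vn_cs P P; have := vn_cs P Q; have := vn_cs Q P; have := vn_cs Q Q.
have := cnormD (nu (nc_star P * P)) (nu (nc_star P * Q)).
have := cnormD (nu (nc_star Q * P)) (nu (nc_star Q * Q)).
have := cnormD (nu (nc_star P * P) + nu (nc_star P * Q)) (nu (nc_star Q * P) + nu (nc_star Q * Q)).
nra.
Qed.

Lemma cnormZ_norm (A : cstarAlgType R) (c : R[i]) (r : R) (x : A) :
  `|c| = r%:C -> cnorm (c *: x) = r * cnorm x.
Proof. by move=> rc; apply/complexI; rewrite cnormZ rc rmorphM. Qed.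

Lemma vnZ (c : R[i]) (r : R) P : 0 <= r -> `|c| = r%:C -> vn (c *: P) = r * vn P.
Proof.
move=> r0 rc; apply/eqP; rewrite -(eqrXn2 (n := 2)) ?mulr_ge0 ?vn_ge0 // exprMn !vn_sq.
rewrite nc_starZ -scalerAl -scalerAr !linearZ /=.
have rc' : `|conjc c| = r%:C by rewrite -rc norm_conjC.
by rewrite (cnormZ_norm _ rc') (cnormZ_norm _ rc) mulrA -expr2.
Qed.

Lemma vnZr (r : R) P : 0 <= r -> vn (r%:C *: P) = r * vn P.
Proof.
by move=> r0; apply: vnZ => //; rewrite normc_def /= expr0n addr0 sqrtr_sqr ger0_norm.
Qed.

Lemma vn1 : vn 1 = 1.
Proof.
have -> : vn 1 = vn (ncC 1) by rewrite ncC1.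
by rewrite /vn nc_starC star1 -ncC_mul mul1r (distC hnu) cnorm1 sqrtr1.
Qed.

(** ** Left multiplications are bounded *)

Definition bounds P (c : R) : Prop := 0 <= c /\ forall Q, vn (P * Q) <= c * vn Q.

Lemma boundsD P Q c d : bounds P c -> bounds Q d -> bounds (P + Q) (c + d).
Proof.
move=> [c0 hc] [d0 hd]; split=> [|S]; first exact: addr_ge0.
by rewrite !mulrDl; apply: le_trans (vnD _ _) _; rewrite lerD ?hc ?hd.
Qed.

Lemma boundsM P Q c d : bounds P c -> bounds Q d -> bounds (P * Q) (c * d).
Proof.
move=> [c0 hc] [d0 hd]; split=> [|S]; first exact: mulr_ge0.
by rewrite -!mulrA; apply: le_trans (hc _) _; rewrite ler_wpM2l.
Qed.

(** The difference [|b|^2 - b^* b] is a square [d^* d], so that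
    [nu (Q^* b^* b Q)] is at most [|b|^2 nu (Q^* Q)]. *)
Lemma bounds_ncC b : bounds (ncC b) (cnorm b).
Proof.
split=> [|Q]; first exact: cnorm_ge0.
apply: le_sqr; first by rewrite mulr_ge0 ?vn_ge0 ?cnorm_ge0.
have /positiveP[d de] : psd ((cnorm b ^+ 2)%:B - star b * b).
  by apply: psd_sub_norm; [exact/psd_sa/psd_starM | rewrite cnorm_starM].
have h : nu (nc_star (ncC d * Q) * (ncC d * Q)) =
    (cnorm b ^+ 2)%:C *: nu (nc_star Q * Q) - nu (nc_star (ncC b * Q) * (ncC b * Q)).
  have e x : nc_star (ncC x * Q) * (ncC x * Q) = nc_star Q * (ncC (star x * x) * Q).
    by rewrite nc_starM nc_starC ncC_mul !mulrA.
  rewrite !e -de linearB linearZ /= ncC1 mulrBl mulrBr linearB /=.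
  by rewrite -scalerAl mul1r -scalerAr linearZ.
have h1 : psd (nu (nc_star (ncC b * Q) * (ncC b * Q))) by apply/positiveP/pos.
have h2 : psd (nu (nc_star (ncC d * Q) * (ncC d * Q))) by apply/positiveP/pos.
rewrite h in h2; have := psd_norm_le h1 h2.
by rewrite cnormZ_ge0 ?exprn_ge0 ?cnorm_ge0 // exprMn !vn_sq.
Qed.

Lemma wpoly_ncX n (s : seq B) a b t : wpoly (s ++ [:: a]) * (ncX ^+ n.+1 * wpoly (b :: t)) =
  wpoly (s ++ a :: nseq n 1 ++ b :: t).
Proof.
elim: n s a => [|n IH] s a.
  rewrite expr1 /= -[a in RHS]mulr1 -wpoly_cat; congr (_ * _).
  by rewrite wpoly_cons ncC1 mul1r.
have -> : ncX ^+ n.+2 * wpoly (b :: t) = wpoly [:: 1; 1] * (ncX ^+ n.+1 * wpoly (b :: t)).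
  by rewrite exprS mulrA.
by rewrite (IH [:: 1] 1) /= wpoly_cat mulr1.
Qed.

Lemma norms_nseq n : norms (nseq n (1 : B)) = 1.
Proof. by elim: n => [|n IH]; rewrite ?[norms _]big_nil // norms_cons cnorm1 IH mulr1. Qed.

Lemma pair_growth : exists2 c : R, 0 < c & forall P Q, exists2 C : R, 0 <= C &
  forall n, cnorm (nu (P * (ncX ^+ n.+1 * Q))) <= C * c ^+ n.
Proof.
have [A [c [A0 c0 hc]]] := growth; exists c => // P Q.
elim/ncpoly_ind: P => p; elim/ncpoly_ind: Q => q.
have word_growth (v w : word B) : exists2 C : R, 0 <= C &
    forall n, cnorm (nu (wpoly (wseq v) * (ncX ^+ n.+1 * wpoly (wseq w)))) <= C * c ^+ n.
  case: v w => [a s] [b t]; rewrite /wseq /= lastI -cats1.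
  set s' := belast a s; set a' := last a s.
  pose r := s' ++ a' :: b :: t.
  exists (A * (c ^+ size r * norms r)) => [|n].
    by rewrite !mulr_ge0 ?norms_ge0 ?exprn_ge0 // ltW.
  rewrite wpoly_ncX; apply: le_trans (hc _) _.
  rewrite -mulrA ler_pM2l // /r !(size_cat, norms_cat, norms_cons, size_nseq, norms_nseq) /=.
  rewrite !(size_cat, norms_cat, norms_cons, size_nseq, norms_nseq) /=.
  rewrite (_ : (size s' + (n + (size t).+1).+1 = size s' + (size t).+2 + n)%N); last by lia.
  by rewrite exprD mul1r mulrAC.
elim: p => [|v p [C C0 IH]].
  by exists 0 => // n; rewrite big_nil mul0r raddf0 cnorm0 mul0r.
have [D D0 hD] : exists2 D : R, 0 <= D &
    forall n, cnorm (nu (wpoly (wseq v) * (ncX ^+ n.+1 * \sum_(w <- q) wpoly (wseq w)))) <= D * c ^+ n.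
  elim: (q) => [|w l [D D0 IHq]].
    by exists 0 => // n; rewrite big_nil !mulr0 raddf0 cnorm0 mul0r.
  have [E E0 hE] := word_growth v w; exists (E + D) => [|n]; first exact: addr_ge0.
  rewrite big_cons !mulrDr raddfD mulrDl; apply: le_trans (cnormD _ _) _.
  by rewrite lerD ?hE ?IHq.
exists (D + C) => [|n]; first exact: addr_ge0.
rewrite big_cons mulrDl raddfD mulrDl; apply: le_trans (cnormD _ _) _.
by rewrite lerD ?hD ?IH.
Qed.

(** The sequence [vn (X^n Q)] is log-convex, so that a first ratio exceeding the
    geometric rate of the moments would propagate. *)
Lemma bounds_ncX : exists c, bounds ncX c.
Proof.
have [c c0 hc] := pair_growth; exists c; split=> [|Q]; first exact: ltW.
pose v n := vn (ncX ^+ n * Q); rewrite -[ncX * Q]/(ncX ^+ 1 * Q) -/(v 1).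
have v0 : v 0%N = vn Q by rewrite /v expr0 mul1r.
have starX n : nc_star (ncX ^+ n * Q) = nc_star Q * ncX ^+ n.
  rewrite nc_starM; congr (_ * _); elim: n => [|n IH]; first by rewrite expr0 -ncC1 nc_starC star1.
  by rewrite [in LHS]exprS nc_starM IH nc_starX -exprSr.
have inner m n : nu (nc_star (ncX ^+ m * Q) * (ncX ^+ n * Q)) =
    nu (nc_star Q * (ncX ^+ (m + n) * Q)).
  by rewrite starX exprD !mulrA.
have cx n : v n.+1 ^+ 2 <= v n * v n.+2.
  rewrite /v vn_sq; apply: le_trans (vn_cs _ _).
  by rewrite (inner n.+1 n.+1) (inner n n.+2) addSnnS.
have vge n : 0 <= v n by exact: vn_ge0.
rewrite -v0 leNgt; apply/negP => lt.
have v1 : 0 < v 1%N by apply: le_lt_trans lt; rewrite mulr_ge0 // ltW.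
have v0p : 0 < v 0%N.
  rewrite lt_def vge andbT; apply/eqP => z; have := vn_cs (ncX ^+ 0 * Q) (ncX ^+ 2 * Q).
  rewrite -/(v 0%N) z mul0r inner; have := vn_sq (ncX ^+ 1 * Q); rewrite -/(v 1%N) inner.
  by move=> <-; nra.
have ratio n : v 1%N * v n <= v 0%N * v n.+1.
  elim: n => [|n IH]; first by rewrite mulrC.
  have [z|z] := eqVneq (v n.+1) 0; first by rewrite z mulr0 mulr_ge0.
  have zp : 0 < v n.+1 by rewrite lt_def z vge.
  rewrite -(ler_pM2r zp) -mulrA -expr2.
  have := ler_wpM2l (vge 1%N) (cx n); have := ler_wpM2r (vge n.+2) IH; lra.
pose q := v 1%N / v 0%N; have qc : c < q by rewrite ltr_pdivlMr.
have grow n : q ^+ n * v 0%N <= v n.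
  elim: n => [|n IH]; first by rewrite mul1r.
  have h : q * v n <= v n.+1.
    by rewrite -(ler_pM2l v0p) mulrA [v 0%N * q]mulrC divfK ?gt_eqF ?ratio.
  by apply: le_trans h; rewrite exprS -mulrA ler_wpM2l // ltW // (lt_trans c0).
have [C C0 hC] := hc (nc_star Q) Q.
have up n : v n.+1 ^+ 2 <= C * c * (c ^+ n) ^+ 2.
  rewrite /v vn_sq inner addSn.
  apply: le_trans (hC _) _; rewrite addnS exprS mulrA exprD expr2; lra.
pose x := q / c; have x1 : 1 < x by rewrite ltr_pdivlMr // mul1r.
pose D := C * c / (q * v 0%N) ^+ 2.
have q0 : 0 < q by exact: lt_trans qc.
have qv : 0 < (q * v 0%N) ^+ 2 by rewrite exprn_gt0 // mulr_gt0.
have small n : (x ^+ n) ^+ 2 <= D.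
  rewrite ler_pdivlMr // -exprMn expr_div_n.
  have cn : 0 < c ^+ n by rewrite exprn_gt0.
  rewrite -[leRHS](mulfK (x := (c ^+ n) ^+ 2)) ?expf_neq0 ?gt_eqF // ler_pdivlMr ?exprn_gt0 //.
  apply: le_trans (up n); rewrite -exprMn; apply: lerXn2r; rewrite ?nnegrE ?vge //.
    by rewrite !mulr_ge0 ?invr_ge0 ?exprn_ge0 // ?ltW.
  apply: le_trans (grow n.+1); rewrite exprS.
  by rewrite mulrAC divfK ?gt_eqF // mulrA [q ^+ n * q]mulrC.
have x10 : 0 < x - 1 by lra.
have D0 : 0 <= D by apply: le_trans (small 0%N); exact: sqr_ge0.
pose n := Num.bound (D / (x - 1)).
have hn : D < n%:R * (x - 1) by rewrite -ltr_pdivrMr // archi_boundP // divr_ge0 // ltW.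
have := small n; have := bernoulli n (ltW (lt_trans ltr01 x1)); move: (x ^+ n) => y; nra.
Qed.

Lemma bounds_exist P : exists c, bounds P c.
Proof.
have [x hx] := bounds_ncX; elim/ncpoly_ind: P => p.
elim: p => [|[b s] p [c hc]].
  by exists 0; rewrite big_nil; split=> // Q; rewrite !mul0r -[0](scale0r 1) (vnZr _ (lexx 0)) mul0r.
have [d hd] : exists d, bounds (wpoly (b :: s)) d.
  elim: s b => [|a s IH] b; first by exists (cnorm b); exact: bounds_ncC.
  have [d hd] := IH a; exists (cnorm b * (x * d)); rewrite wpoly_cons.
  exact: boundsM (bounds_ncC _) (boundsM hx hd).
by exists (d + c); rewrite big_cons; exact: boundsD.
Qed.

(** ** The operator seminorm *)

(** The norm of left multiplication by [P] on the Hilbert module. Adjointability of this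
    multiplication gives the C*-identity. *)
Definition opn P : R := inf [set c | bounds P c]%classic.

Lemma opn_le P c : bounds P c -> opn P <= c.
Proof. by move=> h; apply: ge_inf => //; exists 0 => d []. Qed.

Lemma opnP P : bounds P (opn P).
Proof.
have [c hc] := bounds_exist P.
have ne : ([set c | bounds P c] !=set0)%classic by exists c.
split; first by apply: lb_le_inf => // d [].
move=> Q; have [z|z] := eqVneq (vn Q) 0.
  by rewrite z mulr0 -(mulr0 c) -z; exact: hc.2.
have zp : 0 < vn Q by rewrite lt_def z vn_ge0.
by rewrite -ler_pdivrMr //; apply: lb_le_inf => // d [_ hd]; rewrite ler_pdivrMr.
Qed.

Lemma opn_ge0 P : 0 <= opn P. Proof. by case: (opnP P). Qed.

Lemma opnD P Q : opn (P + Q) <= opn P + opn Q.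
Proof. by apply/opn_le/boundsD; exact: opnP. Qed.

Lemma opnM P Q : opn (P * Q) <= opn P * opn Q.
Proof. by apply/opn_le/boundsM; exact: opnP. Qed.

Lemma opnZ (c : R[i]) P : (opn (c *: P))%:C = `|c| * (opn P)%:C.
Proof.
have le (k : R[i]) (r : R) Q : 0 <= r -> `|k| = r%:C -> opn (k *: Q) <= r * opn Q.
  move=> r0 rk; apply: opn_le; split=> [|S]; first by rewrite mulr_ge0 ?opn_ge0.
  by rewrite -scalerAl (vnZ _ r0 rk) -mulrA ler_wpM2l //; exact: (opnP Q).2.
have [r r0 rc] := norm_real c; rewrite rc -rmorphM; congr (_%:C); apply/eqP.
rewrite eq_le le //=; have [z|z] := eqVneq r 0; first by rewrite z mul0r opn_ge0.
have rp : 0 < r by rewrite lt_def z.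
have c0 : c != 0 by rewrite -normr_eq0 rc; apply/eqP => -[] /eqP; rewrite (negPf z).
have rc' : `|c^-1| = (r^-1)%:C by rewrite normfV rc fmorphV.
have := le _ _ (c *: P) (ltW (_ : 0 < r^-1)) rc'; rewrite scalerA mulVf // scale1r invr_gt0.
by move=> /(_ rp); rewrite mulrC ler_pdivlMr // mulrC.
Qed.

Lemma opn_starM P : opn (nc_star P * P) = opn P ^+ 2.
Proof.
have sq Q : opn Q ^+ 2 <= opn (nc_star Q * Q).
  rewrite -[leRHS]sqr_sqrtr ?opn_ge0 //; apply: lerXn2r; rewrite ?nnegrE ?opn_ge0 ?sqrtr_ge0 //.
  apply: opn_le; split=> [|S]; first exact: sqrtr_ge0.
  apply: le_sqr; first by rewrite mulr_ge0 ?sqrtr_ge0 ?vn_ge0.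
  rewrite vn_sq exprMn (sqr_sqrtr (opn_ge0 _)) nc_starM -mulrA (mulrA (nc_star Q)).
  apply: le_trans (vn_cs _ _) _; have := (opnP (nc_star Q * Q)).2 S.
  by move=> /(ler_wpM2l (vn_ge0 S)); rewrite expr2 mulrCA.
have le Q : opn Q <= opn (nc_star Q).
  have := le_trans (sq Q) (opnM _ _); have := opn_ge0 Q; have := opn_ge0 (nc_star Q).
  rewrite expr2 le_eqVlt => /predU1P[<-|h] q0; first by rewrite mul0r; nra.
  have [->|z] := eqVneq (opn Q) 0; first by move=> _; exact: ltW.
  by rewrite ler_pM2r // lt_def z.
apply/eqP; rewrite eq_le sq andbT; apply: le_trans (opnM _ _) _.
by rewrite expr2 ler_wpM2r ?opn_ge0 // -{2}(nc_starK P) le.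
Qed.

Lemma opn_ncC b : opn (ncC b) = cnorm b.
Proof.
apply/eqP; rewrite eq_le opn_le /=; last exact: bounds_ncC.
have := (opnP (ncC b)).2 1; rewrite vn1 !mulr1; apply: le_trans.
by apply: le_sqr; rewrite ?vn_ge0 // vn_sq nc_starC -ncC_mul (distC hnu) cnorm_starM.
Qed.

Lemma opn1_neq0 : opn 1 <> 0.
Proof. by rewrite -ncC1 opn_ncC cnorm1; apply/eqP; exact: oner_neq0. Qed.

Definition opn_cseminorm : cseminorm R := @CSeminorm R (ncpoly B) opn (@nc_star R B)
  opnD opnZ opnM (@nc_starK R B) (@nc_starD R B) nc_starZ (@nc_starM R B) opn_starM opn1_neq0.

Lemma nu_contractive P : cnorm (nu P) <= opn P.
Proof.
have := vn_cs 1 P; rewrite -ncC1 nc_starC star1 ncC1 mul1r vn1 mul1r => h.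
by apply: le_trans h _; have := (opnP P).2 1; rewrite vn1 !mulr1.
Qed.

(** The completion of the polynomials for the operator seminorm is a C*-algebra to which
    [nu] extends by Schwarz's inequality; the coefficients embed isometrically since
    [nu] is the identity on them. *)
Theorem Sigma0_of_geometric : Sigma0 nu.
Proof.
split=> //; have [M [j [iso jstar dense]]] := cstar_completion opn_cseminorm.
pose L : {linear cs_alg opn_cseminorm -> B} := nu.
have [E hE] := extension (j := j) (L := L) iso dense nu_contractive.
have Ej x : E (j x) = nu x.
  exact: tends_uniq (hE (fun=> x) _ (tends_cst _)) (tends_cst _).
pose f (b : B) : M := j (ncC b).
have f_linear : linear f by move=> c x y; rewrite /f !linearP.
have f_mul : monoid_morphism f.
  by split=> [|x y]; rewrite /f ?ncC1 ?rmorph1 // ncC_mul rmorphM.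
pose iota : {lrmorphism B -> M} := HB.pack f
  (GRing.isLinear.Build R[i] B M _ f f_linear) (GRing.isMonoidMorphism.Build B M f f_mul).
exists M, iota, E, (j ncX); split.
- split.
  + split=> b; last by rewrite /= /f iso /= opn_ncC.
    by rewrite /= /f jstar /= nc_starC.
  + by rewrite -(rmorph1 j) Ej -ncC1 (distC hnu).
  + move=> m [d ->]; apply/positiveP.
    have [u hu] := dense_seq dense d.
    apply: (psd_lim (u := fun n => nu (nc_star (u n) * u n))).
      by move=> n; apply/positiveP/pos.
    apply: (hE (fun n => nc_star (u n) * u n)).
    by apply: tends_ext (tendsM (tends_star hu) hu) => n; rewrite rmorphM jstar.
  + move=> a b m; have [u hu] := dense_seq dense m.
    apply: (tends_uniq (u := fun n => nu (ncC a * u n * ncC b))).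
      apply: (hE (fun n => ncC a * u n * ncC b)).
      by apply: tends_ext (tends_mulr _ (tends_mull _ hu)) => n; rewrite !rmorphM.
    apply: tends_ext (tends_mulr _ (tends_mull _ (hE _ _ hu))) => n.
    by case: hnu => _ -> _.
- by rewrite jstar /= nc_starX.
- move=> b0 bs; rewrite -Ej; congr (E _); rewrite /monomial rmorphM rmorph_prod.
  by congr (_ * _); apply: eq_bigr => b _; rewrite rmorphM.
Qed.

End GNS.

(** * Bounded distributions *)

Section Bounded.
Variables (R : realType) (B : cstarAlgType R).

(** The bimodule property absorbs the coefficients into the points. *)
Lemma expectation_kernel (M : cstarAlgType R) (iota : {lrmorphism B -> M}) (E : {linear M -> B}) :
  cstar_prob_space iota E -> pdk predT (fun x y : M => E (star x * y)).
Proof.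
move=> [[iota_star _] _ pos bim] l _.
have /positiveP : positive (E (star (\sum_(p <- l) p.1 * iota p.2) * (\sum_(p <- l) p.1 * iota p.2))).
  by apply: pos; exists (\sum_(p <- l) p.1 * iota p.2).
congr psd; rewrite star_sum mulr_suml raddf_sum; apply: eq_bigr => p _.
rewrite mulr_sumr raddf_sum; apply: eq_bigr => q _ /=.
by rewrite starM -iota_star mulrA -(mulrA (iota _)) bim.
Qed.

(** The expectation is a contraction, by Schwarz's inequality for its kernel. *)
Lemma Sigma0_moments (mu : ncpoly B -> B) : Sigma0 mu -> exists2 c : R, 0 < c &
  forall b s, cnorm (moments mu (b :: s)) <= cnorm b * (c ^+ size s * norms s).
Proof.
move=> [hmu [M [iota [E [X [hE sX hX]]]]]].
exists (cnorm X + 1) => [|b s]; first by rewrite ltr_wpDl ?cnorm_ge0.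
have [[_ iota_norm] E1 _ _] := hE.
rewrite /moments -monomialE hX; apply: le_trans (cp_bounded (expectation_kernel hE) _) _.
rewrite E1 cnorm1 mul1r /monomial; apply: le_trans (cnormM _ _) _.
rewrite iota_norm ler_wpM2l ?cnorm_ge0 //.
elim: s => [|a s IH]; first by rewrite big_nil cnorm1 mul1r /norms big_nil.
rewrite big_cons norms_cons /= exprS.
rewrite (_ : _ * _ = (cnorm X + 1) * cnorm a * ((cnorm X + 1) ^+ size s * norms s)); last by ring.
apply: le_trans (cnormM _ _) _; apply: ler_pM; rewrite ?cnorm_ge0 //.
apply: le_trans (cnormM _ _) _; rewrite iota_norm ler_wpM2r ?cnorm_ge0 //.
by rewrite lerDl ler01.
Qed.

Lemma geometric_moments (mu : ncpoly B -> B) (c : R) : 0 < c -> Sigma_alg mu ->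
  (forall b s, cnorm (moments mu (b :: s)) <= cnorm b * (c ^+ size s * norms s)) ->
  geometric (moments mu).
Proof.
move=> c0 hmu h; exists c^-1, c; split; rewrite ?invr_gt0 // => -[|b s].
  rewrite (moments_nil hmu) cnorm0 mulr_ge0 ?invr_ge0 ?mulr_ge0 ?exprn_ge0 ?norms_ge0 ?ltW //.
apply: le_trans (h _ _) _; rewrite norms_cons /= exprS !mulrA mulVf ?gt_eqF // mul1r.
by rewrite [cnorm b * _]mulrC.
Qed.

Lemma power_geometric (mu : ncpoly B -> B) (beta : {linear B -> B}) :
  completely_positive beta -> Sigma0 mu ->
  geometric (comp (moments mu) (tau_moments mu beta)).
Proof.
move=> beta_cp h0; have hmu : Sigma_alg mu by case: h0.
have [c c0 hc] := Sigma0_moments h0.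
have hbeta : pdk predT (fun x y : B => beta (star x * y)).
  exact: (pdk_pullback (f := fun x : B => (x, tt))) (cp_kernel beta_cp).
apply: (mom_geometric (cnorm_ge0 (beta 1)) (cp_bounded hbeta)).
- exists c, (2 * c); split=> //; first by rewrite mulr_gt0.
  exact: boolean_cumulants_bound (moments_boolean hmu) c0 hc.
- exact: (tau_boolean mu beta).
- exact: geometric_moments c0 hmu hc.
Qed.

End Bounded.

Theorem theorem7p9 (R : realType) (B : cstarAlgType R)
    (mu : ncpoly B -> B) (alpha : {linear B -> B}) :
  Sigma mu ->
  completely_positive alpha ->
  completely_positive (fun b : B => alpha b - b) ->
  Sigma (boxplus_pow mu alpha)
  /\ (Sigma0 mu -> Sigma0 (boxplus_pow mu alpha)).
Proof.
move=> [hmu pos] _ hbeta; pose beta : {linear B -> B} := alpha \- idfun.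
have beta_cp : completely_positive beta by [].
have [hnu e] := boxplus_powP alpha hmu.
have {}e : moments (boxplus_pow mu alpha) = comp (moments mu) (tau_moments mu beta).
  apply/funext => s; rewrite e; apply: (power_moments hmu) => x.
  by rewrite /= addrC subrK.
have hpos P : positive (boxplus_pow mu alpha (nc_star P * P)).
  by apply: (positive_of_kernel hnu); rewrite e; exact: power_kernel.
split=> // h0; apply: (Sigma0_of_geometric hnu hpos).
by rewrite e; exact: power_geometric.
Qed.
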